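(* Let $A\in \mathrm{SL}(2,\mathbb{Z})$ with $|\mathrm{tr}(A)|>2$ and $A\equiv\begin{pmatrix}1&0\\0&1\end{pmatrix}$ or $\begin{pmatrix}0&1\\1&0\end{pmatrix}\bmod 2$, acting on $\mathbb{T}^2=\mathbb{R}^2/\mathbb{Z}^2$. Let $\mu$ be a normalized $A$-invariant Borel measure on $\mathbb{T}^2$, and $(\mathcal{F},w)$ a finite weighted set of periodic orbits of $A$. Then $\mu$ may be decomposed into $\mu=\beta\,\delta_{\mathcal{F},w}+(1-\beta)\,\nu$, where $0\le\beta\le 1$ and $\nu$ is a normalized $A$-invariant measure satisfying $\nu(\mathcal{S}_{\mathcal{F}})=0$. If $\mu$ is a semiclassical measure of $A$, then its Lebesgue component has a weight $\geq\beta$, which in turn implies $\beta\leq 1/2$.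
   Context: **Weighted sets of orbits.** A finite weighted set $(\mathcal{F},w)$ of periodic orbits is a finite set $\mathcal{F}$ of periodic orbits of $A$ with weights $w_\tau>0$, $\sum_{\tau\in\mathcal{F}}w_\tau=1$. For an orbit $\tau$ of period $T_\tau$, $\delta_\tau=\frac1{T_\tau}\sum_{x\in\tau}\delta_x$; $\delta_{\mathcal{F},w}=\sum_{\tau\in\mathcal{F}}w_\tau\delta_\tau$; $\mathcal{S}_{\mathcal{F}}=\bigcup_{\tau\in\mathcal{F}}\tau$. The measure $\nu$ need not be continuous (it may have a pure point component on periodic orbits not in $\mathcal{F}$). The Lebesgue component of $\mu$ is its absolutely continuous part (a constant multiple of Lebesgue measure, by ergodicity of $A$), and its weight is its total mass. Normalized means of total mass 1. **Hilbert space.** Planck's constant $h=2\pi\hbar$ takes values with $N=h^{-1}\in\mathbb{N}^*$. $\mathcal{H}_h\simeq\mathbb{C}^{N}$ is the space of tempered distributions $\psi$ on $\mathbb{R}$ with $\psi(q+1)=\psi(q)$ and $\tilde\psi(k+N)=\tilde\psi(k)$, where $\tilde\psi$ is the Fourier transform of $\psi$. Equivalently, $\psi=\sum_{j\in\mathbb{Z}}c_j\,\delta(q-j/N)$ with $c_{j+N}=c_j$, and the inner product is $\langle\psi|\psi'\rangle=\sum_{j=0}^{N-1}\overline{c_j}\,c'_j$. **Quantum translations.** For $\mathbf{k}=(k_1,k_2)\in\mathbb{Z}^2$, $\hat T_{h\mathbf{k}}$ is the unitary operator on $\mathcal{H}_h$ given by $(\hat T_{h\mathbf{k}}c)_j=e^{-\pi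 i k_1k_2/N}e^{2\pi i k_2 j/N}c_{j-k_1}$ (the Weyl quantization of $F_{\mathbf{k}}(q,p)=e^{-2\pi i(k_1p-k_2q)}$). **Quantum automorphism.** $\hat A_h$ is the unitary operator on $\mathcal{H}_h$, unique up to a phase, satisfying $\hat A_h\hat T_{h\mathbf{k}}\hat A_h^{-1}=\hat T_{hA\mathbf{k}}$ for all $\mathbf{k}\in\mathbb{Z}^2$. It exists for every $h^{-1}\in\mathbb{N}^*$ under the stated condition on $A\bmod2$. **Coherent states.** For $x=(q_0,p_0)$, $|x\rangle\in\mathcal{H}_h$ is the state with coefficients $c_j=N^{-1/2}\sum_{m\in\mathbb{Z}}g_x(j/N+m)$, where $g_x(q)=(\pi\hbar)^{-1/4}e^{-iq_0p_0/(2\hbar)}e^{ip_0q/\hbar}e^{-(q-q_0)^2/(2\hbar)}$. Changing $x$ by an element of $\mathbb{Z}^2$ only changes $|x\rangle$ by a phase, and $\int_{\mathbb{T}^2}\frac{dx}{h}|x\rangle\langle x|=\mathrm{Id}$. **Husimi measure.** The Husimi measure of $|\psi_h\rangle\in\mathcal{H}_h$ is $\mu_h(f)=\int_{\mathbb{T}^2}\frac{dx}{h}\,|\langle\psi_h|x\rangle|^2 f(x)$. **Semiclassical measures.** A sequence of states $\{|\psi_h\rangle\in\mathcal{H}_h\}_{h\to0}$ (along some sequence $h\to0$, $h^{-1}\in\mathbb{N}^*$) converges to the Borel measure $\mu$ on $\mathbb{T}^2$ iff $\mu_h(f)\to\mu(f)$ for every $f\in C^\infty(\mathbb{T}^2)$.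 $\mu$ is a semiclassical measure of $A$ iff there is a sequence $h\to0$ and normalized eigenstates $|\psi_h\rangle$ of $\hat A_h$ converging to $\mu$.
   Formalization: The existence of the decomposition is claimed only when μ(τ)=w_τ μ(S_F) for every τ in F, which is necessary and sufficient; it fails otherwise, e.g. for μ=δ_{τ1}, F={τ1,τ2}, w=(1/2,1/2). The bounds are proved for every such decomposition. *)

(* Defs.v *)
From HB Require Import structures.
From mathcomp Require Import all_boot all_order all_algebra finmap.
From mathcomp Require Import complex.
From mathcomp Require Import lra.
From mathcomp Require Import all_classical all_reals all_analysis.

Set Implicit Arguments.
Unset Strict Implicit.
Unset Printing Implicit Defensive.

Import Order.TTheory GRing.Theory Num.Theory.
Import numFieldNormedType.Exports.

Local Open Scope classical_set_scope.
Local Open Scope ring_scope.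
Local Open Scope quotient_scope.

Section Torus.
Variable R : realType.

Definition lattice_eqv (x y : R * R) : bool :=
  (x.1 - y.1 \is a Num.int) && (x.2 - y.2 \is a Num.int).

Lemma lattice_eqv_is_equiv : equiv_class_of lattice_eqv.
Proof.
split=> [x|x y|y x z].
- by rewrite /lattice_eqv !subrr !rpred0.
- by rewrite /lattice_eqv -[x.1 - _]opprB -[x.2 - _]opprB !rpredN.
- rewrite /lattice_eqv => /andP[a b] /andP[c d]; apply/andP; split.
  + by rewrite -(subrKA y.1); exact: rpredD.
  + by rewrite -(subrKA y.2); exact: rpredD.
Qed.

Canonical lattice_equiv : equiv_rel (R * R)%type :=
  EquivRelPack lattice_eqv_is_equiv.

Definition torus : Type := quotient_topology {eq_quot lattice_equiv}.

HB.instance Definition _ := Topological.on torus.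
HB.instance Definition _ := Quotient.on torus.
HB.instance Definition _ := isPointed.Build torus (\pi_torus ((0 : R), (0 : R))).
HB.instance Definition _ := Measurable.copy torus
  (g_sigma_algebraType (@open torus)).

Definition torus_proj : R * R -> torus := \pi_torus.

Lemma open_measurable_prod (U : set (R * R)) : open U ->
  measurable (U : set (measurableTypeR R * measurableTypeR R)).
Proof.
move=> oU.
pose B (p q r : rat) : set (R * R) :=
  `]ratr p - ratr r, ratr p + ratr r[%classic `*`
  `]ratr q - ratr r, ratr q + ratr r[%classic.
pose C (p q r : rat) := if `[< B p q r `<=` U >] then B p q r else set0.
have -> : U = \bigcup_p \bigcup_q \bigcup_r C p q r.
  apply/seteqP; split=> [x Ux|x [p _ [q _ [r _]]]]; last first.
    by rewrite /C; case: asboolP => // BU /BU.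
  have /nbhs_ballP[e /= e0 eU] : nbhs x U by exact: open_nbhs_nbhs.
  have [r] := rat_in_itvoo (divr_gt0 e0 (ltr0n R 2)).
  rewrite in_itv /= => /andP[r0 re].
  have lt_pm (y : R) : y - ratr r < y + ratr r.
    by rewrite ltrD2l (lt_trans _ r0)// oppr_lt0.
  have [p] := rat_in_itvoo (lt_pm x.1); rewrite in_itv /= => /andP[p1 p2].
  have [q] := rat_in_itvoo (lt_pm x.2); rewrite in_itv /= => /andP[q1 q2].
  exists p => //; exists q => //; exists r => //; rewrite /C.
  have e2 : e = e / 2 + e / 2 by rewrite -splitr.
  case: asboolP => [_|]; first by rewrite /B /=; split; rewrite in_itv /=; lra.
  case=> y [] /=; rewrite !in_itv /= => /andP[y1 y1'] /andP[y2 y2'].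
  by apply: eU; split; rewrite /ball /= ltr_distl; apply/andP; split; lra.
apply: bigcupT_measurable_rat => p; apply: bigcupT_measurable_rat => q.
apply: bigcupT_measurable_rat => r; rewrite /C; case: asboolP => // _.
by apply: measurableX; exact: measurable_itv.
Qed.

Lemma measurable_torus_proj : measurable_fun setT
  (torus_proj : measurableTypeR R * measurableTypeR R -> torus).
Proof.
apply: (@measurability _ _ _ _ _ _ (@open torus)) => //.
move=> _ [U oU <-]; rewrite setTI; apply: open_measurable_prod.
by move/continuousP: (@pi_continuous _ {eq_quot lattice_equiv}); exact.
Qed.

(* Fundamental domain; Lebesgue measure on the torus is its image under the
   projection, of total mass 1. *)
Definition unit_square : set (measurableTypeR R * measurableTypeR R) :=
  `[0, 1[%classic `*` `[0, 1[%classic.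

Lemma measurable_unit_square : measurable unit_square.
Proof. by apply: measurableX; exact: measurable_itv. Qed.

Definition torus_lebesgue : set torus -> \bar R :=
  pushforward
    (mrestr (lebesgue_measure \x lebesgue_measure)%E measurable_unit_square)
    torus_proj.

Let torus_lebesgue0 : torus_lebesgue set0 = 0%E.
Proof. by rewrite /torus_lebesgue /pushforward preimage_set0 measure0. Qed.

Let torus_lebesgue_ge0 B : (0 <= torus_lebesgue B)%E.
Proof. by rewrite /torus_lebesgue /pushforward; exact: measure_ge0. Qed.

Let torus_lebesgue_sigma_additive : semi_sigma_additive torus_lebesgue.
Proof.
apply: measure_semi_sigma_additive; exact: measurable_torus_proj.
Qed.

HB.instance Definition _ := isMeasure.Build _ _ _ torus_lebesgue
  torus_lebesgue0 torus_lebesgue_ge0 torus_lebesgue_sigma_additive.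

(* [A] has integer entries, so the value does not depend on the
   representative chosen by [repr]. *)
Definition torus_map (A : 'M[int]_2) (x : torus) : torus :=
  let v := repr x in
  torus_proj ((A 0 0)%:~R * v.1 + (A 0 1)%:~R * v.2,
              (A 1 0)%:~R * v.1 + (A 1 1)%:~R * v.2).

Definition invariant_measure (A : 'M[int]_2)
    (mu : {measure set torus -> \bar R}) : Prop :=
  forall B, measurable B -> mu (torus_map A @^-1` B) = mu B.

(* F is of class C^k on the plane. *)
Fixpoint C_k (k : nat) (F : R * R -> R) : Prop :=
  if k is k'.+1 then
    [/\ continuous F,
        forall x, derivable F x (1, 0) /\ derivable F x (0, 1),
        C_k k' (fun x => 'D_((1 : R), (0 : R)) F x) &
        C_k k' (fun x => 'D_((0 : R), (1 : R)) F x)]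
  else continuous F.

Definition torus_smooth (f : torus -> R) : Prop :=
  forall k, C_k k (f \o torus_proj).

(* The absolutely continuous part of [mu] in its (unique) Lebesgue
   decomposition with respect to Lebesgue measure. *)
Definition lebesgue_component
    (mu mac : {measure set torus -> \bar R}) : Prop :=
  mac `<< torus_lebesgue /\
  exists ms : {measure set torus -> \bar R},
    (exists S, [/\ measurable S, torus_lebesgue S = 0%E & ms (~` S) = 0%E]) /\
    forall B, measurable B -> mu B = (mac B + ms B)%E.

End Torus.

Section Orbits.
Variable R : realType.
Local Notation T2 := (torus R).

Definition periodic_orbit (A : 'M[int]_2) (t : {fset T2}) : Prop :=
  exists (x : T2) (n : nat),
    [/\ (0 < n)%N, iter n (torus_map A) x = x &
        forall y, y \in t <-> exists k, y = iter k (torus_map A) x].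

Definition weighted_orbits (A : 'M[int]_2) (F : {fset {fset T2}})
    (w : {fset T2} -> R) : Prop :=
  [/\ forall t, t \in F -> periodic_orbit A t,
      forall t, t \in F -> 0 < w t &
      \sum_(t <- F) w t = 1].

(* The period of an orbit is its number of points. *)
Definition orbit_measure (t : {fset T2}) (B : set T2) : \bar R :=
  ((#|` t|%:R^-1)%:E * \sum_(x <- t) \d_x B)%E.

Definition orbits_measure (F : {fset {fset T2}}) (w : {fset T2} -> R)
    (B : set T2) : \bar R :=
  (\sum_(t <- F) (w t)%:E * orbit_measure t B)%E.

Definition orbits_support (F : {fset {fset T2}}) : set T2 :=
  [set x | exists2 t, t \in F & x \in t].

Definition orbit_decomposition (A : 'M[int]_2) (mu : probability T2 R)
    (F : {fset {fset T2}}) (w : {fset T2} -> R)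
    (beta : R) (nu : probability T2 R) : Prop :=
  [/\ 0 <= beta <= 1, invariant_measure A nu, nu (orbits_support F) = 0%E &
      forall B, measurable B ->
        mu B = (beta%:E * orbits_measure F w B + (1 - beta)%:E * nu B)%E].

End Orbits.

Section Quantum.
Variable R : realType.
Local Notation C := R[i].

Definition expi (t : R) : C := Complex (cos t) (sin t).

Definition sqnorm (z : C) : R := complex.Re z ^+ 2 + complex.Im z ^+ 2.

(* [limn] is taken separately on real and imaginary parts; the coherent-state
   series to which this is applied converges absolutely. *)
Definition zsum (u : int -> C) : C :=
  let S M := \sum_(m < M.*2.+1) u (m%:Z - M%:Z) in
  Complex (limn (fun M => complex.Re (S M))) (limn (fun M => complex.Im (S M))).

(* The state sum_j c_j delta(q - j/N), with c of period N, is represented by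
   the column vector (c_0, ..., c_{N-1}). *)
Definition braket N (phi psi : 'cV[C]_N) : C :=
  \sum_(j < N) (phi j 0)^*%C * psi j 0.

Definition hbar (N : nat) : R := (2 * pi * N%:R)^-1.

(* Column l of row j is selected by l = j - k1 mod N. *)
Definition translation N (k : 'cV[int]_2) : 'M[C]_N :=
  let k1 := k 0 0 in let k2 := k 1 0 in
  \matrix_(j, l)
    (expi (- (pi * (k1 * k2)%:~R / N%:R)) * expi (2 * pi * k2%:~R * j%:R / N%:R) *
     (l%:Z == ((j%:Z - k1) %% N%:Z)%Z)%:R).

(* Determines U up to a phase. *)
Definition quantum_automorphism N (A : 'M[int]_2) (U : 'M[C]_N) : Prop :=
  U \is unitarymx /\
  forall k : 'cV[int]_2,
    U *m translation N k *m invmx U = translation N (A *m k).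

Definition normalized_eigenstate N (A : 'M[int]_2) (psi : 'cV[C]_N) : Prop :=
  braket psi psi = 1 /\
  exists U, quantum_automorphism A U /\ exists lam : C, U *m psi = lam *: psi.

Definition gaussian N (x : R * R) (q : R) : C :=
  real_complex R ((pi * hbar N) `^ (- 4^-1)) *
  expi (- (x.1 * x.2 / (2 * hbar N))) * expi (x.2 * q / hbar N) *
  real_complex R (expR (- ((q - x.1) ^+ 2 / (2 * hbar N)))).

Definition coherent_state N (x : R * R) : 'cV[C]_N :=
  \col_j (real_complex R (Num.sqrt N%:R)^-1 *
          zsum (fun m => gaussian N x (j%:R / N%:R + m%:~R))).

(* mu_h(f). As 1/h = N, the density of the Husimi measure is
   N |<psi|x>|^2; it is Z^2-periodic in x, hence independent of [repr]. *)
Definition husimi N (psi : 'cV[C]_N) (f : torus R -> R) : R :=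
  \int[@torus_lebesgue R]_x
    (N%:R * sqnorm (braket psi (coherent_state N (repr x))) * f x).

Definition semiclassical_measure (A : 'M[int]_2)
    (mu : probability (torus R) R) : Prop :=
  exists (N : nat -> nat) (psi : forall n, 'cV[C]_(N n)),
    [/\ forall n, (0 < N n)%N,
        N n @[n --> \oo] --> \oo,
        forall n, normalized_eigenstate A (psi n) &
        forall f, torus_smooth f ->
          husimi (psi n) f @[n --> \oo] --> \int[mu]_x f x].

End Quantum.

(* Main.v *)
(* Convergence of the Husimi measures is equivalent to convergence of the matrix
   elements <psi|T_k psi> to the Fourier coefficients of mu. Writing
   A^n = b_n A - b_(n-1) with Lucas numbers b_n, choose the first n with
   |b_n| >= 1/h: along a subsequence h A^n k tends to a vector v_k, so that
   T_(A^n k) moves an observable Op(f) by the classical translation v_k, while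
   <psi|T_(A^n k) psi> = <psi|T_k psi> because psi is an eigenstate.
   Let f be a trigonometric polynomial close to the indicator of S = S_F, put
   rho = psi - Op(f) psi, and expand 0 <= || sum_i a_i T_(A^n k_i) rho ||^2.
   The cross terms k_i <> k_j are controlled by the mass that mu puts near the
   translates of S by +v and -v, v = v_(k_j - k_i); it vanishes in the limit,
   since the points of these translates have infinite orbits (v is an irrational
   eigenvector of A), hence are not charged by the finite invariant measure mu.
   What remains is beta * int |a|^2 dLeb <= int |a|^2 dmu with beta = mu(S), for
   every trigonometric polynomial a = sum_i a_i e_(k_i), so mu >= beta Leb.
   Evaluated on the complement of S this reads beta <= 1 - beta. *)

Require Import Defs.
From HB Require Import structures.
From mathcomp Require Import all_boot all_order all_algebra finmap.
From mathcomp Require Import complex.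
From mathcomp Require Import ring lra zify.
From mathcomp Require Import all_classical all_reals all_analysis.
From mathcomp Require Import measurable_realfun.

Set Implicit Arguments.
Unset Strict Implicit.
Unset Printing Implicit Defensive.

Import Order.TTheory GRing.Theory Num.Theory.
Import numFieldNormedType.Exports.

Local Open Scope classical_set_scope.
Local Open Scope ring_scope.

(** * Complex-valued limits and integrals *)

(** The vectors A^n k have size about 1/h, so the phases between the translations T_(A^n k) could
    oscillate without limit. They do not: A preserves the symplectic form, so the phase between
    T_(A^n k) and T_(A^n l) is the one between T_k and T_l, which tends to 1 with h. The choice of n
    is forced. Much earlier, h A^n k tends to 0 and the translation does not move S off itself; much
    later, h A^n k is unbounded. Dividing b_n^2 - t b_n b_(n-1) + b_(n-1)^2 = 1 by 1/h^2 gives x^2 +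
    t x y + y^2 = 0 for the limits x of - h b_(n-1) and y of h b_n. This makes v_k = x k + y A k an
    eigenvector of A, and |y| >= 1 keeps it nonzero. The order of limits matters: a and f stay fixed
    while h tends to 0, then f is sharpened to the indicator of S, and a is varied last. The
    resulting inequality between integrals of |a|^2 passes to Borel sets because trigonometric
    polynomials are dense in L^2 of every finite measure on the torus, in particular of mu + Leb. *)

Section ComplexNumbers.
Variable R : realType.
Local Notation C := R[i].
Implicit Types (z w : C) (t : R).

Lemma ReM z w :
  complex.Re (z * w) = complex.Re z * complex.Re w - complex.Im z * complex.Im w.
Proof. by case: z w => [a b] [c d]. Qed.

Lemma ImM z w :
  complex.Im (z * w) = complex.Re z * complex.Im w + complex.Im z * complex.Re w.
Proof. by case: z w => [a b] [c d]. Qed.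

Lemma ReJ z : complex.Re z^*%C = complex.Re z. Proof. by case: z. Qed.

Lemma ImJ z : complex.Im z^*%C = - complex.Im z. Proof. by case: z. Qed.

Lemma complex_ext z w :
  complex.Re z = complex.Re w -> complex.Im z = complex.Im w -> z = w.
Proof. by case: z w => [a b] [c d] /= -> ->. Qed.

Lemma conjcM z w : (z * w)^*%C = z^*%C * w^*%C.
Proof. exact: rmorphM. Qed.

Lemma conjc_sum (I : finType) (f : I -> C) :
  (\sum_i f i)^*%C = \sum_i (f i)^*%C.
Proof. exact: raddf_sum. Qed.

Lemma Re_conj_ge0 z : z^*%C * z = ((sqnorm z)%:C)%C.
Proof. by case: z => a b; apply: complex_ext; rewrite /sqnorm /=; ring. Qed.

Lemma sqnorm_ge0 z : 0 <= sqnorm z.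
Proof. by rewrite addr_ge0 ?sqr_ge0. Qed.

Lemma sqnorm0 : sqnorm (0 : C) = 0.
Proof. by rewrite /sqnorm /= expr0n addr0. Qed.

Lemma sqnorm1 : sqnorm (1 : C) = 1.
Proof. by rewrite /sqnorm /= expr1n expr0n addr0. Qed.

Lemma sqnormM z w : sqnorm (z * w) = sqnorm z * sqnorm w.
Proof. by case: z w => [a b] [c d]; rewrite /sqnorm /=; ring. Qed.

Lemma sqnormJ z : sqnorm z^*%C = sqnorm z.
Proof. by case: z => a b; rewrite /sqnorm /= sqrrN. Qed.

Lemma sqnormN z : sqnorm (- z) = sqnorm z.
Proof. by case: z => a b; rewrite /sqnorm /= !sqrrN. Qed.

Lemma sqnorm_real t : sqnorm (t%:C)%C = t ^+ 2.
Proof. by rewrite /sqnorm /= expr0n addr0. Qed.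

Lemma normr_Re z : `|complex.Re z| <= Num.sqrt (sqnorm z).
Proof. by rewrite -sqrtr_sqr ler_wsqrtr// lerDl sqr_ge0. Qed.

Lemma normr_Im z : `|complex.Im z| <= Num.sqrt (sqnorm z).
Proof. by rewrite -sqrtr_sqr ler_wsqrtr// lerDr sqr_ge0. Qed.

Lemma sqrt_sqnormD z w :
  Num.sqrt (sqnorm (z + w)) <= Num.sqrt (sqnorm z) + Num.sqrt (sqnorm w).
Proof.
suff : (Num.sqrt (sqnorm (z + w)))%:C%C <=
    (Num.sqrt (sqnorm z) + Num.sqrt (sqnorm w))%:C%C.
  by rewrite lecR.
by rewrite rmorphD /= -!normc_def ler_normD.
Qed.

Lemma sqrt_sqnorm_sum (I : finType) (P : pred I) (f : I -> C) :
  Num.sqrt (sqnorm (\sum_(i | P i) f i)) <= \sum_(i | P i) Num.sqrt (sqnorm (f i)).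
Proof.
elim/big_ind2: _ => //; first by rewrite sqnorm0 sqrtr0.
by move=> z x w y zx wy; rewrite (le_trans (sqrt_sqnormD _ _))// lerD.
Qed.

Lemma expiD t u : expi (t + u) = expi t * expi u.
Proof. by apply: complex_ext => /=; rewrite ?cosD ?sinD// addrC mulrC [X in _ + X]mulrC addrC. Qed.

Lemma expi0 : expi 0 = 1 :> C.
Proof. by rewrite /expi cos0 sin0. Qed.

Lemma expiN t : expi (- t) = (expi t)^*%C.
Proof. by rewrite /expi cosN sinN. Qed.

Lemma sqnorm_expi t : sqnorm (expi t) = 1.
Proof. exact: cos2Dsin2. Qed.

Lemma expiJM t : (expi t)^*%C * expi t = 1.
Proof. by rewrite -expiN -expiD addNr expi0. Qed.

Lemma cos_2pi_nat (n : nat) : cos (2 * pi * n%:R) = 1 :> R.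
Proof.
elim: n => [|n IH]; first by rewrite mulr0 cos0.
have -> : 2 * pi * n.+1%:R = 2 * pi * n%:R + pi *+ 2 :> R.
  by rewrite -addn1 natrD -mulr_natr; ring.
by rewrite cosD2pi.
Qed.

Lemma sin_2pi_nat (n : nat) : sin (2 * pi * n%:R) = 0 :> R.
Proof.
elim: n => [|n IH]; first by rewrite mulr0 sin0.
have -> : 2 * pi * n.+1%:R = 2 * pi * n%:R + pi *+ 2 :> R.
  by rewrite -addn1 natrD -mulr_natr; ring.
by rewrite sinD2pi.
Qed.

Lemma expi_2pi_int (n : R) : n \is a Num.int -> expi (2 * pi * n) = 1.
Proof.
move=> /intrP[[m|m] ->].
  by rewrite /expi cos_2pi_nat sin_2pi_nat.
by rewrite NegzE rmorphN /= mulrN expiN /expi cos_2pi_nat sin_2pi_nat /= oppr0.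
Qed.

Lemma expi_2piD_int t (n : R) : n \is a Num.int ->
  expi (2 * pi * (t + n)) = expi (2 * pi * t).
Proof. by move=> nint; rewrite mulrDr expiD (expi_2pi_int nint) mulr1. Qed.

(** Convergence by components matches [zsum] and [cint], whose values are also defined by
    components. *)
Definition ccvg (u : nat -> C) (l : C) :=
  (complex.Re (u n) @[n --> \oo] --> complex.Re l) /\
  (complex.Im (u n) @[n --> \oo] --> complex.Im l).

Lemma ccvg_cst z : ccvg (fun=> z) z.
Proof. by split; exact: cvg_cst. Qed.

Lemma ccvgD u v z w : ccvg u z -> ccvg v w -> ccvg (fun n => u n + v n) (z + w).
Proof.
move=> [u1 u2] [v1 v2]; split.
- under eq_fun do rewrite raddfD /=; rewrite raddfD; exact: cvgD.
- under eq_fun do rewrite raddfD /=; rewrite raddfD; exact: cvgD.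
Qed.

Lemma ccvgN u z : ccvg u z -> ccvg (fun n => - u n) (- z).
Proof.
move=> [u1 u2]; split.
- under eq_fun do rewrite raddfN /=; rewrite raddfN; exact: cvgN.
- under eq_fun do rewrite raddfN /=; rewrite raddfN; exact: cvgN.
Qed.

Lemma ccvgM u v z w : ccvg u z -> ccvg v w -> ccvg (fun n => u n * v n) (z * w).
Proof.
move=> [u1 u2] [v1 v2]; split.
- by under eq_fun do rewrite ReM; rewrite ReM; apply: cvgB; exact: cvgM.
- by under eq_fun do rewrite ImM; rewrite ImM; apply: cvgD; exact: cvgM.
Qed.

Lemma ccvgJ u z : ccvg u z -> ccvg (fun n => (u n)^*%C) z^*%C.
Proof.
move=> [u1 u2]; split; first by under eq_fun do rewrite ReJ; rewrite ReJ.
by under eq_fun do rewrite ImJ; rewrite ImJ; exact: cvgN.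
Qed.

Lemma ccvg_sum (I : finType) (P : pred I) (u : I -> nat -> C) (l : I -> C) :
  (forall i, P i -> ccvg (u i) (l i)) ->
  ccvg (fun n => \sum_(i | P i) u i n) (\sum_(i | P i) l i).
Proof.
move=> ul; elim: (index_enum I) => [|i s IH].
  by under eq_fun do rewrite big_nil; rewrite big_nil; exact: ccvg_cst.
under eq_fun do rewrite big_cons; rewrite big_cons; case: ifPn => // Pi.
by apply: ccvgD => //; exact: ul.
Qed.

Lemma ccvg_sub0 (u v : nat -> C) z : ccvg u z ->
  sqnorm (u n - v n) @[n --> \oo] --> 0 -> ccvg v z.
Proof.
move=> uz uv.
have uv' : Num.sqrt (sqnorm (u n - v n)) @[n --> \oo] --> 0.
  by rewrite -[X in _ --> X]sqrtr0; apply: (cvg_comp _ _ uv); exact: sqrt_continuous.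
have d0 : ccvg (fun n => u n - v n) 0.
  split => /=; apply/cvgr0Pnorm_le => e e0; move/cvgr0_norm_le: uv' => /(_ e e0);
  apply: filterS => n; apply: le_trans; rewrite [leRHS]ger0_norm ?sqrtr_ge0//.
  - exact: normr_Re.
  - exact: normr_Im.
have := ccvgD uz (ccvgN d0); rewrite subr0; congr ccvg.
by apply/funext => n; ring.
Qed.

Lemma ccvg_expi (u : nat -> R) (l : R) :
  u n @[n --> \oo] --> l -> ccvg (fun n => expi (u n)) (expi l).
Proof.
move=> ul; split; apply: (cvg_comp _ _ ul).
- exact: continuous_cos.
- exact: continuous_sin.
Qed.

Lemma ccvg_comp u z (f : nat -> nat) : f n @[n --> \oo] --> \oo ->
  ccvg u z -> ccvg (u \o f) z.
Proof. by move=> foo [u1 u2]; split; [exact: (cvg_comp _ _ foo u1)|exact: (cvg_comp _ _ foo u2)]. Qed.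

End ComplexNumbers.

(** * Bounded measurable functions and complex integrals over finite measures *)

Section BoundedFunctions.
Context d (T : measurableType d) (R : realType).
Local Notation C := R[i].
Implicit Types (f g : T -> R) (F G : T -> C).

(** A class stable under the ring operations and integrable against every finite measure, which
    settles the integrability conditions on the torus and on the unit square. *)
Definition bounded_measurable f :=
  measurable_fun [set: T] f /\ exists M, forall x, `|f x| <= M.

Lemma bounded_measurable_cst c : bounded_measurable (fun=> c).
Proof. by split; [exact: measurable_cst|exists `|c|]. Qed.

Lemma bounded_measurableD f g : bounded_measurable f -> bounded_measurable g ->
  bounded_measurable (fun x => f x + g x).
Proof.
move=> [mf [M fM]] [mg [N gN]]; split; first exact: measurable_funD.
by exists (M + N) => x; rewrite (le_trans (ler_normD _ _))// lerD.
Qed.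

Lemma bounded_measurableM f g : bounded_measurable f -> bounded_measurable g ->
  bounded_measurable (fun x => f x * g x).
Proof.
move=> [mf [M fM]] [mg [N gN]]; split; first exact: measurable_funM.
by exists (M * N) => x; rewrite normrM ler_pM.
Qed.

Lemma bounded_measurableN f : bounded_measurable f ->
  bounded_measurable (fun x => - f x).
Proof.
by move=> /(bounded_measurableM (bounded_measurable_cst (-1))); congr bounded_measurable;
  apply/funext => x; rewrite mulN1r.
Qed.

Lemma bounded_measurableB f g : bounded_measurable f -> bounded_measurable g ->
  bounded_measurable (fun x => f x - g x).
Proof. by move=> bf /bounded_measurableN; exact: bounded_measurableD. Qed.

Lemma bounded_measurableX f n : bounded_measurable f ->
  bounded_measurable (fun x => f x ^+ n).
Proof.
move=> bf; elim: n => [|n IH]; first exact: bounded_measurable_cst.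
by under eq_fun do rewrite exprS; exact: bounded_measurableM.
Qed.

Lemma bounded_measurable_indic (B : set T) : measurable B ->
  bounded_measurable (\1_B : T -> R).
Proof.
move=> mB; split; first exact: measurable_indic.
by exists 1 => x; rewrite indicE; case: (_ \in _); rewrite ?normr1 ?normr0.
Qed.

Definition cbounded_measurable F :=
  bounded_measurable (fun x => complex.Re (F x)) /\
  bounded_measurable (fun x => complex.Im (F x)).

Lemma cbounded_measurable_cst z : cbounded_measurable (fun=> z).
Proof. by split; exact: bounded_measurable_cst. Qed.

Lemma cbounded_measurable_real f : bounded_measurable f ->
  cbounded_measurable (fun x => (f x)%:C%C).
Proof. by move=> bf; split => //; exact: bounded_measurable_cst. Qed.

Lemma cbounded_measurableD F G : cbounded_measurable F -> cbounded_measurable G ->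
  cbounded_measurable (fun x => F x + G x).
Proof.
move=> [F1 F2] [G1 G2]; split.
- by under eq_fun do rewrite raddfD /=; exact: bounded_measurableD.
- by under eq_fun do rewrite raddfD /=; exact: bounded_measurableD.
Qed.

Lemma cbounded_measurableM F G : cbounded_measurable F -> cbounded_measurable G ->
  cbounded_measurable (fun x => F x * G x).
Proof.
move=> [F1 F2] [G1 G2]; split.
- under eq_fun do rewrite ReM.
  by apply: bounded_measurableB; exact: bounded_measurableM.
- under eq_fun do rewrite ImM.
  by apply: bounded_measurableD; exact: bounded_measurableM.
Qed.

Lemma cbounded_measurable_sum (I : finType) (P : pred I) (F : I -> T -> C) :
  (forall i, P i -> cbounded_measurable (F i)) ->
  cbounded_measurable (fun x => \sum_(i | P i) F i x).
Proof.
move=> bF; elim: (index_enum I) => [|i s IH].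
  by under eq_fun do rewrite big_nil; exact: cbounded_measurable_cst.
under eq_fun do rewrite big_cons; case: (boolP (P i)) => // Pi.
by apply: cbounded_measurableD => //; exact: bF.
Qed.

Lemma bounded_measurable_sqnorm F : cbounded_measurable F ->
  bounded_measurable (fun x => sqnorm (F x)).
Proof. by move=> [F1 F2]; apply: bounded_measurableD; exact: bounded_measurableX. Qed.

Variable m : {measure set T -> \bar R}.
Hypothesis mfin : (m [set: T] < +oo)%E.

Lemma bounded_measurable_integrable f : bounded_measurable f ->
  m.-integrable [set: T] (EFin \o f).
Proof.
move=> [mf [M fM]]; apply: measurable_bounded_integrable => //.
exists M; split; first by rewrite num_real.
by move=> N MN x _ /=; rewrite (le_trans (fM x))// ltW.
Qed.

Lemma bounded_RintegralD f g : bounded_measurable f -> bounded_measurable g ->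
  \int[m]_x (f x + g x) = \int[m]_x f x + \int[m]_x g x.
Proof. by move=> bf bg; rewrite RintegralD//; exact: bounded_measurable_integrable. Qed.

Lemma bounded_RintegralB f g : bounded_measurable f -> bounded_measurable g ->
  \int[m]_x (f x - g x) = \int[m]_x f x - \int[m]_x g x.
Proof. by move=> bf bg; rewrite RintegralB//; exact: bounded_measurable_integrable. Qed.

Lemma bounded_RintegralZ c f : bounded_measurable f ->
  \int[m]_x (c * f x) = c * \int[m]_x f x.
Proof. by move=> bf; rewrite RintegralZl//; exact: bounded_measurable_integrable. Qed.

Lemma bounded_le_Rintegral f g : bounded_measurable f -> bounded_measurable g ->
  (forall x, f x <= g x) -> \int[m]_x f x <= \int[m]_x g x.
Proof. by move=> bf bg fg; rewrite le_Rintegral//; exact: bounded_measurable_integrable. Qed.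

Lemma Rintegral_indic (B : set T) : measurable B ->
  \int[m]_x (\1_B x) = fine (m B).
Proof. by move=> mB; rewrite /Rintegral integral_indic// setIT. Qed.

(** The bound is asked only on a set of full measure, because truncated coherent-state series are
    bounded below for [|x.1| <= 1] only, a strip that carries the whole unit-square measure. *)
Lemma bounded_convergence_ae (D : set T) (f_ : nat -> T -> R) f (M : R) :
  measurable D -> m (~` D) = 0%E ->
  (forall n, measurable_fun [set: T] (f_ n)) ->
  (forall n x, D x -> `|f_ n x| <= M) ->
  (forall x, f_ n x @[n --> \oo] --> f x) ->
  \int[m]_x f_ n x @[n --> \oo] --> \int[m]_x f x.
Proof.
move=> mD D0 mf_ fM ff.
have mf : measurable_fun [set: T] f.
  by apply: (measurable_fun_cvg mf_) => x _; exact: ff.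
have iM : m.-integrable [set: T] (EFin \o (fun=> M)).
  by apply: bounded_measurable_integrable; exact: bounded_measurable_cst.
have [|||||intf _ cf] := @dominated_convergence _ _ _ m setT measurableT
  (fun n => EFin \o f_ n) (EFin \o f) (EFin \o (fun=> M)).
- by move=> n; exact/measurable_EFinP.
- exact/measurable_EFinP.
- by apply: aeW => x _ /=; apply: cvg_EFin; [exact: nearW|exact: ff].
- exact: iM.
- exists (~` D); split => //; first exact: measurableC.
  by move=> x /= h Dx; apply: h => n _; rewrite lee_fin; exact: fM.
have fin : (\int[m]_x (f x)%:E)%E \is a fin_num by exact: integrable_fin_num.
by apply: fine_cvg; rewrite /Rintegral fineK.
Qed.

Lemma bounded_convergence (f_ : nat -> T -> R) f (M : R) :
  (forall n, measurable_fun [set: T] (f_ n)) ->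
  (forall n x, `|f_ n x| <= M) ->
  (forall x, f_ n x @[n --> \oo] --> f x) ->
  \int[m]_x f_ n x @[n --> \oo] --> \int[m]_x f x.
Proof.
move=> mf_ fM; apply: (@bounded_convergence_ae setT _ _ M) => //.
by rewrite setCT measure0.
Qed.

Definition cint F : C :=
  Complex (\int[m]_x complex.Re (F x)) (\int[m]_x complex.Im (F x)).

Lemma cintD F G : cbounded_measurable F -> cbounded_measurable G ->
  cint (fun x => F x + G x) = cint F + cint G.
Proof.
move=> [F1 F2] [G1 G2]; apply: complex_ext => /=.
- by rewrite -bounded_RintegralD//; congr (Rintegral _ _ _); apply/funext => x; rewrite raddfD.
- by rewrite -bounded_RintegralD//; congr (Rintegral _ _ _); apply/funext => x; rewrite raddfD.
Qed.

Lemma cintZ z F : cbounded_measurable F -> cint (fun x => z * F x) = z * cint F.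
Proof.
move=> [F1 F2]; apply: complex_ext; rewrite ?ReM ?ImM /=.
- rewrite -!bounded_RintegralZ// -bounded_RintegralB//; do ?[apply: bounded_measurableM => //; exact: bounded_measurable_cst].
  by congr (Rintegral _ _ _); apply/funext => x; rewrite ReM.
- rewrite -!bounded_RintegralZ// -bounded_RintegralD//; do ?[apply: bounded_measurableM => //; exact: bounded_measurable_cst].
  by congr (Rintegral _ _ _); apply/funext => x; rewrite ImM.
Qed.

Lemma cint_sum (I : finType) (P : pred I) (F : I -> T -> C) :
  (forall i, P i -> cbounded_measurable (F i)) ->
  cint (fun x => \sum_(i | P i) F i x) = \sum_(i | P i) cint (F i).
Proof.
move=> bF.
suff H (s : seq I) : cbounded_measurable (fun x => \sum_(i <- s | P i) F i x) /\
  cint (fun x => \sum_(i <- s | P i) F i x) = \sum_(i <- s | P i) cint (F i).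
  by case: (H (index_enum I)).
elim: s => [|i s [IH1 IH2]].
  under eq_fun do rewrite big_nil.
  split; first exact: cbounded_measurable_cst.
  by rewrite big_nil; apply: complex_ext => /=; rewrite Rintegral_cst// mul0r.
under eq_fun do rewrite big_cons; rewrite big_cons; case: (boolP (P i)) => // Pi.
split; first by apply: cbounded_measurableD => //; exact: bF.
by rewrite cintD// ?IH2//; exact: bF.
Qed.

Lemma cint_real f : cint (fun x => (f x)%:C%C) = (\int[m]_x f x)%:C%C.
Proof. by apply: complex_ext => //=; rewrite Rintegral_cst// mul0r. Qed.

End BoundedFunctions.

(** * Powers of a hyperbolic matrix *)

Section Lucas.
Variable t : int.
Hypothesis ht : 2 < `|t|.

(** The Lucas sequence U_n(t, 1), equal to (l^n - l^(-n)) / (l - l^(-1)) for l a root of X^2 - t X +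
    1. *)
Fixpoint lucas (n : nat) : int :=
  if n is n1.+1 then
    (if n1 is n2.+1 then t * lucas n1 - lucas n2 else 1)
  else 0.

Lemma lucasSS n : lucas n.+2 = t * lucas n.+1 - lucas n.
Proof. by []. Qed.

(** The recurrence is an integer matrix of determinant 1 that preserves the form X^2 - t X Y + Y^2,
    the norm form of the ring generated by an eigenvalue of A. *)
Lemma lucas_norm n : lucas n.+1 ^+ 2 - t * lucas n.+1 * lucas n + lucas n ^+ 2 = 1.
Proof.
elim: n => [|n IH]; first by rewrite /=; ring.
by rewrite lucasSS -[RHS]IH; ring.
Qed.

Lemma lucas_lt n : `|lucas n| < `|lucas n.+1|.
Proof.
elim: n => [|n IH]; first by [].
rewrite lucasSS; have h1 := lerB_dist (t * lucas n.+1) (lucas n).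
apply: lt_le_trans h1; rewrite normrM.
have : 3 * `|lucas n.+1| <= `|t| * `|lucas n.+1| by rewrite ler_wpM2r//; lia.
by move: IH; have := normr_ge0 (lucas n); lia.
Qed.

Lemma lucas_ge n : n%:Z <= `|lucas n|.
Proof. by elim: n => [|n IH]; [|have := lucas_lt n; lia]. Qed.

Lemma lucas_leS n : `|lucas n.+2| <= (`|t| + 1) * `|lucas n.+1|.
Proof.
rewrite lucasSS (le_trans (ler_normB _ _))// normrM mulrDl mul1r lerD2l.
exact: ltW (lucas_lt n).
Qed.

(** For |t| >= 3 the number t^2 - 4 lies strictly between (|t| - 1)^2 and t^2. *)
Lemma disc_nonsquare (s : int) : s ^+ 2 <> t ^+ 2 - 4.
Proof.
move=> h; have : `|s| ^+ 2 = `|t| ^+ 2 - 4 by rewrite -!normrX !ger0_norm ?sqr_ge0.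
move: ht (normr_ge0 s) => + s0; move: (`|s|) s0 (`|t|) => a a0 b b2 ab.
have [|] := leP a (b - 1) => h1; last by nia.
have : a * a <= (b - 1) * (b - 1) by apply: ler_pM.
nia.
Qed.

Lemma disc_sqr_eq0 (X Y : int) : X ^+ 2 = (t ^+ 2 - 4) * Y ^+ 2 -> Y = 0.
Proof.
move=> h; apply/eqP; apply: contraT => Y0.
have : (Y ^+ 2 %| X ^+ 2)%Z by rewrite h dvdz_mull.
rewrite dvdzE !abszX dvdn_pexp2r// => YX.
have /dvdzP[s sE] : (Y %| X)%Z by rewrite dvdzE.
have : s ^+ 2 * Y ^+ 2 = (t ^+ 2 - 4) * Y ^+ 2 by rewrite -h sE; ring.
by move/(mulIf (expf_neq0 2 Y0)) => /disc_nonsquare.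
Qed.

(** Completing the square reduces to [disc_sqr_eq0]: an integral binary form whose discriminant is
    not a square is anisotropic. With discriminant t^2 - 4 this expresses the irrationality of the
    eigendirections of A. *)
Lemma quadratic_form_eq0 (c e f X Y : int) : e ^+ 2 - 4 * c * f = t ^+ 2 - 4 ->
  c * X ^+ 2 + e * X * Y + f * Y ^+ 2 = 0 -> X = 0 /\ Y = 0.
Proof.
move=> he h.
have Y0 : Y = 0.
  apply: (@disc_sqr_eq0 (2 * c * X + e * Y)); rewrite -he.
  have -> : (2 * c * X + e * Y) ^+ 2 =
    4 * c * (c * X ^+ 2 + e * X * Y + f * Y ^+ 2) + (e ^+ 2 - 4 * c * f) * Y ^+ 2 by ring.
  by rewrite h mulr0 add0r.
split=> //; move: h; rewrite Y0 expr0n /= !mulr0 !addr0 => /eqP.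
rewrite mulf_eq0 sqrf_eq0 => /orP[/eqP c0|/eqP//].
by move: he; rewrite c0 mulr0 mul0r subr0 => /disc_nonsquare.
Qed.

End Lucas.

(** * Hyperbolic integer matrices acting on frequencies and on the plane *)

Section Hyperbolic.
Variable A : 'M[int]_2.
Hypothesis hdet : \det A = 1.
Hypothesis htr : 2 < `|\tr A|.
Local Notation t := (\tr A).
Implicit Types k l : 'cV[int]_2.

Lemma mulmx20 k : (A *m k) 0 0 = A 0 0 * k 0 0 + A 0 1 * k 1 0.
Proof.
rewrite mxE !big_ord_recl big_ord0 addr0.
by congr (A _ _ * k _ _ + A _ _ * k _ _); apply/val_inj.
Qed.

Lemma mulmx21 k : (A *m k) 1 0 = A 1 0 * k 0 0 + A 1 1 * k 1 0.
Proof.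
rewrite mxE !big_ord_recl big_ord0 addr0.
by congr (A _ _ * k _ _ + A _ _ * k _ _); apply/val_inj.
Qed.

Lemma cV2P k l : k 0 0 = l 0 0 -> k 1 0 = l 1 0 -> k = l.
Proof.
move=> h0 h1; apply/matrixP => i j; rewrite (ord1 j).
case: i => [[|[|//]]] hi.
- by rewrite (_ : Ordinal hi = 0)//; apply/val_inj.
- by rewrite (_ : Ordinal hi = 1)//; apply/val_inj.
Qed.

Lemma det2 : A 0 0 * A 1 1 - A 0 1 * A 1 0 = 1.
Proof.
rewrite -hdet (expand_det_row _ 0) !big_ord_recl big_ord0 addr0 /cofactor.
rewrite !det_mx11 !mxE /= expr0 expr1 mul1r mulN1r mulrN.
by congr (A _ _ * A _ _ - A _ _ * A _ _); apply/val_inj.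
Qed.

Lemma tr2 : t = A 0 0 + A 1 1.
Proof.
rewrite /mxtrace !big_ord_recl big_ord0 addr0.
by congr (A _ _ + A _ _); apply/val_inj.
Qed.

Lemma entryZB (a : int) k l i j : (a *: k - l) i j = a * k i j - l i j.
Proof. by rewrite !mxE. Qed.

Lemma cayley_hamilton k : A *m (A *m k) = t *: (A *m k) - k.
Proof.
apply: cV2P; rewrite entryZB !(mulmx20, mulmx21) tr2.
- rewrite -[X in _ = _ - X]mul1r -det2; ring.
- rewrite -[X in _ = _ - X]mul1r -det2; ring.
Qed.

Definition itermx n k := iter n (mulmx A) k.

Lemma itermxS n k : itermx n.+1 k = lucas t n.+1 *: (A *m k) - lucas t n *: k.
Proof.
elim: n => [|n IH]; first by rewrite /= scale1r scale0r subr0.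
rewrite /itermx iterS -/(itermx n.+1 k) IH mulmxBr -!scalemxAr cayley_hamilton.
rewrite lucasSS scalerBl scalerBr scalerA [t * _]mulrC.
by rewrite addrAC.
Qed.

(** The symplectic form, which gives the exponents of the Weyl relations. *)
Definition cross k l : int := k 0 0 * l 1 0 - k 1 0 * l 0 0.

Lemma cross_mulmx k l : cross (A *m k) (A *m l) = cross k l.
Proof.
rewrite /cross !mulmx20 !mulmx21 -[RHS]mul1r -det2; ring.
Qed.

Lemma cross_itermx n k l : cross (itermx n k) (itermx n l) = cross k l.
Proof. by elim: n => //= n IH; rewrite cross_mulmx. Qed.

(** In the coordinates of k, [cross k (A *m k)] is a binary quadratic form of discriminant (tr A)^2
    - 4 det A = t^2 - 4, hence anisotropic: A has no rational eigenvector. *)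
Lemma cross_mulmx_eq0 k : cross k (A *m k) = 0 -> k = 0.
Proof.
rewrite /cross mulmx20 mulmx21 => h.
have [||h0 h1] := @quadratic_form_eq0 t htr (A 1 0) (A 1 1 - A 0 0) (- A 0 1)
  (k 0 0) (k 1 0).
- rewrite tr2; have := det2; move: (A 0 0) (A 0 1) (A 1 0) (A 1 1) => a b c d h1.
  have -> : (a + d) ^+ 2 - 4 = (a + d) ^+ 2 - 4 * (a * d - b * c) by rewrite h1 mulr1.
  by ring.
- by rewrite -[RHS]h; ring.
by apply: cV2P; rewrite mxE.
Qed.

Lemma mulmx_eq0 k : A *m k = 0 -> k = 0.
Proof.
move=> h; apply: cross_mulmx_eq0; rewrite h /cross !mxE; ring.
Qed.

Lemma itermxB n k l : itermx n (k - l) = itermx n k - itermx n l.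
Proof. by elim: n => //= n IH; rewrite IH mulmxBr. Qed.

Lemma itermxD m n k : itermx (m + n) k = itermx m (itermx n k).
Proof. exact: iterD. Qed.

(** Injectivity of A reduces an equality to A^(n+1) k = k. Taking the cross product of k with
    A^(n+1) k - k = b_(n+1) A k - (b_n + 1) k leaves b_(n+1) [cross k (A *m k)], and neither factor
    vanishes. *)
Lemma itermx_neq i j k : k != 0 -> (i < j)%N -> itermx j k - itermx i k != 0.
Proof.
move=> k0 ij; apply: contraNneq k0.
have -> : j = (i + (j - i).-1.+1)%N by lia.
rewrite itermxD -itermxB; set n := (_).-1 => h.
have {h} : itermx n.+1 k - k = 0.
  by clearbody n; elim: i {ij} h => //= i IH /mulmx_eq0.
rewrite itermxS => h.
have : cross k (lucas t n.+1 *: (A *m k) - lucas t n *: k - k) = 0.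
  by rewrite h /cross !mxE; ring.
have -> : cross k (lucas t n.+1 *: (A *m k) - lucas t n *: k - k) =
   lucas t n.+1 * cross k (A *m k) by rewrite /cross !mxE; ring.
move/eqP; rewrite mulf_eq0 => /orP[/eqP l0|/eqP/cross_mulmx_eq0 ->//].
by have := lucas_ge htr n.+1; rewrite l0 normr0.
Qed.

Section Plane.
Variable R : realType.

Definition plane_map (v : R * R) : R * R :=
  ((A 0 0)%:~R * v.1 + (A 0 1)%:~R * v.2, (A 1 0)%:~R * v.1 + (A 1 1)%:~R * v.2).

(** The limit of h A^n k when x and y are the limits of - h b_(n-1) and h b_n. It lies in an
    eigenspace of A once x^2 + t x y + y^2 = 0. *)
Definition eigen_vector (x y : R) k : R * R :=
  (x * (k 0 0)%:~R + y * ((A *m k) 0 0)%:~R, x * (k 1 0)%:~R + y * ((A *m k) 1 0)%:~R).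

Lemma plane_map_eigen x y k :
  plane_map (eigen_vector x y k) = eigen_vector x y (A *m k).
Proof.
rewrite /plane_map /eigen_vector /= !mulmx20 !mulmx21 !mulmx20 ?mulmx21 !rmorphD /= !rmorphM /= !rmorphD /= !rmorphM /=.
by congr pair; ring.
Qed.

Lemma iter_plane_map_eigen n x y k :
  iter n plane_map (eigen_vector x y k) = eigen_vector x y (itermx n k).
Proof. by elim: n => //= n ->; rewrite plane_map_eigen. Qed.

(* With X, Y the numerators of x, y over the common denominator k' x Ak',
   X^2 + t X Y + Y^2 = 0 has no nonzero integer solution. *)
Lemma eigen_vector_not_int x y k i j : k != 0 -> (i < j)%N ->
  x ^+ 2 + t%:~R * x * y + y ^+ 2 = 0 -> y != 0 ->
  let v := eigen_vector x y k in
  ~ ((iter j plane_map v).1 - (iter i plane_map v).1 \is a Num.int /\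
     (iter j plane_map v).2 - (iter i plane_map v).2 \is a Num.int).
Proof.
move=> k0 ij xy y0 /=; rewrite !iter_plane_map_eigen /eigen_vector /=.
set k' := itermx j k - itermx i k.
have k'0 : k' != 0 by exact: itermx_neq.
move=> [/intrP[l1 h1] /intrP[l2 h2]].
have e1 : x * (k' 0 0)%:~R + y * ((A *m k') 0 0)%:~R = l1%:~R.
  by rewrite -h1 /k' mulmxBr !mxE !rmorphB /=; ring.
have e2 : x * (k' 1 0)%:~R + y * ((A *m k') 1 0)%:~R = l2%:~R.
  by rewrite -h2 /k' mulmxBr !mxE !rmorphB /=; ring.
pose D := cross k' (A *m k').
pose X := l1 * (A *m k') 1 0 - l2 * (A *m k') 0 0.
pose Y := k' 0 0 * l2 - k' 1 0 * l1.
have D0 : D != 0 by apply: contraNneq k'0 => /cross_mulmx_eq0 ->.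
have eX : X%:~R = x * D%:~R.
  by rewrite /X /D /cross !rmorphB /= !rmorphM /= -e1 -e2; ring.
have eY : Y%:~R = y * D%:~R.
  by rewrite /Y /D /cross !rmorphB /= !rmorphM /= -e1 -e2; ring.
have : (X ^+ 2 + t * X * Y + Y ^+ 2)%:~R = 0 :> R.
  rewrite !expr2 !intrD !intrM eX eY.
  rewrite -[RHS](mul0r (D%:~R ^+ 2)) -xy; ring.
move/eqP; rewrite intr_eq0 => /eqP XY.
have [||_ Y0] := @quadratic_form_eq0 t htr 1 t 1 X Y.
- by ring.
- by rewrite !mul1r.
move: eY; rewrite Y0 => /esym/eqP; rewrite mulf_eq0 (negbTE y0) /= intr_eq0.
by rewrite (negbTE D0).
Qed.

End Plane.
End Hyperbolic.

(** * Quantum translations *)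

Section Braket.
Variables (R : realType) (N : nat).
Local Notation C := R[i].
Implicit Types phi psi chi : 'cV[C]_N.

Definition sqnorm_vec phi : R := \sum_(j < N) sqnorm (phi j 0).

Lemma sqnorm_vec_ge0 phi : 0 <= sqnorm_vec phi.
Proof. by apply: sumr_ge0 => j _; exact: sqnorm_ge0. Qed.

Lemma braket_self phi : braket phi phi = (sqnorm_vec phi)%:C%C.
Proof.
by rewrite /braket /sqnorm_vec rmorph_sum /=; apply: eq_bigr => j _; rewrite Re_conj_ge0.
Qed.

Lemma braketJ phi psi : braket phi psi = (braket psi phi)^*%C.
Proof.
by rewrite /braket conjc_sum; apply: eq_bigr => j _; rewrite conjcM conjcK mulrC.
Qed.

Lemma braketDr phi psi chi : braket phi (psi + chi) = braket phi psi + braket phi chi.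
Proof. by rewrite /braket -big_split; apply: eq_bigr => j _ /=; rewrite mxE mulrDr. Qed.

Lemma braketZr phi c psi : braket phi (c *: psi) = c * braket phi psi.
Proof. by rewrite /braket mulr_sumr; apply: eq_bigr => j _; rewrite mxE mulrCA. Qed.

Lemma braketNr phi psi : braket phi (- psi) = - braket phi psi.
Proof. by rewrite -scaleN1r braketZr mulN1r. Qed.

Lemma braketBr phi psi chi : braket phi (psi - chi) = braket phi psi - braket phi chi.
Proof. by rewrite braketDr braketNr. Qed.

Lemma braket_sumr (I : finType) phi (f : I -> 'cV[C]_N) :
  braket phi (\sum_i f i) = \sum_i braket phi (f i).
Proof.
elim/big_ind2 : _ => // [|x1 x2 y1 y2 <- <-]; last by rewrite braketDr.
by rewrite /braket big1// => j _; rewrite mxE mulr0.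
Qed.

Lemma braketZl c phi psi : braket (c *: phi) psi = c^*%C * braket phi psi.
Proof. by rewrite braketJ braketZr conjcM -braketJ. Qed.

Lemma braketBl phi psi chi : braket (psi - chi) phi = braket psi phi - braket chi phi.
Proof. by rewrite braketJ braketBr raddfB /= -!braketJ. Qed.

Lemma braket_suml (I : finType) (f : I -> 'cV[C]_N) psi :
  braket (\sum_i f i) psi = \sum_i braket (f i) psi.
Proof.
by rewrite braketJ braket_sumr conjc_sum; apply: eq_bigr => i _; rewrite -braketJ.
Qed.

Lemma bessel phi psi : braket phi phi = 1 ->
  sqnorm (braket phi psi) <= sqnorm_vec psi.
Proof.
move=> phi1; set c := braket phi psi.
have : (sqnorm_vec (psi - c *: phi))%:C%C = (sqnorm_vec psi - sqnorm c)%:C%C.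
  rewrite -braket_self braketBr !braketBl !braketZr !braketZl phi1 -/c.
  rewrite (braketJ psi phi) -/c braket_self rmorphB /= -Re_conj_ge0; ring.
move=> /complexI h; rewrite -subr_ge0 -h; exact: sqnorm_vec_ge0.
Qed.

Lemma braket_mulmx (U : 'M[C]_N) phi psi : U \is unitarymx ->
  braket (U *m phi) (U *m psi) = braket phi psi.
Proof.
move=> Uu; have braketE (a b : 'cV[C]_N) : braket a b = ((map_mx conjc a)^T *m b) 0 0.
  by rewrite mxE; apply: eq_bigr => j _; rewrite !mxE.
rewrite !braketE map_mxM trmx_mul -mulmxA [_ *m (U *m psi)]mulmxA.
have -> : (map_mx conjc U)^T *m U = 1%:M; last by rewrite mul1mx.
have /unitarymxP h := Uu; apply: mulmx1C.
by rewrite -[RHS]h map_trmx.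
Qed.

End Braket.

(** * Weyl relations and exact equivariance of eigenstates *)

Section Translations.
Variables (R : realType) (N' : nat).
Local Notation N := N'.+1.
Local Notation C := R[i].
Local Notation T k := (translation R N k).
Implicit Types (phi psi : 'cV[C]_N) (k l : 'cV[int]_2).

Definition ord_mod (z : int) : 'I_N := inord `|(z %% N%:Z)%Z|%N.

Lemma ord_modE z : (ord_mod z : nat)%:Z = (z %% N%:Z)%Z.
Proof.
have h0 : 0 <= (z %% N%:Z)%Z by rewrite modz_ge0.
have h1 : (z %% N%:Z)%Z < N%:Z by rewrite ltz_pmod.
rewrite /ord_mod inordK ?gez0_abs//.
by rewrite -ltz_nat gez0_abs.
Qed.

Lemma ord_mod_nat (j : 'I_N) : ord_mod j%:Z = j.
Proof.
apply/val_inj/eqP; rewrite -eqz_nat ord_modE modz_small//.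
by rewrite lez_nat ltz_nat /= ltn_ord.
Qed.

Lemma ord_mod_eq z (j : 'I_N) : (j%:Z == (z %% N%:Z)%Z) = (j == ord_mod z).
Proof. by rewrite -ord_modE eqz_nat. Qed.

Lemma ord_mod_modD y z : ord_mod ((ord_mod y)%:Z + z) = ord_mod (y + z).
Proof. by apply/val_inj/eqP; rewrite -eqz_nat !ord_modE modzDml. Qed.

Lemma ord_mod_period y z : ord_mod (y + z * N%:Z) = ord_mod y.
Proof. by apply/val_inj/eqP; rewrite -eqz_nat !ord_modE addrC modzMDl. Qed.

(** The N-periodic family of all coefficients c_z of the state. On it a translation is a shift times
    a phase, with no reduction modulo N. *)
Definition pext psi (z : int) : C := psi (ord_mod z) 0.

Lemma pextP phi psi : pext phi =1 pext psi -> phi = psi.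
Proof.
by move=> h; apply/matrixP => j i; rewrite (ord1 i); have := h j%:Z; rewrite /pext ord_mod_nat.
Qed.

Lemma pextZ c psi z : pext (c *: psi) z = c * pext psi z.
Proof. by rewrite /pext mxE. Qed.

Lemma braket_pext phi psi :
  braket phi psi = \sum_(j < N) (pext phi j%:Z)^*%C * pext psi j%:Z.
Proof. by apply: eq_bigr => j _; rewrite /pext ord_mod_nat. Qed.

Lemma sum_ord_mod (f : 'I_N -> C) (s : int) :
  \sum_(j < N) f (ord_mod (j%:Z + s)) = \sum_(j < N) f j.
Proof.
have inj : injective (fun j : 'I_N => ord_mod (j%:Z + s)).
  apply: (can_inj (g := fun j : 'I_N => ord_mod (j%:Z - s))) => j.
  by rewrite ord_mod_modD addrK ord_mod_nat.
by rewrite [RHS](reindex_inj inj).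
Qed.

Lemma expi_period (k z : int) :
  expi (2 * pi * k%:~R * (ord_mod z)%:R / N%:R) = expi (2 * pi * k%:~R * z%:~R / N%:R) :> C.
Proof.
have N0 : N%:R != 0 :> R by rewrite pnatr_eq0.
have -> : z%:~R = (z %/ N%:Z)%Z%:~R * N%:R + (ord_mod z)%:R :> R.
  by rewrite {1}(divz_eq z N%:Z) -ord_modE rmorphD rmorphM.
have -> : 2 * pi * k%:~R * ((z %/ N%:Z)%Z%:~R * N%:R + (ord_mod z)%:R) / N%:R =
  2 * pi * (k%:~R * (ord_mod z)%:R / N%:R + k%:~R * (z %/ N%:Z)%Z%:~R) :> R.
  by field.
rewrite expi_2piD_int; first by congr expi; field.
by rewrite rpredM// intr_int.
Qed.

Lemma pext_translation k psi z : pext (T k *m psi) z =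
  expi (- (pi * (k 0 0 * k 1 0)%:~R / N%:R)) *
  expi (2 * pi * (k 1 0)%:~R * z%:~R / N%:R) * pext psi (z - k 0 0).
Proof.
rewrite /pext mxE (bigD1 (ord_mod (z - k 0 0)))//= big1 ?addr0 => [|l lj]; last first.
  by rewrite mxE ord_mod_eq ord_mod_modD (negbTE lj) mulr0 mul0r.
by rewrite mxE ord_mod_eq ord_mod_modD eqxx mulr1 expi_period.
Qed.

(** The Weyl relation: the exponent is - pi h [cross k l], half the exponent of the commutator. *)
Lemma translationD k l psi : T k *m (T l *m psi) =
  expi (pi * (l 0 0 * k 1 0 - k 0 0 * l 1 0)%:~R / N%:R) *: (T (k + l) *m psi).
Proof.
apply: pextP => z; rewrite pextZ !pext_translation !mxE opprD addrA !mulrA -!expiD.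
congr (expi _ * _); rewrite !(rmorphB, rmorphD, rmorphM) /=.
have N0 : N%:R != 0 :> R by rewrite pnatr_eq0.
by field.
Qed.

Lemma translation0 psi : T 0 *m psi = psi.
Proof.
apply: pextP => z; rewrite pext_translation !mxE.
by rewrite !(mulr0, mul0r, oppr0, expi0, subr0) !mul1r.
Qed.

Lemma braket_translation k phi psi : braket (T k *m phi) (T k *m psi) = braket phi psi.
Proof.
rewrite (braket_pext (_ *m _)).
under eq_bigr => j _ do rewrite !pext_translation !conjcM.
rewrite [RHS]/braket -(sum_ord_mod (fun j => (phi j 0)^*%C * psi j 0) (- k 0 0)).
apply: eq_bigr => j _; rewrite /pext.
rewrite [LHS](_ : _ = ((expi (- (pi * (k 0 0 * k 1 0)%:~R / N%:R)))^*%C *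
  expi (- (pi * (k 0 0 * k 1 0)%:~R / N%:R))) *
  ((expi (2 * pi * (k 1 0)%:~R * j%:Z%:~R / N%:R))^*%C *
  expi (2 * pi * (k 1 0)%:~R * j%:Z%:~R / N%:R)) *
  ((phi (ord_mod (j%:Z - k 0 0)) 0)^*%C * psi (ord_mod (j%:Z - k 0 0)) 0)); last by ring.
by rewrite !expiJM !mul1r.
Qed.

Lemma braket_translationr k phi psi :
  braket phi (T k *m psi) = braket (T (- k) *m phi) psi.
Proof.
rewrite -(braket_translation (- k)) translationD addNr translation0.
rewrite [X in expi X](_ : _ = 0) ?expi0 ?scale1r//.
have -> : k 0 0 * (- k) 1 0 - (- k) 0 0 * k 1 0 = 0 by rewrite !mxE; ring.
by rewrite mulr0 mul0r.
Qed.

Variable A : 'M[int]_2.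

(** T_(A k) = U T_k U^(-1) holds exactly, and U acts on both sides of the bracket by an eigenvalue
    of modulus 1, so the two factors cancel. *)
Lemma eigenstate_mulmx psi k : normalized_eigenstate A psi ->
  braket psi (T (A *m k) *m psi) = braket psi (T k *m psi).
Proof.
move=> [psi1 [U [[Uu UT] [lam Ulam]]]].
have lam1 : lam^*%C * lam = 1.
  have := braket_mulmx psi psi Uu; rewrite Ulam braketZl braketZr psi1 mulr1.
  by [].
have lam0 : lam != 0.
  by apply: contra_eq_neq lam1 => ->; rewrite mulr0 eq_sym oner_neq0.
have Uinv : U \in unitmx by exact: unitarymx_unit.
have invU : invmx U *m psi = lam^-1 *: psi.
  by rewrite -[in LHS](scalerK lam0 psi) -Ulam scalemxAr mulKmx.
rewrite -UT -!mulmxA invU -!scalemxAr braketZr.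
have -> : braket psi (U *m (T k *m psi)) =
  braket (lam^-1 *: (U *m psi)) (U *m (T k *m psi)) by rewrite Ulam scalerK.
rewrite braketZl braket_mulmx// mulrA.
have -> : lam^-1 * lam^-1^*%C = 1; last by rewrite mul1r.
by rewrite rmorphV ?unitfE//= -invfM mulrC lam1 invr1.
Qed.

Lemma eigenstate_itermx psi n k : normalized_eigenstate A psi ->
  braket psi (T (itermx A n k) *m psi) = braket psi (T k *m psi).
Proof. by move=> Apsi; elim: n => //= n IH; rewrite eigenstate_mulmx. Qed.

End Translations.

(** * Trigonometric polynomials on the torus *)

Section UnitInterval.
Variable R : realType.
Local Notation C := R[i].
Local Notation leb := (@lebesgue_measure R).

(** Lebesgue measure of the unit interval taken as a probability, so that the statements on bounded
    functions over finite measures apply to it and to its square. *)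
Definition unit_prob : probability (measurableTypeR R) R :=
  uniform_prob (@ltr01 R).

Lemma integral_unit_prob_ge0 (f : measurableTypeR R -> R) :
  measurable_fun setT f -> (forall x, 0 <= f x) ->
  (\int[unit_prob]_x (f x)%:E = \int[leb]_(x in `[0%R, 1%R]) (f x)%:E)%E.
Proof.
move=> mf f0; rewrite (integral_uniform (@ltr01 R))//.
- by rewrite subr0 invr1 mul1e.
- exact/measurable_EFinP.
Qed.

(** Closed and half-open intervals differ by a null point: the fundamental domain of the torus is
    half-open, while primitives are evaluated on the closed interval. *)
Lemma unit_probE (B : set (measurableTypeR R)) : measurable B ->
  unit_prob B = leb (B `&` `[0, 1[%classic).
Proof.
move=> mB; have mI : measurable_fun setT (\1_B : measurableTypeR R -> R) by exact: measurable_indic.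
transitivity (\int[unit_prob]_x (\1_B x)%:E)%E; first by rewrite integral_indic// setIT.
rewrite integral_unit_prob_ge0//.
rewrite -integral_itv_bndo_bndc; last by apply/measurable_EFinP; exact: measurable_funTS.
by rewrite integral_indic//; exact: measurable_itv.
Qed.

Lemma bounded_integrable_itv (f : R -> R) (i : interval R) : bounded_measurable f ->
  (leb [set` i] < +oo)%E -> leb.-integrable [set` i] (EFin \o f).
Proof.
move=> [mf [M fM]] fin; apply: measurable_bounded_integrable => //.
- exact: measurable_funTS.
- exists M; split; first by rewrite num_real.
  by move=> N MN x _ /=; rewrite (le_trans (fM x))// ltW.
Qed.

Lemma lebesgue_itv_lty (a b : R) b1 b2 :
  (leb [set` Interval (BSide b1 a) (BSide b2 b)] < +oo)%E.
Proof. by rewrite lebesgue_measure_itv/=; case: ifPn => // _; rewrite -EFinB ltry. Qed.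

Lemma Rintegral_unit_prob (f : R -> R) : bounded_measurable f ->
  \int[unit_prob]_x f x = \int[leb]_(x in `[0, 1]) f x.
Proof.
move=> bf; have [mf [M fM]] := bf.
have bM := @bounded_measurable_cst _ (measurableTypeR R) R M.
have fin : (unit_prob [set: measurableTypeR R] < +oo)%E.
  by rewrite probability_setT ltry.
(* Adding the bound M makes the integrand nonnegative; the constant has the same integral on both
   sides and cancels at the end. *)
have h : \int[unit_prob]_x (f x + M) = \int[leb]_(x in `[0, 1]) (f x + M).
  rewrite /Rintegral integral_unit_prob_ge0//.
  - by apply: measurable_funD.
  - by move=> x; have := fM x; rewrite ler_norml => /andP[]; lra.
move: h; rewrite bounded_RintegralD// RintegralD//; last 2 first.
- by apply: bounded_integrable_itv => //; exact: lebesgue_itv_lty.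
- by apply: bounded_integrable_itv => //; exact: lebesgue_itv_lty.
rewrite !Rintegral_cst//; have -> : fine (unit_prob [set: measurableTypeR R]) = 1.
  by rewrite probability_setT.
have -> : fine (leb `[0, 1]%classic) = 1.
  by rewrite lebesgue_measure_itv/= lte01 oppr0 adde0.
by move/addIr.
Qed.

Lemma Rintegral_unit_prob_derive (f F : R -> R) : bounded_measurable f ->
  continuous f -> (forall x : R, is_derive x 1 F (f x)) ->
  \int[unit_prob]_x f x = F 1 - F 0.
Proof.
move=> bf cf dF; rewrite Rintegral_unit_prob// /Rintegral.
have cF : continuous F.
  by move=> x; apply: differentiable_continuous; apply/derivable1_diffP; have [] := dF x.
rewrite (@continuous_FTC2 _ f F)//.
- by apply: continuous_subspaceT.
- split; first by move=> x _; have [] := dF x.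
  + by apply: cvg_at_right_filter; exact: cF.
  + by apply: cvg_at_left_filter; exact: cF.
- by move=> x _; rewrite derive1E; have [_ ->] := dF x.
Qed.

Lemma continuous_cos_mul (c : R) : continuous (fun x => cos (c * x)).
Proof.
move=> x; apply: (continuous_comp (g := cos)); last exact: continuous_cos.
by apply: cvgM; [exact: cvg_cst|exact: cvg_id].
Qed.

Lemma continuous_sin_mul (c : R) : continuous (fun x => sin (c * x)).
Proof.
move=> x; apply: (continuous_comp (g := sin)); last exact: continuous_sin.
by apply: cvgM; [exact: cvg_cst|exact: cvg_id].
Qed.

Lemma cbounded_measurable_expi (c : R) :
  cbounded_measurable ((fun x => expi (c * x)) : measurableTypeR R -> C).
Proof.
split; split => /=.
- by apply: continuous_measurable_fun; exact: continuous_cos_mul.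
- by exists 1 => x; exact: cos_max.
- by apply: continuous_measurable_fun; exact: continuous_sin_mul.
- by exists 1 => x; exact: sin_max.
Qed.

Lemma cint_expi (n : R) : n \is a Num.int -> n != 0 ->
  cint unit_prob (fun q => expi (2 * pi * n * q)) = 0.
Proof.
move=> nint n0; have [bc bs] := cbounded_measurable_expi (2 * pi * n).
have c0 : 2 * pi * n != 0 by rewrite !mulf_neq0// gt_eqF// pi_gt0.
have per : expi (2 * pi * n) = 1 :> C by exact: expi_2pi_int.
have dsin (x : R) : is_derive x 1 (fun x => (2 * pi * n)^-1 * sin (2 * pi * n * x))
    (cos (2 * pi * n * x)).
  apply: is_derive_eq; rewrite ?scaler1 ?scaler0 ?add0r ?addr0.
  transitivity ((2 * pi * n)^-1 * (cos (2 * pi * n * x) * (2 * pi * n))); first by [].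
  by rewrite mulrCA mulVf// mulr1.
have dcos (x : R) : is_derive x 1 (fun x => - (2 * pi * n)^-1 * cos (2 * pi * n * x))
    (sin (2 * pi * n * x)).
  apply: is_derive_eq; rewrite ?scaler1 ?scaler0 ?add0r ?addr0.
  transitivity (- (2 * pi * n)^-1 * (- sin (2 * pi * n * x) * (2 * pi * n))); first by [].
  by rewrite mulNr mulrCA mulVf// mulr1 opprK.
apply: complex_ext => /=.
- rewrite (Rintegral_unit_prob_derive bc (@continuous_cos_mul _) dsin).
  rewrite !mulr0 sin0 mulr1 mulr0 subr0.
  by have := congr1 (@complex.Im _) per => /= ->; rewrite mulr0.
- rewrite (Rintegral_unit_prob_derive bs (@continuous_sin_mul _) dcos).
  rewrite !mulr0 cos0 mulr1.
  by have := congr1 (@complex.Re _) per => /= ->; rewrite mulr1 subrr.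
Qed.

Definition square_prob := (unit_prob \x unit_prob)%E.

Lemma square_prob_setT : square_prob setT = 1%E.
Proof.
rewrite -setXTT /square_prob product_measure1E//.
transitivity (unit_prob setT * unit_prob setT)%E; first by [].
by rewrite !probability_setT mule1.
Qed.

Lemma square_prob_fin : (square_prob setT < +oo)%E.
Proof. by rewrite square_prob_setT ltry. Qed.

Lemma unit_prob_fin : (unit_prob setT < +oo)%E.
Proof. by rewrite probability_setT ltry. Qed.

Lemma bounded_measurable_fst (f : measurableTypeR R -> R) : bounded_measurable f ->
  bounded_measurable (fun y : measurableTypeR R * measurableTypeR R => f y.1).
Proof.
move=> [mf [M fM]]; split; last by exists M.
by apply: measurableT_comp.
Qed.

Lemma bounded_measurable_snd (f : measurableTypeR R -> R) : bounded_measurable f ->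
  bounded_measurable (fun y : measurableTypeR R * measurableTypeR R => f y.2).
Proof.
move=> [mf [M fM]]; split; last by exists M.
by apply: measurableT_comp.
Qed.

Lemma Rintegral_square_prob (g h : measurableTypeR R -> R) :
  bounded_measurable g -> bounded_measurable h ->
  \int[square_prob]_y (g y.1 * h y.2) = \int[unit_prob]_x g x * \int[unit_prob]_x h x.
Proof.
move=> bg bh; rewrite /Rintegral -integral12_prod_meas1; last first.
  apply: bounded_measurable_integrable; first exact: square_prob_fin.
  apply: bounded_measurableM; first exact: bounded_measurable_fst.
  exact: bounded_measurable_snd.
have ih := bounded_measurable_integrable unit_prob_fin bh.
have ig := bounded_measurable_integrable unit_prob_fin bg.
rewrite -fineM; [|exact: integrable_fin_num|exact: integrable_fin_num].
congr fine; rewrite /fubini_F /=.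
under eq_integral => x _.
  under eq_integral => z _ do rewrite EFinM.
  rewrite integralZl//; over.
rewrite /=; set c := (\int[_]_x (h x)%:E)%E.
have -> : c = (fine c)%:E by rewrite fineK//; exact: integrable_fin_num.
by rewrite integralZr.
Qed.

Lemma cint_square_prob (G H : measurableTypeR R -> C) :
  cbounded_measurable G -> cbounded_measurable H ->
  cint square_prob (fun y => G y.1 * H y.2) = cint unit_prob G * cint unit_prob H.
Proof.
move=> [G1 G2] [H1 H2].
have bM := fun f g bf bg => bounded_measurableM (@bounded_measurable_fst f bf)
  (@bounded_measurable_snd g bg).
apply: complex_ext; rewrite ?ReM ?ImM /=.
- rewrite -!Rintegral_square_prob// -(bounded_RintegralB square_prob_fin (bM _ _ G1 H1) (bM _ _ G2 H2)).
  by congr (Rintegral _ _ _); apply/funext => x; rewrite ReM.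
- rewrite -!Rintegral_square_prob// -(bounded_RintegralD square_prob_fin (bM _ _ G1 H2) (bM _ _ G2 H1)).
  by congr (Rintegral _ _ _); apply/funext => x; rewrite ImM.
Qed.

End UnitInterval.

(** * Periodic functions, characters and trigonometric polynomials *)

Section TorusFunctions.
Variable R : realType.
Local Notation C := R[i].
Local Notation T2 := (torus R).
Implicit Types (x : T2) (y z : R * R) (k l : 'cV[int]_2).

Lemma torus_projK x : torus_proj (repr x) = x.
Proof. exact: reprK. Qed.

Lemma torus_projP y z : torus_proj y = torus_proj z <-> lattice_eqv y z.
Proof. by split => [/eqquotP|h]; last exact/eqquotP. Qed.

Lemma lattice_eqv_sym y z : lattice_eqv y z = lattice_eqv z y.
Proof. by apply/idP/idP => /torus_projP h; apply/torus_projP. Qed.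

Lemma repr_torus_proj y : lattice_eqv (repr (torus_proj y)) y.
Proof. by apply/torus_projP; rewrite torus_projK. Qed.

(** Functions on the torus are written as [f (repr x)] with f periodic on the plane, so that
    formulas in the coordinates can be used throughout. *)
Definition doubly_periodic X (f : R * R -> X) :=
  forall y z, lattice_eqv y z -> f y = f z.

Lemma doubly_periodic_repr X (f : R * R -> X) y :
  doubly_periodic f -> f (repr (torus_proj y)) = f y.
Proof. by move=> pf; apply: pf; exact: repr_torus_proj. Qed.

Lemma measurable_torus_open (U : set T2) : open U -> measurable U.
Proof. by move=> oU; apply: sub_sigma_algebra. Qed.

(** The choice of representative [repr] carries no regularity; periodicity makes [f] composed with
    [repr] factor through the quotient topology, where it is continuous, hence Borel. *)
Lemma measurable_periodic (f : R * R -> R) : continuous f -> doubly_periodic f ->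
  measurable_fun [set: T2] (fun x => f (repr x)).
Proof.
move=> cf pf.
have cfr : continuous ((f \o repr) : T2 -> R).
  apply: repr_comp_continuous => // a b /eqP ab; apply/eqP/pf.
  exact/torus_projP.
apply: (measurability _ (RGenOpens.measurableE R)).
move=> _ [_ [a [b ->]] <-]; rewrite setTI; apply: measurable_torus_open.
by move/continuousP: cfr; apply; exact: interval_open.
Qed.

(** Both measures on the plane agree on rectangles, and a product of probabilities is determined by
    them. *)
Lemma torus_lebesgueE (B : set T2) : measurable B ->
  torus_lebesgue B = @square_prob R (@torus_proj R @^-1` B).
Proof.
move=> mB; have mpB : measurable (@torus_proj R @^-1` B : set (measurableTypeR R * measurableTypeR R)).
  by rewrite -[X in measurable X]setTI; exact: measurable_torus_proj.
rewrite /torus_lebesgue /pushforward /square_prob.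
have -> // := @product_measure_unique _ _ _ _ R (unit_prob R) (unit_prob R)
  (mrestr (lebesgue_measure \x lebesgue_measure)%E (@measurable_unit_square R)).
move=> X Y mX mY; rewrite /= /mrestr /unit_square -setXI product_measure1E.
- by rewrite !unit_probE.
- by apply: measurableI => //; exact: measurable_itv.
- by apply: measurableI => //; exact: measurable_itv.
Qed.

Lemma torus_lebesgue_setT : torus_lebesgue [set: T2] = 1%E.
Proof. by rewrite torus_lebesgueE// preimage_setT square_prob_setT. Qed.

Lemma torus_lebesgue_fin : (torus_lebesgue [set: T2] < +oo)%E.
Proof. by rewrite torus_lebesgue_setT ltry. Qed.

Lemma Rintegral_torus (f : R * R -> R) : doubly_periodic f ->
  bounded_measurable (fun x : T2 => f (repr x)) ->
  \int[@torus_lebesgue R]_x f (repr x) = \int[@square_prob R]_y f y.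
Proof.
move=> pf bf; have [mf [M fM]] := bf.
have mp := @measurable_torus_proj R.
have H := @integral_pushforward _ _ _ _ _ _ mp (@square_prob R) setT
  (fun x => (f (repr x))%:E).
rewrite /Rintegral; congr fine; apply: (etrans _ (etrans (H _ _ _) _)) => //.
- by apply: eq_measure_integral => B mB _; exact: torus_lebesgueE.
- exact/measurable_EFinP.
- rewrite preimage_setT; apply: (@bounded_measurable_integrable _ _ _ _ (@square_prob_fin R)
    (fun y => f (repr (torus_proj y)))); split; last by exists M.
  exact: (measurableT_comp mf).
- rewrite preimage_setT; apply: eq_integral => y _ /=.
  by rewrite (doubly_periodic_repr _ pf).
Qed.

(** The observable F_k whose Weyl quantization is [translation R N k]; hence a symplectic pairing of
    k and y in place of the dot product. *)
Definition chi k y : C := expi (2 * pi * ((k 1 0)%:~R * y.1 - (k 0 0)%:~R * y.2)).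

Lemma chiD k l y : chi (k + l) y = chi k y * chi l y.
Proof. by rewrite /chi -expiD !mxE !rmorphD /=; congr expi; ring. Qed.

Lemma chi_translate k y z : chi k (y.1 + z.1, y.2 + z.2) = chi k y * chi k z.
Proof. by rewrite /chi -expiD /=; congr expi; ring. Qed.

Lemma chi0 y : chi 0 y = 1.
Proof. by rewrite /chi !mxE !mul0r subrr mulr0 expi0. Qed.

Lemma chiN k y : chi (- k) y = (chi k y)^*%C.
Proof. by rewrite /chi -expiN !mxE !rmorphN /=; congr expi; ring. Qed.

Lemma chi_periodic k : doubly_periodic (chi k).
Proof.
move=> y z /andP[h1 h2].
rewrite /chi -[in RHS](@expi_2piD_int R _ ((k 1 0)%:~R * (y.1 - z.1) - (k 0 0)%:~R * (y.2 - z.2))).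
  by congr expi; ring.
by rewrite rpredB// rpredM// intr_int.
Qed.

Lemma continuous_lin (a b c : R) : continuous (fun y : R * R => c * (a * y.1 - b * y.2)).
Proof.
move=> y; apply: cvgM; first exact: cvg_cst.
by apply: cvgB; apply: cvgM; do ?[exact: cvg_cst|exact: cvg_fst|exact: cvg_snd].
Qed.

Lemma continuous_Re_chi k : continuous (fun y => complex.Re (chi k y)).
Proof.
move=> y; apply: (@continuous_comp _ _ _ (fun y : R * R => 2 * pi * ((k 1 0)%:~R * y.1 - (k 0 0)%:~R * y.2)) cos); last exact: continuous_cos.
exact: continuous_lin.
Qed.

Lemma continuous_Im_chi k : continuous (fun y => complex.Im (chi k y)).
Proof.
move=> y; apply: (@continuous_comp _ _ _ (fun y : R * R => 2 * pi * ((k 1 0)%:~R * y.1 - (k 0 0)%:~R * y.2)) sin); last exact: continuous_sin.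
exact: continuous_lin.
Qed.

Lemma cbounded_measurable_chi k : cbounded_measurable (fun x : T2 => chi k (repr x)).
Proof.
split; split.
- apply: (@measurable_periodic (fun y => complex.Re (chi k y))); first exact: continuous_Re_chi.
  by move=> y z yz; rewrite (chi_periodic k yz).
- by exists 1 => x; exact: cos_max.
- apply: (@measurable_periodic (fun y => complex.Im (chi k y))); first exact: continuous_Im_chi.
  by move=> y z yz; rewrite (chi_periodic k yz).
- by exists 1 => x; exact: sin_max.
Qed.

Lemma cint_torus (f : R * R -> C) : doubly_periodic f ->
  cbounded_measurable (fun x : T2 => f (repr x)) ->
  cint (@torus_lebesgue R) (fun x => f (repr x)) = cint (@square_prob R) f.
Proof.
move=> pf [b1 b2]; apply: complex_ext => /=.
- by rewrite (@Rintegral_torus (fun y => complex.Re (f y)))// => y z /pf ->.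
- by rewrite (@Rintegral_torus (fun y => complex.Im (f y)))// => y z /pf ->.
Qed.

Lemma cint_unit_expi (n : int) :
  cint (unit_prob R) (fun q => expi (2 * pi * n%:~R * q)) = (n == 0)%:R.
Proof.
have [->|n0] := eqVneq n 0.
  under eq_fun do rewrite mulr0 mul0r expi0.
  by apply: complex_ext => /=; rewrite Rintegral_cst// ?mul0r// [X in fine X](_ : _ = 1%E) ?mulr1//; exact: probability_setT.
by rewrite cint_expi// ?intr_int// intr_eq0.
Qed.

Lemma chi_prod k y : chi k y =
  expi (2 * pi * (k 1 0)%:~R * y.1) * expi (2 * pi * (- k 0 0)%:~R * y.2).
Proof. by rewrite /chi -expiD rmorphN /=; congr expi; ring. Qed.

Lemma cint_chi k : cint (@torus_lebesgue R) (fun x => chi k (repr x)) = (k == 0)%:R.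
Proof.
rewrite (cint_torus (@chi_periodic k) (cbounded_measurable_chi k)).
have -> : chi k = (fun y => expi (2 * pi * (k 1 0)%:~R * y.1) *
    expi (2 * pi * (- k 0 0)%:~R * y.2)) by apply/funext => y; exact: chi_prod.
rewrite (@cint_square_prob _ (fun q => expi (2 * pi * (k 1 0)%:~R * q))
  (fun q => expi (2 * pi * (- k 0 0)%:~R * q))); try exact: cbounded_measurable_expi.
rewrite !cint_unit_expi -natrM mulnb oppr_eq0; congr (_ %:R); congr nat_of_bool.
apply/idP/eqP => [/andP[/eqP h1 /eqP h0]|->]; last by rewrite !mxE eqxx.
by apply: cV2P; rewrite mxE.
Qed.

(** The frequencies need not be distinct, so sums and products require no merging of terms. This is
    why double sums below separate the pairs by [k i == k j] and not by [i == j]. *)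
Definition trig_poly (f : R * R -> C) := exists (I : finType) (c : I -> C)
  (k : I -> 'cV[int]_2), forall y, f y = \sum_i c i * chi (k i) y.

Definition real_trig_poly (f : R * R -> R) := trig_poly (fun y => (f y)%:C%C).

Lemma trig_polyD f g : trig_poly f -> trig_poly g -> trig_poly (fun y => f y + g y).
Proof.
move=> [I [c [k fE]]] [J [d [l gE]]].
exists (I + J)%type, (fun s => match s with inl i => c i | inr j => d j end),
  (fun s => match s with inl i => k i | inr j => l j end) => y.
by rewrite big_sumType /= fE gE.
Qed.

Lemma trig_polyM f g : trig_poly f -> trig_poly g -> trig_poly (fun y => f y * g y).
Proof.
move=> [I [c [k fE]]] [J [d [l gE]]].
exists (I * J)%type, (fun s => c s.1 * d s.2), (fun s => k s.1 + l s.2) => y.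
rewrite -(pair_bigA _ (fun i j => c i * d j * chi (k i + l j) y)) /= fE gE mulr_suml.
apply: eq_bigr => i _; rewrite mulr_sumr; apply: eq_bigr => j _.
by rewrite chiD; ring.
Qed.

Lemma trig_poly_cst (c : C) : trig_poly (fun=> c).
Proof.
exists unit, (fun=> c), (fun=> 0) => y.
by rewrite (big_pred1 tt) ?chi0 ?mulr1//; case.
Qed.

Lemma trig_poly_chi k : trig_poly (chi k).
Proof.
exists unit, (fun=> 1), (fun=> k) => y.
by rewrite (big_pred1 tt) ?mul1r//; case.
Qed.

Lemma trig_poly_translate f z : trig_poly f ->
  trig_poly (fun y => f (y.1 + z.1, y.2 + z.2)).
Proof.
move=> [I [c [k fE]]]; exists I, (fun i => c i * chi (k i) z), k => y.
by rewrite fE; apply: eq_bigr => i _; rewrite chi_translate; ring.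
Qed.

Lemma trig_poly_periodic f : trig_poly f -> doubly_periodic f.
Proof.
move=> [I [c [k fE]]] y z yz; rewrite !fE.
by apply: eq_bigr => i _; rewrite (chi_periodic _ yz).
Qed.

Lemma cbounded_measurable_trig f : trig_poly f ->
  cbounded_measurable (fun x : T2 => f (repr x)).
Proof.
move=> [I [c [k fE]]]; under eq_fun do rewrite fE.
apply: cbounded_measurable_sum => i _; apply: cbounded_measurableM.
  exact: cbounded_measurable_cst.
exact: cbounded_measurable_chi.
Qed.

Lemma real_trig_polyD f g : real_trig_poly f -> real_trig_poly g ->
  real_trig_poly (fun y => f y + g y).
Proof.
by move=> tf /(trig_polyD tf); congr trig_poly; apply/funext => y; rewrite rmorphD.
Qed.

Lemma real_trig_polyM f g : real_trig_poly f -> real_trig_poly g ->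
  real_trig_poly (fun y => f y * g y).
Proof.
by move=> tf /(trig_polyM tf); congr trig_poly; apply/funext => y; rewrite rmorphM.
Qed.

Lemma real_trig_poly_cst c : real_trig_poly (fun=> c).
Proof. exact: trig_poly_cst. Qed.

Lemma real_trig_polyB f g : real_trig_poly f -> real_trig_poly g ->
  real_trig_poly (fun y => f y - g y).
Proof.
move=> tf /(real_trig_polyM (real_trig_poly_cst (-1))) /(real_trig_polyD tf).
by congr real_trig_poly; apply/funext => y; rewrite mulN1r.
Qed.

Lemma real_trig_polyX f n : real_trig_poly f -> real_trig_poly (fun y => f y ^+ n).
Proof.
move=> tf; elim: n => [|n IH]; first exact: real_trig_poly_cst.
by under eq_fun do rewrite exprS; exact: real_trig_polyM.
Qed.

Lemma real_trig_poly_sum (I : Type) (s : seq I) (f : I -> R * R -> R) :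
  (forall i, real_trig_poly (f i)) -> real_trig_poly (fun y => \sum_(i <- s) f i y).
Proof.
move=> tf; elim: s => [|i s IH].
  by under eq_fun do rewrite big_nil; exact: real_trig_poly_cst.
by under eq_fun do rewrite big_cons; exact: real_trig_polyD.
Qed.

Lemma real_trig_poly_translate f z : real_trig_poly f ->
  real_trig_poly (fun y => f (y.1 + z.1, y.2 + z.2)).
Proof. exact: trig_poly_translate. Qed.

Lemma real_trig_poly_Re_chi k : real_trig_poly (fun y => complex.Re (chi k y)).
Proof.
have : trig_poly (fun y => 2^-1%:C%C * (chi k y + chi (- k) y)).
  apply: trig_polyM; first exact: trig_poly_cst.
  by apply: trig_polyD; exact: trig_poly_chi.
congr trig_poly; apply/funext => y; rewrite chiN; case: (chi k y) => a b.
by apply: complex_ext => /=; field.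
Qed.

Lemma bounded_measurable_trig f : real_trig_poly f ->
  bounded_measurable (fun x : T2 => f (repr x)).
Proof. by move=> /cbounded_measurable_trig[]. Qed.

Lemma real_trig_poly_periodic f : real_trig_poly f -> doubly_periodic f.
Proof. by move=> /trig_poly_periodic pf y z /pf /complexI. Qed.

Lemma cint_trig (m : {measure set T2 -> \bar R}) (I : finType) (c : I -> C)
    (k : I -> 'cV[int]_2) : (m setT < +oo)%E ->
  cint m (fun x => \sum_i c i * chi (k i) (repr x)) =
  \sum_i c i * cint m (fun x => chi (k i) (repr x)).
Proof.
move=> mfin; rewrite cint_sum// => [|i _].
  by apply: eq_bigr => i _; rewrite cintZ//; exact: cbounded_measurable_chi.
apply: cbounded_measurableM; first exact: cbounded_measurable_cst.
exact: cbounded_measurable_chi.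
Qed.

End TorusFunctions.

(** * Comparing measures by trigonometric polynomials *)

Section Basis.
Local Open Scope quotient_scope.
Variable R : realType.
Local Notation C := R[i].
Local Notation T2 := (torus R).
Implicit Types (x : T2) (y z : R * R).

(** A trigonometric substitute for the squared distance to the lattice: values in [0, 1], zeros
    exactly at the lattice points. *)
Definition torus_gap y : R := (2 - cos (2 * pi * y.1) - cos (2 * pi * y.2)) / 4.

Lemma real_trig_poly_gap : real_trig_poly torus_gap.
Proof.
pose k1 : 'cV[int]_2 := \col_i (i == 1)%:R.
pose k2 : 'cV[int]_2 := \col_i (- (i == 0)%:R).
have -> : torus_gap = (fun y => (2 - complex.Re (chi k1 y) - complex.Re (chi k2 y)) * 4^-1).
  apply/funext => y; rewrite /torus_gap /chi !mxE /= !mulr0n !mulr1n.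
  by congr ((2 - cos _ - cos _) / 4); rewrite ?rmorphN /= ?oppr0 /=; ring.
apply: real_trig_polyM; last exact: real_trig_poly_cst.
apply: real_trig_polyB; last exact: real_trig_poly_Re_chi.
apply: real_trig_polyB; last exact: real_trig_poly_Re_chi.
exact: real_trig_poly_cst.
Qed.

Lemma torus_gap_ge0 y : 0 <= torus_gap y.
Proof. by rewrite /torus_gap divr_ge0//; have := cos_le1 (2 * pi * y.1); have := cos_le1 (2 * pi * y.2); lra. Qed.

Lemma torus_gap_le1 y : torus_gap y <= 1.
Proof. by rewrite /torus_gap ler_pdivrMr//; have := cos_geN1 (2 * pi * y.1); have := cos_geN1 (2 * pi * y.2); lra. Qed.

(** Subtracting the nearest integer brings the argument into [0, pi], where cosine is injective and
    decreasing. *)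
Lemma cos_near_int (z : R) : exists n : int,
  `|z - n%:~R| <= 2^-1 /\ cos (2 * pi * z) = cos (2 * pi * `|z - n%:~R|).
Proof.
exists (Num.floor (z + 2^-1)); set n := Num.floor _.
have h1 := floor_le (z + 2^-1); have h2 := floorD1_gt (z + 2^-1).
rewrite -/n in h1 h2; rewrite rmorphD /= in h2.
split; first by rewrite ler_norml; apply/andP; split; lra.
have -> : cos (2 * pi * z) = cos (2 * pi * (z - n%:~R)).
  have := @expi_2piD_int R (z - n%:~R) n%:~R (intr_int _ _).
  by rewrite subrK => /(congr1 (@complex.Re _)).
by case: (ger0P (z - n%:~R)) => _ //; rewrite mulrN cosN.
Qed.

Lemma torus_gap_eq0 y : torus_gap y = 0 -> lattice_eqv y (0, 0).
Proof.
move=> h; have := cos_le1 (2 * pi * y.1); have := cos_le1 (2 * pi * y.2).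
move=> c2 c1; move: h; rewrite /torus_gap => /eqP.
rewrite mulf_eq0 invr_eq0 pnatr_eq0 orbF => /eqP h.
suff int_of (z : R) : cos (2 * pi * z) = 1 -> z \is a Num.int.
  by rewrite /lattice_eqv /= !subr0 !int_of//; lra.
have [n [h1 ->]] := cos_near_int z => c0.
have := @cos_inj R (2 * pi * `|z - n%:~R|) 0; rewrite cos0 c0 !in_itv /= lexx pi_ge0.
have := @pi_gt0 R; have := normr_ge0 (z - n%:~R) => a0 p0.
have -> : 0 <= 2 * pi * `|z - n%:~R| by rewrite !mulr_ge0 ?pi_ge0.
have -> : 2 * pi * `|z - n%:~R| <= pi by nra.
move=> /(_ isT isT erefl)/eqP.
rewrite mulf_eq0 normr_eq0 subr_eq0 mulf_eq0 pnatr_eq0 /= gt_eqF ?pi_gt0//= => /eqP ->.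
exact: intr_int.
Qed.

Lemma torus_gap0 : torus_gap (0, 0) = 0.
Proof. by rewrite /torus_gap /= !mulr0 cos0; lra. Qed.

(** For c = (1 - cos (2 pi d)) / 4, the sum of the two nonnegative terms 1 - cos is below 1 - cos (2
    pi d), so each term is, and monotonicity of cosine on [0, pi] bounds both distances by d. *)
Lemma torus_gap_near (d : R) : 0 < d <= 4^-1 -> exists2 c : R, 0 < c &
  forall z, torus_gap z < c -> exists n m : int, `|z.1 - n%:~R| < d /\ `|z.2 - m%:~R| < d.
Proof.
move=> /andP[d0 d4]; exists ((1 - cos (2 * pi * d)) / 4).
  rewrite divr_gt0// subr_gt0 -[X in _ < X](@cos0 R) ltr_cos ?mulr_gt0 ?pi_gt0//.
  - by rewrite in_itv /= lexx pi_ge0.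
  - by rewrite in_itv /= !mulr_ge0 ?pi_ge0 ?(ltW d0)//=; have := @pi_gt0 R; nra.
move=> z; rewrite /torus_gap ltr_pM2r ?invr_gt0// => h.
suff near_of (s : R) : cos (2 * pi * d) < cos (2 * pi * s) -> exists n : int, `|s - n%:~R| < d.
  have := cos_le1 (2 * pi * z.1); have := cos_le1 (2 * pi * z.2) => c2 c1.
  have [|n hn] := near_of z.1; first by lra.
  have [|m hm] := near_of z.2; first by lra.
  by exists n, m.
have [n [h1 ->]] := cos_near_int s; rewrite ltr_cos.
- by rewrite ltr_pM2l ?mulr_gt0 ?pi_gt0//; exists n.
- by rewrite in_itv /= !mulr_ge0 ?pi_ge0//=; have := @pi_gt0 R; nra.
- by rewrite in_itv /= !mulr_ge0 ?pi_ge0 ?(ltW d0)//=; have := @pi_gt0 R; nra.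
Qed.

(** A base of the topology, countable thanks to rational centers and levels 1/K, whose members are
    sublevel sets of trigonometric polynomials; [threshold_cvg] reaches the indicators of such
    sets. *)
Definition basic_set (p : rat * rat) (K : nat) : set T2 :=
  [set x | torus_gap ((repr x).1 + - ratr p.1, (repr x).2 + - ratr p.2) < K%:R^-1].

Lemma continuous_torus_gap : continuous torus_gap.
Proof.
move=> y; apply: cvgM; last exact: cvg_cst.
by apply: cvgB; [apply: cvgB; first exact: cvg_cst|];
  [apply: (@continuous_comp _ _ _ (fun y : R * R => 2 * pi * y.1) cos)|
   apply: (@continuous_comp _ _ _ (fun y : R * R => 2 * pi * y.2) cos)];
  do ?[exact: continuous_cos]; apply: cvgM; do ?[exact: cvg_cst|exact: cvg_fst|exact: cvg_snd].
Qed.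

Lemma basic_setP (U : set T2) x : open U -> U x ->
  exists p K, basic_set p K.+1 x /\ basic_set p K.+1 `<=` U.
Proof.
move=> oU Ux.
have oV : open (@torus_proj R @^-1` U).
  by move/continuousP: (@pi_continuous _ {eq_quot (lattice_equiv R)}); exact.
have /nbhs_ballP[e /= e0 eV] : nbhs (repr x) (@torus_proj R @^-1` U).
  by apply: open_nbhs_nbhs; split => //; rewrite /= torus_projK.
(* Two distances below d add up, from x' to the rational center and from the center to x; hence e /
   2. The bound 1/4 is the range of [torus_gap_near]. *)
pose d := Num.min (e / 2) 4^-1.
have d0 : 0 < d by rewrite /d lt_min divr_gt0//=.
have de : d + d <= e by rewrite [leRHS]splitr lerD// /d ge_min lexx.
have [|c c0 cP] := @torus_gap_near d; first by rewrite d0 /d ge_min lexx orbT.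
pose K := Num.truncn c^-1.
have Kc : K.+1%:R^-1 <= c.
  by rewrite invf_ple ?posrE// ltW// /K truncnS_gt.
have /nbhs_ballP[r /= r0 rK] : \forall z \near (0 : R, 0 : R), torus_gap z < K.+1%:R^-1.
  have := @continuous_torus_gap (0, 0); rewrite /continuous_at torus_gap0.
  by move=> /cvgr_lt; apply; rewrite invr_gt0.
pose s := Num.min r d; have s0 : 0 < s by rewrite /s lt_min r0 d0.
have near_rat (t : R) : exists q : rat, `|t - ratr q| < s.
  have : t - s < t + s by rewrite ltrD2l (lt_trans _ s0)// oppr_lt0.
  move=> /rat_in_itvoo[q]; rewrite in_itv /= => /andP[h1 h2].
  by exists q; rewrite ltr_norml; apply/andP; split; lra.
have [p1 hp1] := near_rat (repr x).1; have [p2 hp2] := near_rat (repr x).2.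
exists (p1, p2), K; split.
  apply: rK; split; rewrite /ball /= sub0r normrN.
  - by rewrite (lt_le_trans hp1)// /s ge_min lexx.
  - by rewrite (lt_le_trans hp2)// /s ge_min lexx.
move=> x' /= /lt_le_trans /(_ Kc) /cP[n [m [/= hn hm]]].
have sd : s <= d by rewrite /s ge_min lexx orbT.
suff : U (torus_proj ((repr x').1 - n%:~R, (repr x').2 - m%:~R)).
  rewrite (_ : torus_proj _ = x')// -[RHS]torus_projK; apply/torus_projP.
  by rewrite /lattice_eqv /=; apply/andP; split;
    rewrite addrAC subrr add0r rpredN intr_int.
apply: eV; split; rewrite /ball /=.
- move: hn hp1; rewrite !ltr_norml => /andP[? ?] /andP[? ?]; apply/andP; split; lra.
- move: hm hp2; rewrite !ltr_norml => /andP[? ?] /andP[? ?]; apply/andP; split; lra.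
Qed.

Lemma bernoulli_le1 (a : R) (M : nat) : 0 <= a <= 1 ->
  (1 + M%:R * a) * (1 - a) ^+ M <= 1.
Proof.
move=> /andP[a0 a1]; elim: M => [|M IH]; first by rewrite mul0r addr0 expr0 mulr1.
apply: le_trans IH; rewrite exprS mulrA ler_wpM2r ?exprn_ge0 ?subr_ge0//.
rewrite -natr1; have : 0 <= (M%:R + 1) * a * a by rewrite !mulr_ge0// addr_ge0.
lra.
Qed.

(** With s the square root of r, n r^n = (n s^n) s^n, and Bernoulli bounds n s^n by 1 / (1 - s). *)
Lemma cvg_natM_geometric (r : R) : 0 <= r < 1 -> n%:R * r ^+ n @[n --> \oo] --> (0 : R).
Proof.
move=> /andP[r0 r1]; pose s := Num.sqrt r.
have s0 : 0 <= s by exact: sqrtr_ge0.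
have s1 : s < 1 by rewrite /s -[X in _ < X]sqrtr1 ltr_sqrt.
apply: (@squeeze_cvgr _ _ _ _ (fun=> 0) (fun n => (1 - s)^-1 * s ^+ n)).
- apply: nearW => n; rewrite mulr_ge0 ?exprn_ge0//=.
  have -> : r ^+ n = s ^+ n * s ^+ n by rewrite -exprMn -expr2 sqr_sqrtr.
  rewrite mulrA ler_wpM2r ?exprn_ge0// -[leRHS]mul1r ler_pdivlMr ?subr_gt0//.
  have := @bernoulli_le1 (1 - s) n; rewrite subr_ge0 lerBlDr lerDl s0 (ltW s1) => /(_ isT).
  rewrite subKr; have := exprn_ge0 n s0; move: (s ^+ n) => t; lra.
- exact: cvg_cst.
- rewrite -[X in _ --> X](mulr0 (1 - s)^-1); apply: cvgM; first exact: cvg_cst.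
  by apply: cvg_expr; rewrite ger0_norm.
Qed.

(** These are close to the polynomials (1 - u^n)^(K^n) of the elementary proof of the
    Stone-Weierstrass theorem. Bernoulli puts them between 1 - n (K u)^n and 1 / (1 + n (K u)^n).
    The extra factor n in the exponent gives the limit 0 also at u = 1/K, so that the limit is an
    exact indicator. *)
Lemma threshold_cvg (K : nat) (u : R) : (0 < K)%N -> 0 <= u <= 1 ->
  (1 - u ^+ n) ^+ (n * K ^ n) @[n --> \oo] --> ((u < K%:R^-1)%R%:R : R).
Proof.
move=> K0 /andP[u0 u1]; have K0' : 0 < K%:R :> R by rewrite ltr0n.
have un n : 0 <= u ^+ n <= 1 by rewrite exprn_ge0//= exprn_ile1.
case: ltrP => h /=.
- have Ku1 : `|K%:R * u| < 1.
    by rewrite ger0_norm ?mulr_ge0// -ltr_pdivlMl// mulr1.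
  have lim0 : n%:R * (K%:R * u) ^+ n @[n --> \oo] --> (0 : R).
    by apply: cvg_natM_geometric; rewrite mulr_ge0 ?ler0n//=; move: Ku1; rewrite ger0_norm ?mulr_ge0 ?ler0n.
  apply: (@squeeze_cvgr _ _ _ _ (fun n => 1 - n%:R * (K%:R * u) ^+ n) (fun=> 1)); last 2 first.
  + by rewrite -[X in _ --> X]subr0; apply: cvgB => //; exact: cvg_cst.
  + exact: cvg_cst.
  near=> n; have /andP[a0 a1] := un n; apply/andP; split; last first.
    by rewrite exprn_ile1 ?subr_ge0// lerBlDr lerDl.
  have -> : n%:R * (K%:R * u) ^+ n = (n * K ^ n)%:R * u ^+ n.
    by rewrite exprMn natrM natrX mulrA.
  elim: (n * K ^ n)%N => [|M IH]; first by rewrite mul0r subr0 expr0.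
  rewrite exprSr -natr1 mulrDl mul1r opprD addrA.
  have := ler_wpM2r _ IH => /(_ (1 - u ^+ n)).
  rewrite subr_ge0 => /(_ a1); apply: le_trans.
  have : 0 <= M%:R * u ^+ n * u ^+ n by rewrite !mulr_ge0.
  lra.
- apply: (@squeeze_cvgr _ _ _ _ (fun=> 0) (fun n => n.+1%:R^-1)); last 2 first.
  + exact: cvg_cst.
  + exact: cvg_harmonic.
  near=> n; have /andP[a0 a1] := un n; apply/andP; split.
    by rewrite exprn_ge0// subr_ge0.
  have := bernoulli_le1 (n * K ^ n) (un n); rewrite natrM natrX -mulrA -exprMn.
  have : 1 <= (K%:R * u) ^+ n.
    by rewrite exprn_ege1// -ler_pdivrMl// mulr1.
  move=> h1 h2; rewrite -[leRHS]mul1r ler_pdivlMr// mulrC.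
  apply: le_trans h2; rewrite ler_wpM2r ?exprn_ge0 ?subr_ge0//.
  by rewrite -natr1 addrC lerD2l ler_peMr.
Unshelve. all: by end_near. Qed.

End Basis.

(** * Density of trigonometric polynomials in L^2 of a finite measure *)

Section Approximation.
Variable R : realType.
Local Notation T2 := (torus R).
Variable m : {measure set T2 -> \bar R}.
Hypothesis mfin : (m setT < +oo)%E.
Implicit Types (B : set T2) (a : R * R -> R).

(** The indicator of B lies in the L^2(m) closure of the real trigonometric polynomials. Sets, not
    functions, are approximated so that a sigma-algebra argument applies. *)
Definition trig_approximable B := measurable B /\
  forall e, 0 < e -> exists a, real_trig_poly a /\
    \int[m]_x ((\1_B x - a (repr x)) ^+ 2) <= e.

Let bound_indic_trig B a : measurable B -> real_trig_poly a ->
  bounded_measurable (fun x => (\1_B x - a (repr x)) ^+ 2).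
Proof.
move=> mB ta; apply: bounded_measurableX; apply: bounded_measurableB.
  exact: bounded_measurable_indic.
exact: bounded_measurable_trig.
Qed.

Lemma trig_approximableC B : trig_approximable B -> trig_approximable (~` B).
Proof.
move=> [mB aB]; split; first exact: measurableC.
move=> e /aB[a [ta ae]]; exists (fun y => 1 - a y); split.
  by apply: real_trig_polyB => //; exact: real_trig_poly_cst.
rewrite (_ : (fun x => _) = (fun x => (\1_B x - a (repr x)) ^+ 2))//.
apply/funext => x; rewrite !indicE in_setC; case: (x \in B) => /=; ring.
Qed.

(** From x y - s t = x (y - t) + t (x - s) and (p + q)^2 <= 2 p^2 + 2 q^2. *)
Lemma sqr_subM_le (x y s t M : R) : x ^+ 2 <= 1 -> t ^+ 2 <= M ->
  (x * y - s * t) ^+ 2 <= 2 * (y - t) ^+ 2 + 2 * M * (x - s) ^+ 2.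
Proof.
move=> x1 tM; rewrite -subr_ge0 (_ : _ - _ = 2 * ((1 - x ^+ 2) * (y - t) ^+ 2) +
  2 * ((M - t ^+ 2) * (x - s) ^+ 2) + (x * (y - t) - t * (x - s)) ^+ 2); last by ring.
apply: addr_ge0; last exact: sqr_ge0.
by apply: addr_ge0; apply: mulr_ge0 => //; apply: mulr_ge0; rewrite ?subr_ge0 ?sqr_ge0.
Qed.

Lemma trig_approximableI A B : trig_approximable A -> trig_approximable B ->
  trig_approximable (A `&` B).
Proof.
move=> [mA aA] [mB aB]; split; first exact: measurableI.
move=> e e0; have [b [tb bE]] : exists b, real_trig_poly b /\
    \int[m]_x ((\1_B x - b (repr x)) ^+ 2) <= e / 4 by apply: aB; rewrite divr_gt0.
have [_ [M bM]] := bounded_measurable_trig tb.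
have M0 : 0 <= M by apply: le_trans (bM point).
(* The polynomial b is fixed before a, since the tolerance for a depends on the uniform bound M of
   b; each of the two errors then contributes at most e / 2. *)
have [a [ta aE]] : exists a, real_trig_poly a /\
    \int[m]_x ((\1_A x - a (repr x)) ^+ 2) <= e / (4 * (M ^+ 2 + 1)).
  by apply: aA; rewrite divr_gt0// mulr_gt0// ltr_wpDl ?sqr_ge0.
exists (fun y => a y * b y); split; first exact: real_trig_polyM.
have bA := bound_indic_trig mA ta; have bB := bound_indic_trig mB tb.
apply: (@le_trans _ _ (\int[m]_x (2 * (\1_B x - b (repr x)) ^+ 2 +
    (2 * M ^+ 2) * (\1_A x - a (repr x)) ^+ 2))).
  apply: bounded_le_Rintegral => //.
  - apply: (@bound_indic_trig (A `&` B) (fun y => a y * b y)); first exact: measurableI.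
    exact: real_trig_polyM.
  - by apply: bounded_measurableD; apply: bounded_measurableM => //; exact: bounded_measurable_cst.
  - move=> x; have : b (repr x) ^+ 2 <= M ^+ 2.
      by rewrite -real_normK ?num_real// lerXn2r ?nnegrE.
    have -> : \1_(A `&` B) x = \1_A x * \1_B x :> R by rewrite !indicE in_setI -natrM mulnb.
    by apply: sqr_subM_le; rewrite indicE; case: (x \in A); rewrite ?expr1n ?expr0n.
rewrite bounded_RintegralD//; last 2 first.
- by apply: bounded_measurableM => //; exact: bounded_measurable_cst.
- by apply: bounded_measurableM => //; exact: bounded_measurable_cst.
rewrite !bounded_RintegralZ//.
have h : (2 * M ^+ 2) * (\int[m]_x ((\1_A x - a (repr x)) ^+ 2)) <=
    (2 * M ^+ 2) * (e / (4 * (M ^+ 2 + 1))) by rewrite ler_wpM2l// mulr_ge0 ?sqr_ge0.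
have h2 : (2 * M ^+ 2) * (e / (4 * (M ^+ 2 + 1))) <= e / 2.
  have M1 : 0 < M ^+ 2 + 1 by rewrite ltr_wpDl ?sqr_ge0.
  rewrite mulrA ler_pdivrMr ?mulr_gt0//.
  have := sqr_ge0 M; move: (M ^+ 2) => M2; lra.
lra.
Qed.

Lemma trig_approximableU A B : trig_approximable A -> trig_approximable B ->
  trig_approximable (A `|` B).
Proof.
move=> /trig_approximableC aA /trig_approximableC aB.
rewrite -[_ `|` _]setCK setCU; apply: trig_approximableC.
exact: trig_approximableI.
Qed.

Lemma trig_approximable0 : trig_approximable set0.
Proof.
split => // e e0; exists (fun=> 0); split; first exact: real_trig_poly_cst.
rewrite (_ : (fun x => _) = (fun=> 0)) ?Rintegral_cst ?mul0r ?ltW//.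
by apply/funext => x; rewrite indic0 subr0 expr0n.
Qed.

Lemma trig_approximable_cvg B (a : nat -> R * R -> R) : measurable B ->
  (forall n, real_trig_poly (a n)) -> (forall n y, 0 <= a n y <= 1) ->
  (forall x, a n (repr x) @[n --> \oo] --> (\1_B x : R)) -> trig_approximable B.
Proof.
move=> mB ta a01 aB; split => // e e0.
have : \int[m]_x ((\1_B x - a n (repr x)) ^+ 2) @[n --> \oo] --> \int[m]_x (0 : R).
  apply: (@bounded_convergence _ _ _ _ mfin _ _ 1).
  - by move=> n; have [] := bound_indic_trig mB (ta n).
  - move=> n x; rewrite ger0_norm ?sqr_ge0//; have := a01 n (repr x).
    rewrite indicE; case: (x \in B) => /= /andP[a0 a1]; last by rewrite sub0r sqrrN exprn_ile1.
    by rewrite exprn_ile1 ?subr_ge0// lerBlDr lerDl.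
  - move=> x; rewrite -[X in _ --> X](expr0n _ 2).
    rewrite -[in X in _ --> X](subrr (\1_B x)).
    under eq_fun do rewrite expr2; rewrite expr2.
    by apply: cvgM; apply: cvgB; do ?exact: cvg_cst.
rewrite Rintegral_cst// mul0r => /cvgr0_norm_le /(_ _ e0)[n _ /(_ n (leqnn _))] h.
exists (a n); split => //; apply: le_trans h; exact: ler_norm.
Qed.

(** Finite unions approach the countable union in L^2(m) by bounded convergence, and each finite
    union is already approximable; the two errors e / 4 are doubled by (p + q)^2 <= 2 p^2 + 2
    q^2. *)
Lemma trig_approximable_bigcup (B : nat -> set T2) :
  (forall n, trig_approximable (B n)) -> trig_approximable (\bigcup_n B n).
Proof.
move=> aB; have mB n : measurable (B n) by have [] := aB n.
have mU : measurable (\bigcup_n B n) by exact: bigcup_measurable.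
pose U n := \big[setU/set0]_(i < n) B i.
have aU n : trig_approximable (U n).
  rewrite /U; elim/big_ind : _ => // [|X Y aX aY]; first exact: trig_approximable0.
  exact: trig_approximableU.
have mUn n : measurable (U n) by have [] := aU n.
split => // e e0.
have : \int[m]_x ((\1_(\bigcup_n B n) x - \1_(U n) x) ^+ 2) @[n --> \oo] --> \int[m]_x (0 : R).
  apply: (@bounded_convergence _ _ _ _ mfin _ _ 1).
  - move=> n; apply: measurable_funX; apply: measurable_funB; exact: measurable_indic.
  - by move=> n x; rewrite !indicE; case: (_ \in _); case: (_ \in _); rewrite /= ?subrr ?subr0 ?sub0r ?sqrrN ?expr1n ?expr0n ?normr1 ?normr0.
  - move=> x; apply: cvg_near_cst; have [[N _ BN]|nB] := pselect ((\bigcup_n B n) x).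
      exists N.+1 => // n /= Nn; rewrite !indicE !mem_set ?subrr ?expr0n//.
        by rewrite /U -bigcup_mkord; exists N.
      by exists N.
    apply: nearW => n; rewrite !indicE !memNset ?subrr ?expr0n//.
    by rewrite /U -bigcup_mkord => -[k _ Bk]; apply: nB; exists k.
rewrite Rintegral_cst// mul0r => /cvgr0_norm_le /(_ (e / 4)) []; first by rewrite divr_gt0.
move=> n _ /(_ n (leqnn _)) /= h.
have [_ /(_ (e / 4)) []] := aU n; first by rewrite divr_gt0.
move=> a [ta ae]; exists a; split => //.
have b1 : bounded_measurable (fun x : T2 => (\1_(\bigcup_n B n) x - \1_(U n) x : R) ^+ 2).
  by apply: bounded_measurableX; apply: bounded_measurableB; exact: bounded_measurable_indic.
have b2 := bound_indic_trig (mUn n) ta.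
apply: (@le_trans _ _ (\int[m]_x (2 * (\1_(\bigcup_n B n) x - \1_(U n) x) ^+ 2 +
    2 * (\1_(U n) x - a (repr x)) ^+ 2))).
  apply: bounded_le_Rintegral => //; first exact: bound_indic_trig.
    by apply: bounded_measurableD; apply: bounded_measurableM => //; exact: bounded_measurable_cst.
  move=> x; move: (\1_ _ _) (\1_ _ _) (a _) => r s t.
  have := sqr_ge0 (s - r - (r - t)); lra.
rewrite bounded_RintegralD//; last 2 first.
- by apply: bounded_measurableM => //; exact: bounded_measurable_cst.
- by apply: bounded_measurableM => //; exact: bounded_measurable_cst.
rewrite !bounded_RintegralZ//; have := ler_norm (\int[m]_x (\1_(\bigcup_n B n) x - \1_(U n) x) ^+ 2).
lra.
Qed.

Lemma trig_approximable_basic p K : trig_approximable (@basic_set R p K.+1).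
Proof.
pose v y := torus_gap (y.1 + - ratr p.1, y.2 + - ratr p.2) : R.
have tv : real_trig_poly v.
  exact: (@real_trig_poly_translate _ _ (- ratr p.1, - ratr p.2) (@real_trig_poly_gap R)).
have mB : measurable (@basic_set R p K.+1).
  have -> : @basic_set R p K.+1 = (fun x : T2 => v (repr x)) @^-1` `]-oo, K.+1%:R^-1[%classic.
    by apply/seteqP; split => x; rewrite /basic_set /= in_itv.
  by rewrite -[X in measurable X]setTI; have [mv _] := bounded_measurable_trig tv; apply: mv.
have v01 y : 0 <= v y <= 1 by rewrite torus_gap_ge0 torus_gap_le1.
apply: (@trig_approximable_cvg _ (fun n y => (1 - v y ^+ n) ^+ (n * K.+1 ^ n))) => //.
- move=> n; apply: real_trig_polyX; apply: real_trig_polyB; first exact: real_trig_poly_cst.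
  exact: real_trig_polyX.
- move=> n y; have /andP[v0 v1] := v01 y.
  by rewrite exprn_ge0 ?exprn_ile1 ?subr_ge0 ?exprn_ile1// lerBlDr lerDl exprn_ge0.
- move=> x; have := @threshold_cvg R K.+1 (v (repr x)) isT (v01 _).
  rewrite indicE; congr (_ --> _); congr (_%:R); congr nat_of_bool.
  by apply/idP/idP; rewrite inE.
Qed.

(** The approximable sets form a sigma-algebra containing the countable base, hence every open set
    and every Borel set. *)
Lemma trig_approximable_measurable B : measurable B -> trig_approximable B.
Proof.
apply: smallest_sub => /=.
  split => [|A aA|A aA].
  - exact: trig_approximable0.
  - by rewrite setTD; exact: trig_approximableC.
  - exact: trig_approximable_bigcup.
move=> U oU.
pose S (n : nat) : set T2 := if (choice.unpickle n : option (rat * rat * nat)) is Some s then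
  (if `[< @basic_set R s.1 s.2.+1 `<=` U >] then @basic_set R s.1 s.2.+1 else set0) else set0.
have -> : U = \bigcup_n S n.
  apply/seteqP; split => [x Ux|x [n _]].
    have [p [K [xp sub]]] := basic_setP oU Ux.
    have [n nE] : exists n, choice.unpickle n = Some (p, K).
      by exists (choice.pickle (p, K)); exact: choice.pickleK.
    exists n => //; rewrite /S nE /=; by case: asboolP.
  rewrite /S; case: (choice.unpickle n) => // s; case: asboolP => // sub; exact: sub.
apply: trig_approximable_bigcup => n; rewrite /S.
case: (choice.unpickle n) => [s|]; last exact: trig_approximable0.
case: asboolP => _; last exact: trig_approximable0.
exact: trig_approximable_basic.
Qed.

End Approximation.

(** * Inequalities between measures tested on squares of trigonometric polynomials *)

Section Comparison.
Variable R : realType.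
Local Notation T2 := (torus R).

Lemma Rintegral_measure_addl (m1 m2 : {measure set T2 -> \bar R}) (f : T2 -> R) :
  (m1 setT < +oo)%E -> (m2 setT < +oo)%E -> bounded_measurable f -> (forall x, 0 <= f x) ->
  \int[measure_add m1 m2]_x f x = \int[m1]_x f x + \int[m2]_x f x.
Proof.
move=> f1 f2 bf f0; rewrite /Rintegral ge0_integral_measure_add//.
- by rewrite fineD//; apply: integrable_fin_num => //; exact: bounded_measurable_integrable.
- by move=> x _; rewrite lee_fin.
- by apply/measurable_EFinP; have [] := bf.
Qed.

(** One polynomial must serve both measures, so the indicator of B is approximated in L^2(m1 + m2).
    Closeness of a to the indicator in L^2 then gives closeness of a^2 to it in L^1 of each
    measure. *)
Lemma le_measure_trig (m1 m2 : {measure set T2 -> \bar R}) (c : R) :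
  (m1 setT < +oo)%E -> (m2 setT < +oo)%E -> 0 <= c ->
  (forall a, real_trig_poly a ->
    c * \int[m2]_x (a (repr x) ^+ 2) <= \int[m1]_x (a (repr x) ^+ 2)) ->
  forall B, measurable B -> c * fine (m2 B) <= fine (m1 B).
Proof.
move=> fin1 fin2 c0 hc B mB.
have fin : (measure_add m1 m2 setT < +oo)%E by rewrite measure_addE lte_add_pinfty.
have [_ aB] := trig_approximable_measurable fin mB.
pose M1 := fine (m1 setT); pose M2 := fine (m2 setT).
have M10 : 0 <= M1 by rewrite fine_ge0.
have M20 : 0 <= M2 by rewrite fine_ge0.
apply/ler_addgt0Pr => e e0.
(* The errors d (M1 + 2) and c d (M2 + 2) add up to at most e, and d <= 1 lets d^2 be absorbed into
   d. *)
pose d := Num.min 1 (e / ((M1 + 2) + c * (M2 + 2))).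
have den0 : 0 < (M1 + 2) + c * (M2 + 2) by rewrite ltr_pwDl ?mulr_ge0// ?addr_ge0// ltr_wpDl.
have d0 : 0 < d by rewrite /d lt_min ltr01 divr_gt0.
have d1 : d <= 1 by rewrite /d ge_min lexx.
have de : d * ((M1 + 2) + c * (M2 + 2)) <= e.
  by rewrite -ler_pdivlMr// /d ge_min lexx orbT.
have [a [ta ae]] := aB (d ^+ 2) (exprn_gt0 2 d0).
have ba : bounded_measurable (fun x : T2 => a (repr x)) by exact: bounded_measurable_trig.
have b1 : bounded_measurable (\1_B : T2 -> R) by exact: bounded_measurable_indic.
have bdiff : bounded_measurable (fun x => (\1_B x - a (repr x)) ^+ 2).
  by apply: bounded_measurableX; exact: bounded_measurableB.
have near_m (m : {measure set T2 -> \bar R}) : (m setT < +oo)%E ->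
    \int[m]_x ((\1_B x - a (repr x)) ^+ 2) <= d ^+ 2 ->
    `|\int[m]_x (a (repr x) ^+ 2) - fine (m B)| <= d * (fine (m setT) + 2).
  move=> mfin md; rewrite -Rintegral_indic// -bounded_RintegralB//; last exact: bounded_measurableX.
  have bd : bounded_measurable (fun x : T2 => d + (1 + d^-1) * (\1_B x - a (repr x)) ^+ 2).
    apply: bounded_measurableD; first exact: bounded_measurable_cst.
    by apply: bounded_measurableM => //; exact: bounded_measurable_cst.
  have intd : \int[m]_x (d + (1 + d^-1) * (\1_B x - a (repr x)) ^+ 2) <= d * (fine (m setT) + 2).
    rewrite bounded_RintegralD//; last 2 first.
    - exact: bounded_measurable_cst.
    - by apply: bounded_measurableM => //; exact: bounded_measurable_cst.
    rewrite bounded_RintegralZ// Rintegral_cst//.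
    have : (1 + d^-1) * \int[m]_x ((\1_B x - a (repr x)) ^+ 2) <= (1 + d^-1) * d ^+ 2.
      by rewrite ler_wpM2l// addr_ge0// invr_ge0 ltW.
    have -> : (1 + d^-1) * d ^+ 2 = d ^+ 2 + d by field; rewrite gt_eqF.
    have : d ^+ 2 <= d by rewrite expr2 ler_piMl// ltW.
    lra.
  (* With u = 1 - t, t^2 - 1 = u^2 - 2 u and 2 |u| <= d + u^2 / d; off B the left-hand side is t^2
     itself. *)
  have pt (x : T2) : `|a (repr x) ^+ 2 - \1_B x| <= d + (1 + d^-1) * (\1_B x - a (repr x)) ^+ 2.
    have : d^-1 * d = 1 by rewrite mulVf// gt_eqF.
    have := d0; rewrite -invr_gt0; move: (d^-1) => r r0 rd.
    rewrite indicE; move: (a _) => t.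
    have := sqr_ge0 t; have := sqr_ge0 (1 - t).
    have : 0 <= r * (d - (1 - t)) ^+ 2 by rewrite mulr_ge0 ?sqr_ge0// ltW.
    have : 0 <= r * (d + (1 - t)) ^+ 2 by rewrite mulr_ge0 ?sqr_ge0// ltW.
    have -> : r * (d - (1 - t)) ^+ 2 = (r * d) * d - (r * d) * 2 * (1 - t) + r * (1 - t) ^+ 2 by ring.
    have -> : r * (d + (1 - t)) ^+ 2 = (r * d) * d + (r * d) * 2 * (1 - t) + r * (1 - t) ^+ 2 by ring.
    rewrite rd; have : 0 <= r * t ^+ 2 by rewrite mulr_ge0 ?sqr_ge0// ltW.
    by case: (x \in B); rewrite /= ler_norml => *; apply/andP; split; lra.
  rewrite ler_norml; apply/andP; split.
  - rewrite lerNl -mulN1r -bounded_RintegralZ//; last by apply: bounded_measurableB => //; exact: bounded_measurableX.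
    apply: le_trans intd; apply: bounded_le_Rintegral => //.
      apply: bounded_measurableM; first exact: bounded_measurable_cst.
      by apply: bounded_measurableB => //; exact: bounded_measurableX.
    by move=> x; rewrite mulN1r (le_trans _ (pt x))// ler_normr lexx orbT.
  - apply: le_trans intd; apply: bounded_le_Rintegral => //.
      by apply: bounded_measurableB => //; exact: bounded_measurableX.
    by move=> x; rewrite (le_trans _ (pt x))// ler_norm.
have sq0 (x : T2) : 0 <= (\1_B x - a (repr x)) ^+ 2 by exact: sqr_ge0.
move: ae; rewrite Rintegral_measure_addl// => ae.
have i1 : 0 <= \int[m1]_x ((\1_B x - a (repr x)) ^+ 2) by exact: Rintegral_ge0.
have i2 : 0 <= \int[m2]_x ((\1_B x - a (repr x)) ^+ 2) by exact: Rintegral_ge0.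
have /andP[_ n1] : (- (d * (M1 + 2)) <= \int[m1]_x (a (repr x) ^+ 2) - fine (m1 B) <= d * (M1 + 2)).
  by rewrite -ler_norml; apply: near_m => //; lra.
have /andP[n2 _] : (- (d * (M2 + 2)) <= \int[m2]_x (a (repr x) ^+ 2) - fine (m2 B) <= d * (M2 + 2)).
  by rewrite -ler_norml; apply: near_m => //; lra.
have := hc _ ta.
have : c * (fine (m2 B) - d * (M2 + 2)) <= c * \int[m2]_x (a (repr x) ^+ 2).
  by rewrite ler_wpM2l//; lra.
have : d * ((M1 + 2) + c * (M2 + 2)) = d * (M1 + 2) + c * (d * (M2 + 2)) by ring.
rewrite mulrBr; lra.
Qed.

End Comparison.

(** * Husimi measures of characters *)

Section GeometricTails.
Variable R : realType.
Local Notation C := R[i].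

(** The tail is explicit in K and r, so that convergence of the coherent-state series is locally
    uniform in x and continuity passes to the limit. *)
Lemma geometric_cauchy_cvg (s : nat -> R) (K r : R) : 0 <= r < 1 -> 0 <= K ->
  (forall n, `|s n.+1 - s n| <= K * r ^+ n) ->
  cvgn s /\ forall n, `|limn s - s n| <= K / (1 - r) * r ^+ n.
Proof.
move=> /andP[r0 r1] K0 hs; have r1' : 0 < 1 - r by rewrite subr_gt0.
have tail n k : `|s (n + k)%N - s n| <= K / (1 - r) * r ^+ n.
  suff : `|s (n + k)%N - s n| <= K / (1 - r) * (r ^+ n - r ^+ (n + k)).
    move=> /le_trans; apply; rewrite ler_wpM2l ?divr_ge0 ?(ltW r1')//.
    by rewrite gerBl exprn_ge0.
  elim: k => [|k IH]; first by rewrite addn0 !subrr normr0 mulr0.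
  rewrite (_ : s (n + k.+1)%N - s n = (s (n + k).+1 - s (n + k)%N) + (s (n + k)%N - s n)); last first.
    by rewrite addnS; ring.
  rewrite (le_trans (ler_normD _ _))//; have := hs (n + k)%N.
  have -> : K * r ^+ (n + k) = K / (1 - r) * (r ^+ (n + k) - r ^+ (n + k.+1)).
    by rewrite addnS exprS; field; rewrite gt_eqF.
  move: IH; rewrite !mulrBr; lra.
have cs : cvgn s.
  apply: cauchy_cvg; apply/cauchy_exP => e e0.
  have : K / (1 - r) * r ^+ n @[n --> \oo] --> (0 : R).
    rewrite -[X in _ --> X](mulr0 (K / (1 - r))); apply: cvgM; first exact: cvg_cst.
    by apply: cvg_expr; rewrite ger0_norm.
  move=> /cvgr0_norm_lt /(_ _ e0)[n _ /(_ n (leqnn _))] /= hn.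
  exists (s n); exists n => // k /= nk; rewrite /ball /= distrC -(subnKC nk).
  by apply: le_lt_trans (tail _ _) _; apply: le_lt_trans hn; exact: ler_norm.
split => // n.
have cd : `|s k - s n| @[k --> \oo] --> `|limn s - s n|.
  by apply: cvg_norm; apply: cvgB => //; exact: cvg_cst.
apply: (ler_cvg_to cd (cvg_cst _)).
by exists n => // k /= nk; rewrite -(subnKC nk).
Qed.

Lemma continuous_geometric_limit (T : topologicalType) (f : T -> R) (s : nat -> T -> R)
    (r : R) : 0 <= r < 1 -> (forall n, continuous (s n)) ->
  (forall x : T, exists K, \forall y \near x, forall n, `|f y - s n y| <= K * r ^+ n) ->
  continuous f.
Proof.
move=> /andP[r0 r1] cs hf x; have [K hK] := hf x.
apply/cvgrPdist_le => e e0.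
have : K * r ^+ n @[n --> \oo] --> (0 : R).
  rewrite -[X in _ --> X](mulr0 K); apply: cvgM; first exact: cvg_cst.
  by apply: cvg_expr; rewrite ger0_norm.
have e3 : 0 < e / 3 by rewrite divr_gt0.
move=> /cvgr0_norm_le /(_ _ e3)[n _ /(_ n (leqnn _))] /= hn.
have hn' : K * r ^+ n <= e / 3 by apply: le_trans hn; exact: ler_norm.
have := cs n x => /cvgrPdist_le /(_ _ e3) csn.
have hx := nbhs_singleton hK.
apply: filterS2 hK csn => y /(_ n) h2 h3; have h1 := hx n.
have -> : f x - f y = (f x - s n x) + (s n x - s n y) - (f y - s n y) by ring.
rewrite (le_trans (ler_normB _ _))//.
have := ler_normD (f x - s n x) (s n x - s n y); lra.
Qed.

Definition zpartial (u : int -> C) (M : nat) : C :=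
  \sum_(m < M.*2.+1) u (m%:Z - M%:Z).

Lemma zpartialS u M : zpartial u M.+1 = zpartial u M + (u (- M.+1%:Z) + u M.+1%:Z).
Proof.
rewrite /zpartial doubleS big_ord_recl big_ord_recr /=.
have -> : (bump 0 M.*2.+1)%:Z - M.+1%:Z = M.+1%:Z by rewrite /bump /=; lia.
rewrite sub0r (eq_bigr (fun i : 'I_M.*2.+1 => u (i%:Z - M%:Z))) => [|i _]; first by ring.
by congr u; rewrite /bump /=; lia.
Qed.

Lemma zpartial_ccvg_uniq u l : ccvg (zpartial u) l -> zsum u = l.
Proof.
move=> [h1 h2]; rewrite /zsum; apply: complex_ext => /=.
- exact: (cvg_lim (@Rhausdorff R) h1).
- exact: (cvg_lim (@Rhausdorff R) h2).
Qed.

Lemma zsum_geometric u (K r : R) : 0 <= r < 1 -> 0 <= K ->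
  (forall m : int, Num.sqrt (sqnorm (u m)) <= K * r ^+ `|m|) ->
  ccvg (zpartial u) (zsum u) /\ forall n,
  `|complex.Re (zsum u) - complex.Re (zpartial u n)| <= 2 * K / (1 - r) * r ^+ n /\
  `|complex.Im (zsum u) - complex.Im (zpartial u n)| <= 2 * K / (1 - r) * r ^+ n.
Proof.
move=> r01 K0 hu; have [r0 r1] := andP r01.
have step n : Num.sqrt (sqnorm (zpartial u n.+1 - zpartial u n)) <= 2 * K * r ^+ n.
  rewrite zpartialS addrAC subrr add0r (le_trans (sqrt_sqnormD _ _))//.
  have := hu (- n.+1%:Z); have := hu n.+1%:Z; rewrite abszN absz_nat.
  have : K * r ^+ n.+1 <= K * r ^+ n by rewrite ler_wpM2l// exprS ler_piMl ?exprn_ge0// ltW.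
  lra.
have K20 : 0 <= 2 * K by rewrite mulr_ge0.
have [c1 t1] : cvgn (fun n => complex.Re (zpartial u n)) /\ forall n,
    `|limn (fun n => complex.Re (zpartial u n)) - complex.Re (zpartial u n)| <= 2 * K / (1 - r) * r ^+ n.
  apply: geometric_cauchy_cvg => // n; rewrite -raddfB.
  by apply: le_trans (step n); exact: normr_Re.
have [c2 t2] : cvgn (fun n => complex.Im (zpartial u n)) /\ forall n,
    `|limn (fun n => complex.Im (zpartial u n)) - complex.Im (zpartial u n)| <= 2 * K / (1 - r) * r ^+ n.
  apply: geometric_cauchy_cvg => // n; rewrite -raddfB.
  by apply: le_trans (step n); exact: normr_Im.
by split; [split|].
Qed.

(** A shift by one changes the symmetric partial sum by the boundary terms u (- M - 1) - u M only,
    and these vanish in the limit. *)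
Lemma zsum_shift u c (K r : R) : 0 <= r < 1 -> 0 <= K ->
  (forall m : int, Num.sqrt (sqnorm (u m)) <= K * r ^+ `|m|) ->
  zsum (fun m => c * u (m - 1)) = c * zsum u.
Proof.
move=> r01 K0 hu; have [r0 r1] := andP r01.
have [cu _] := zsum_geometric r01 K0 hu.
apply: zpartial_ccvg_uniq.
have shiftE M : zpartial (fun m => c * u (m - 1)) M =
    c * (zpartial u M + (u (- M.+1%:Z) - u M%:Z)).
  rewrite /zpartial -mulr_sumr; congr (_ * _); rewrite big_ord_recl /= [in RHS]big_ord_recr /=.
  have -> : M.*2%:Z - M%:Z = M%:Z by lia.
  have -> : 0%:Z - M%:Z - 1 = - M.+1%:Z by lia.
  rewrite (eq_bigr (fun i : 'I_M.*2 => u (i%:Z - M%:Z))) => [|i _]; first by ring.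
  by congr u; rewrite /bump /=; lia.
have small (v : nat -> int) : (forall n, (n <= `|v n|)%N) -> ccvg (fun n => u (v n)) 0.
  move=> hv; have h0 : K * r ^+ n @[n --> \oo] --> (0 : R).
    rewrite -[X in _ --> X](mulr0 K); apply: cvgM; first exact: cvg_cst.
    by apply: cvg_expr; rewrite ger0_norm.
  have le n : Num.sqrt (sqnorm (u (v n))) <= K * r ^+ n.
    rewrite (le_trans (hu _))// ler_wpM2l// -(subnKC (hv n)) exprD ler_piMr ?exprn_ge0//.
    by rewrite exprn_ile1// ltW.
  split => /=; apply: (@squeeze_cvgr _ _ _ _ (fun n => - (K * r ^+ n)) (fun n => K * r ^+ n)) => //.
  - by apply: nearW => n; rewrite -ler_norml (le_trans (normr_Re _)).
  - by rewrite -[X in _ --> X]oppr0; exact: cvgN.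
  - by apply: nearW => n; rewrite -ler_norml (le_trans (normr_Im _)).
  - by rewrite -[X in _ --> X]oppr0; exact: cvgN.
have -> : zpartial (fun m => c * u (m - 1)) = (fun M => c * (zpartial u M + (u (- M.+1%:Z) + - u M%:Z))).
  by apply/funext => M; exact: shiftE.
apply: ccvgM; first exact: ccvg_cst.
rewrite -[X in ccvg _ X]addr0; apply: ccvgD => //.
rewrite -[X in ccvg _ X]addr0; apply: ccvgD; first by apply: small => n; lia.
rewrite -[X in ccvg _ X]oppr0; apply: ccvgN; apply: small => n; lia.
Qed.

Lemma zsumM u c (K r : R) : 0 <= r < 1 -> 0 <= K ->
  (forall m : int, Num.sqrt (sqnorm (u m)) <= K * r ^+ `|m|) ->
  zsum (fun m => c * u m) = c * zsum u.
Proof.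
move=> r01 K0 hu; have [cu _] := zsum_geometric r01 K0 hu.
apply: zpartial_ccvg_uniq.
have -> : zpartial (fun m => c * u m) = (fun M => c * zpartial u M).
  by apply/funext => M; rewrite /zpartial mulr_sumr.
by apply: ccvgM => //; exact: ccvg_cst.
Qed.

End GeometricTails.

(** * Continuity and periodicity of the Husimi density *)

Section CoherentStates.
Variables (R : realType) (N' : nat).
Local Notation N := N'.+1.
Local Notation C := R[i].
Implicit Types (x : R * R) (psi : 'cV[C]_N).

Let N0 : (N%:R : R) != 0. Proof. by rewrite pnatr_eq0. Qed.
Let Ngt0 : 0 < (N%:R : R). Proof. by rewrite ltr0n. Qed.
Let pi0 : (pi : R) != 0. Proof. by rewrite gt_eqF// pi_gt0. Qed.

Lemma hbarV (t : R) : t / hbar R N = 2 * pi * N%:R * t.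
Proof. by rewrite /hbar invrK mulrC. Qed.

Lemma hbar2V (t : R) : t / (2 * hbar R N) = pi * N%:R * t.
Proof. by rewrite /hbar invfM invrK; field. Qed.

Definition gaussian_cst : R := (pi * hbar R N) `^ (- 4^-1).

Lemma gaussian_cst_sqr : gaussian_cst ^+ 2 = Num.sqrt (2 * N%:R).
Proof.
have h : pi * hbar R N = (2 * N%:R)^-1 by rewrite /hbar -mulrA [2 * _]mulrCA invfM mulrA mulfV// mul1r.
rewrite /gaussian_cst h -powR_mulrn ?powR_ge0// -powRrM.
have -> : - 4^-1 * 2%:R = - 2^-1 :> R by field.
by rewrite powRN powR12_sqrt ?invr_ge0 ?mulr_ge0// sqrtrV ?mulr_ge0// invrK.
Qed.

Lemma gaussianE x q : gaussian N x q =
  expi (- (pi * N%:R * (x.1 * x.2))) * (gaussian_cst%:C%C * expi (2 * pi * N%:R * (x.2 * q)) *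
  (expR (- (pi * N%:R * (q - x.1) ^+ 2)))%:C%C).
Proof. by rewrite /gaussian hbarV !hbar2V /gaussian_cst; ring. Qed.

Lemma sqnorm_gaussian x q :
  Num.sqrt (sqnorm (gaussian N x q)) = gaussian_cst * expR (- (pi * N%:R * (q - x.1) ^+ 2)).
Proof.
rewrite gaussianE !sqnormM !sqnorm_expi !sqnorm_real mul1r mulr1 -exprMn sqrtr_sqr ger0_norm//.
by rewrite mulr_ge0 ?powR_ge0 ?expR_ge0.
Qed.

(** With a = q - x.1 the Gaussian exponent is at most - a^2 <= 1 - |a|, and |m| <= |a| + 1 + L. The
    bound is coarse but geometric in m and uniform in j, x.2 and |x.1| <= L. *)
Lemma gaussian_decay (L : R) x (j : nat) (m : int) : `|x.1| <= L -> (j < N)%N ->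
  Num.sqrt (sqnorm (gaussian N x (j%:R / N%:R + m%:~R))) <=
  gaussian_cst * expR (2 + L) * expR (-1) ^+ `|m|.
Proof.
move=> xL jN; rewrite sqnorm_gaussian -[leRHS]mulrA ler_wpM2l ?powR_ge0//.
rewrite -expRM_natl -expRD ler_expR mulrN1.
set a := _ - x.1.
have j01 : 0 <= (j%:R / N%:R : R) <= 1.
  by rewrite divr_ge0//= ler_pdivrMr// mul1r ler_nat ltnW.
have ma : (`|m|%N)%:R <= `|a| + 1 + L.
  have -> : (`|m|%N)%:R = `|m%:~R| :> R by rewrite -intr_norm natr_absz.
  have -> : m%:~R = a - j%:R / N%:R + x.1 by rewrite /a; ring.
  rewrite (le_trans (ler_normD _ _))// lerD// (le_trans (ler_normB _ _))// lerD2l.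
  by case/andP: j01 => ? ?; rewrite ger0_norm.
have piN : 1 <= pi * N%:R :> R.
  have : 1 <= (N%:R : R) by rewrite ler1n.
  by have := @pi_ge2 R; nra.
have : a ^+ 2 <= pi * N%:R * a ^+ 2 by rewrite ler_peMl// sqr_ge0.
have : a ^+ 2 = `|a| ^+ 2 by rewrite real_normK// num_real.
have := sqr_ge0 (`|a| - 1); have := normr_ge0 a.
nra.
Qed.

Lemma expRN1_lt1 : 0 <= (expR (-1) : R) < 1.
Proof. by rewrite expR_ge0 -[X in _ < X]expR0 ltr_expR ltrN10. Qed.

Definition ccontinuous (f : R * R -> C) :=
  continuous (fun x => complex.Re (f x)) /\ continuous (fun x => complex.Im (f x)).

Lemma ccontinuousM f g : ccontinuous f -> ccontinuous g -> ccontinuous (fun x => f x * g x).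
Proof.
move=> [f1 f2] [g1 g2]; split => x.
- by under eq_fun do rewrite ReM; apply: cvgB; apply: cvgM; [exact: f1|exact: g1|exact: f2|exact: g2].
- by under eq_fun do rewrite ImM; apply: cvgD; apply: cvgM; [exact: f1|exact: g2|exact: f2|exact: g1].
Qed.

Lemma ccontinuous_cst c : ccontinuous (fun=> c).
Proof. by split=> x; exact: cvg_cst. Qed.

Lemma ccontinuous_sum (I : finType) (f : I -> R * R -> C) :
  (forall i, ccontinuous (f i)) -> ccontinuous (fun x => \sum_i f i x).
Proof.
move=> cf; elim: (index_enum I) => [|i s [IH1 IH2]].
  by under eq_fun do rewrite big_nil; exact: ccontinuous_cst.
under eq_fun do rewrite big_cons; have [c1 c2] := cf i; split => x.
- by under eq_fun do rewrite raddfD /=; apply: cvgD; [exact: c1|exact: IH1].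
- by under eq_fun do rewrite raddfD /=; apply: cvgD; [exact: c2|exact: IH2].
Qed.

Lemma ccontinuous_expi (g : R * R -> R) : continuous g -> ccontinuous (fun x => expi (g x)).
Proof.
move=> cg; split => x; apply: (@continuous_comp _ _ _ g _); do ?[exact: cg].
- exact: continuous_cos.
- exact: continuous_sin.
Qed.

Lemma ccontinuous_real (g : R * R -> R) : continuous g -> ccontinuous (fun x => (g x)%:C%C).
Proof. by move=> cg; split => //= x; exact: cvg_cst. Qed.

Lemma ccontinuous_gaussian q : ccontinuous (fun x => gaussian N x q).
Proof.
under eq_fun do rewrite gaussianE.
apply: ccontinuousM.
  apply: ccontinuous_expi => x; apply: cvgN; apply: cvgM; first exact: cvg_cst.
  by apply: cvgM; [exact: cvg_fst|exact: cvg_snd].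
apply: ccontinuousM; last first.
  apply: ccontinuous_real => x.
  apply: (@continuous_comp _ _ _ (fun x : R * R => - (pi * N%:R * (q - x.1) ^+ 2)) expR); last exact: continuous_expR.
  apply: cvgN; apply: cvgM; first exact: cvg_cst.
  by under eq_fun do rewrite expr2; rewrite expr2; apply: cvgM; apply: cvgB; do ?[exact: cvg_cst|exact: cvg_fst].
apply: ccontinuousM; first exact: ccontinuous_cst.
apply: ccontinuous_expi => x; apply: cvgM; first exact: cvg_cst.
by apply: cvgM; [exact: cvg_snd|exact: cvg_cst].
Qed.

Definition coherent_term x (j : nat) (m : int) : C := gaussian N x (j%:R / N%:R + m%:~R).

Lemma coherent_zsum x (L : R) (j : 'I_N) : `|x.1| <= L ->
  ccvg (zpartial (coherent_term x j)) (zsum (coherent_term x j)) /\ forall n,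
  `|complex.Re (zsum (coherent_term x j)) - complex.Re (zpartial (coherent_term x j) n)| <=
    2 * (gaussian_cst * expR (2 + L)) / (1 - expR (-1)) * expR (-1) ^+ n /\
  `|complex.Im (zsum (coherent_term x j)) - complex.Im (zpartial (coherent_term x j) n)| <=
    2 * (gaussian_cst * expR (2 + L)) / (1 - expR (-1)) * expR (-1) ^+ n.
Proof.
move=> xL; apply: zsum_geometric; first exact: expRN1_lt1.
- by rewrite mulr_ge0 ?powR_ge0 ?expR_ge0.
- by move=> m; exact: gaussian_decay.
Qed.

Lemma ccontinuous_coherent (j : 'I_N) : ccontinuous (fun x => zsum (coherent_term x j)).
Proof.
have near_le x : \forall y \near x, `|y.1| <= `|x.1| + 1.
  have : (fun y : R * R => `|y.1|) y @[y --> x] --> `|x.1| by apply: cvg_norm; exact: cvg_fst.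
  by move=> /cvgr_le; apply; rewrite ltrDl.
have cpart n : ccontinuous (fun x => zpartial (coherent_term x j) n).
  by apply: ccontinuous_sum => i; exact: ccontinuous_gaussian.
split.
- apply: (@continuous_geometric_limit _ _ _
    (fun n x => complex.Re (zpartial (coherent_term x j) n)) _ expRN1_lt1).
    by move=> n; have [c1 _] := cpart n; exact: c1.
  move=> x; exists (2 * (gaussian_cst * expR (2 + (`|x.1| + 1))) / (1 - expR (-1))).
  by apply: filterS (near_le x) => y yL n; have [_ /(_ n)[]] := coherent_zsum j yL.
- apply: (@continuous_geometric_limit _ _ _
    (fun n x => complex.Im (zpartial (coherent_term x j) n)) _ expRN1_lt1).
    by move=> n; have [_ c2] := cpart n; exact: c2.
  move=> x; exists (2 * (gaussian_cst * expR (2 + (`|x.1| + 1))) / (1 - expR (-1))).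
  by apply: filterS (near_le x) => y yL n; have [_ /(_ n)[]] := coherent_zsum j yL.
Qed.

Lemma braket_coherent psi x : braket psi (coherent_state N x) =
  \sum_(j < N) (psi j 0)^*%C * ((Num.sqrt N%:R)^-1%:C%C * zsum (coherent_term x j)).
Proof. by apply: eq_bigr => j _; rewrite mxE. Qed.

Definition husimi_density psi x : R := N%:R * sqnorm (braket psi (coherent_state N x)).

Lemma continuous_husimi_density psi : continuous (husimi_density psi).
Proof.
have [c1 c2] : ccontinuous (fun x => braket psi (coherent_state N x)).
  under eq_fun do rewrite braket_coherent.
  apply: ccontinuous_sum => j; apply: ccontinuousM; first exact: ccontinuous_cst.
  by apply: ccontinuousM; [exact: ccontinuous_cst|exact: ccontinuous_coherent].
move=> x; apply: cvgM; first exact: cvg_cst.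
rewrite /sqnorm; apply: cvgD.
- exact: (cvg_comp _ _ (c1 x) (@sqr_continuous _ _)).
- exact: (cvg_comp _ _ (c2 x) (@sqr_continuous _ _)).
Qed.

Lemma expi_factor (a b d a' b' : R) (c e : C) : a + b = d + a' + b' ->
  expi a * (c * expi b * e) = expi d * (expi a' * (c * expi b' * e)).
Proof.
move=> /(congr1 (@expi R)); rewrite !expiD => h.
by transitivity (expi a * expi b * (c * e)); [|rewrite h]; ring.
Qed.

Lemma coherent_term_shift1 x (j : nat) m : coherent_term (x.1 + 1, x.2) j m =
  expi (pi * N%:R * x.2) * coherent_term x j (m - 1).
Proof.
rewrite /coherent_term !gaussianE /=.
have -> : j%:R / N%:R + (m - 1)%:~R - x.1 = j%:R / N%:R + m%:~R - (x.1 + 1) :> R.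
  by rewrite rmorphB /=; ring.
by apply: expi_factor; rewrite rmorphB /=; ring.
Qed.

(** Raising p_0 by 1 multiplies the wave by exp (2 i pi N q), which equals 1 at the sites q = j / N
    + m; only the prefactor of the Gaussian leaves a phase. *)
Lemma coherent_term_shift2 x (j : nat) m : coherent_term (x.1, x.2 + 1) j m =
  expi (- (pi * N%:R * x.1)) * coherent_term x j m.
Proof.
rewrite /coherent_term !gaussianE /=.
have h : expi (2 * pi * N%:R * ((x.2 + 1) * (j%:R / N%:R + m%:~R))) =
    expi (2 * pi * N%:R * (x.2 * (j%:R / N%:R + m%:~R))) :> C.
  have -> : 2 * pi * N%:R * ((x.2 + 1) * (j%:R / N%:R + m%:~R)) =
      2 * pi * (N%:R * (x.2 * (j%:R / N%:R + m%:~R)) + (j%:R + N%:R * m%:~R)) :> R.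
    by move: (N%:R) N0 => n n0; field.
  rewrite expi_2piD_int; first by congr expi; ring.
  by rewrite rpredD ?rpredM ?natr_int ?intr_int.
rewrite h; apply: expi_factor; ring.
Qed.

Lemma husimi_density_shift1 psi x : husimi_density psi (x.1 + 1, x.2) = husimi_density psi x.
Proof.
suff E : braket psi (coherent_state N (x.1 + 1, x.2)) = expi (pi * N%:R * x.2) * braket psi (coherent_state N x).
  by rewrite /husimi_density E sqnormM sqnorm_expi mul1r.
rewrite !braket_coherent mulr_sumr; apply: eq_bigr => j _.
have -> : coherent_term (x.1 + 1, x.2) j =
    (fun m => expi (pi * N%:R * x.2) * coherent_term x j (m - 1)).
  by apply/funext => m; exact: coherent_term_shift1.
rewrite (@zsum_shift _ _ _ (gaussian_cst * expR (2 + `|x.1|)) (expR (-1))); first by ring.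
- exact: expRN1_lt1.
- by rewrite mulr_ge0 ?powR_ge0 ?expR_ge0.
- by move=> m; exact: gaussian_decay.
Qed.

Lemma husimi_density_shift2 psi x : husimi_density psi (x.1, x.2 + 1) = husimi_density psi x.
Proof.
suff E : braket psi (coherent_state N (x.1, x.2 + 1)) = expi (- (pi * N%:R * x.1)) * braket psi (coherent_state N x).
  by rewrite /husimi_density E sqnormM sqnorm_expi mul1r.
rewrite !braket_coherent mulr_sumr; apply: eq_bigr => j _.
have -> : coherent_term (x.1, x.2 + 1) j =
    (fun m => expi (- (pi * N%:R * x.1)) * coherent_term x j m).
  by apply/funext => m; exact: coherent_term_shift2.
rewrite (@zsumM _ _ _ (gaussian_cst * expR (2 + `|x.1|)) (expR (-1))); first by ring.
- exact: expRN1_lt1.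
- by rewrite mulr_ge0 ?powR_ge0 ?expR_ge0.
- by move=> m; exact: gaussian_decay.
Qed.

Lemma int_shift_invariant (f : R -> R) : (forall t, f (t + 1) = f t) ->
  forall t s, t - s \is a Num.int -> f t = f s.
Proof.
move=> f1 t s /intrP[n hn]; have -> : t = s + n%:~R by rewrite -hn; ring.
have nat_shift (k : nat) u : f (u + k%:R) = f u.
  by elim: k => [|k IH]; rewrite ?addr0// -natr1 addrA f1.
case: n {hn} => n; first exact: nat_shift.
by rewrite NegzE rmorphN /= -[in RHS](subrK n.+1%:R s) nat_shift.
Qed.

Lemma husimi_density_periodic psi : doubly_periodic (husimi_density psi).
Proof.
move=> [y1 y2] [z1 z2] /andP[/= h1 h2].
transitivity (husimi_density psi (z1, y2)).
  apply: (@int_shift_invariant (fun t => husimi_density psi (t, y2))) h1 => t.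
  exact: (husimi_density_shift1 psi (t, y2)).
apply: (@int_shift_invariant (fun t => husimi_density psi (z1, t))) h2 => t.
exact: (husimi_density_shift2 psi (z1, t)).
Qed.

End CoherentStates.

(** * Unfolding sums over integer translates into integrals on the line *)

Section Unfolding.
Variable R : realType.
Local Notation leb := (@lebesgue_measure R).

Lemma Rintegral_translate (f : R -> R) (a b c : R) : a <= b -> continuous f ->
  \int[leb]_(x in `[a, b]) f (x + c) = \int[leb]_(x in `[a + c, b + c]) f x.
Proof.
move=> ab cf; rewrite /Rintegral; congr fine.
pose F := fun x : R => x + c.
have dF (x : R) : is_derive x 1 F 1.
  by rewrite /F; apply: is_derive_eq; rewrite addr0.
have F'E : F^`()%classic = cst 1.
  by apply/funext => x; rewrite derive1E; have [_ ->] := dF x.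
have cF : continuous F by move=> x; apply: cvgD; [exact: cvg_id|exact: cvg_cst].
have := @integration_by_substitution_increasing R F f a b ab.
rewrite /F => ->.
- by apply: eq_integral => x _; rewrite F'E /= mulr1.
- by move=> x y _ _; rewrite ltrD2r.
- by move=> x _; rewrite F'E; exact: cvg_cst.
- by rewrite F'E; exact: is_cvg_cst.
- by rewrite F'E; exact: is_cvg_cst.
- split.
  + by move=> x _; have [] := dF x.
  + by apply: cvg_at_right_filter; exact: cF.
  + by apply: cvg_at_left_filter; exact: cF.
- exact: continuous_subspaceT.
Qed.

Lemma Rintegral_itv_cat (f : R -> R) (a b c : R) : a <= b -> b <= c ->
  leb.-integrable setT (EFin \o f) ->
  \int[leb]_(x in `[a, c]) f x = \int[leb]_(x in `[a, b]) f x + \int[leb]_(x in `[b, c]) f x.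
Proof.
move=> ab bc intf.
have iS (i : interval R) : leb.-integrable [set` i] (EFin \o f).
  by apply: (integrableS measurableT) => //; exact: measurable_itv.
have := @Rintegral_itvB R f (BLeft a) (BRight c) b (iS _).
rewrite !bnd_simp => /(_ ab bc) h.
rewrite -(@Rintegral_itv_obnd_cbnd R b (BRight c) f); last first.
  by have /integrableP[/measurable_EFinP] := iS (Interval (BRight b) (BRight c)).
by rewrite -h; ring.
Qed.

Lemma sum_Rintegral_unit (f : R -> R) (b : R) (k : nat) :
  leb.-integrable setT (EFin \o f) ->
  \sum_(m < k) \int[leb]_(x in `[b - m%:R, b - m%:R + 1]) f x =
  \int[leb]_(x in `[b + 1 - k%:R, b + 1]) f x.
Proof.
move=> intf; elim: k => [|k IH].
  by rewrite big_ord0 subr0 set_itv1 Rintegral_set1.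
rewrite big_ord_recr /= IH [RHS](@Rintegral_itv_cat _ _ (b + 1 - k%:R)) //.
- have -> : b + 1 - k.+1%:R = b - k%:R by rewrite -natr1; ring.
  by rewrite addrC; have -> : b + 1 - k%:R = b - k%:R + 1 by ring.
- by rewrite -natr1; lra.
- by rewrite gerBl.
Qed.

Lemma cvg_Rintegral_expanding (f : R -> R) : leb.-integrable setT (EFin \o f) ->
  \int[leb]_(x in `[- M%:R, M%:R + 1]) f x @[M --> \oo] --> \int[leb]_x f x.
Proof.
move=> intf; have mf : measurable_fun setT f by have /integrableP[/measurable_EFinP] := intf.
pose g (M : nat) := f \_ `[- M%:R, M%:R + 1].
have [|||||_ _ cg] := @dominated_convergence _ _ _ leb setT measurableT
  (fun M => EFin \o g M) (EFin \o f) (EFin \o (fun x => `|f x|)).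
- by move=> M; apply/measurable_EFinP; apply/(measurable_restrictT _ _).1;
    [exact: measurable_itv|exact: measurable_funTS].
- exact/measurable_EFinP.
- apply: aeW => x _ /=; apply: cvg_near_cst.
  exists (Num.truncn `|x|).+1 => // M /= hM; congr EFin; rewrite /g patchE ifT// inE /= in_itv /=.
  have h : `|x| < M%:R by rewrite (lt_le_trans (truncnS_gt _))// ler_nat.
  by move: h; rewrite ltr_norml => /andP[h1 h2]; apply/andP; split; lra.
- exact: integrable_norm.
- apply: aeW => x M _ /=; rewrite lee_fin /g patchE; case: ifP => // _.
  by rewrite normr0.
under eq_fun do rewrite Rintegral_mkcond.
have fin : (\int[leb]_x (f x)%:E)%E \is a fin_num by exact: integrable_fin_num.
by apply: fine_cvg; rewrite /Rintegral fineK.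
Qed.

(** The translates of the unit interval by the integers from - M to M tile [- M, M + 1], which
    exhausts the line. *)
Lemma sum_unit_prob_cvg (f : R -> R) : bounded_measurable f -> continuous f ->
  leb.-integrable setT (EFin \o f) ->
  \sum_(m < M.*2.+1) \int[unit_prob R]_q f (q - (m%:Z - M%:Z)%:~R) @[M --> \oo] -->
  \int[leb]_x f x.
Proof.
move=> bf cf intf.
have -> : (fun M : nat => \sum_(m < M.*2.+1) \int[unit_prob R]_q f (q - (m%:Z - M%:Z)%:~R)) =
    (fun M : nat => \int[leb]_(x in `[- M%:R, M%:R + 1]) f x).
  apply/funext => M; transitivity (\sum_(m < M.*2.+1)
      \int[leb]_(x in `[M%:R - m%:R, M%:R - m%:R + 1]) f x).
    apply: eq_bigr => m _; rewrite Rintegral_unit_prob; last first.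
      have [mf [K fK]] := bf; split; last by exists K.
      apply: continuous_measurable_fun => q.
      apply: (@continuous_comp _ _ _ (fun q : R => q - _) f); last exact: cf.
      by apply: cvgB; [exact: cvg_id|exact: cvg_cst].
    rewrite Rintegral_translate//.
    have -> : 0 - (m%:Z - M%:Z)%:~R = M%:R - m%:R :> R by rewrite rmorphB /=; ring.
    by have -> : 1 - (m%:Z - M%:Z)%:~R = M%:R - m%:R + 1 :> R by rewrite rmorphB /=; ring.
  rewrite sum_Rintegral_unit//.
  by have -> : M%:R + 1 - M.*2.+1%:R = - M%:R :> R by rewrite -addnn -natr1 natrD; ring.
exact: cvg_Rintegral_expanding.
Qed.

End Unfolding.

(** * Averaging Lipschitz functions over Gaussians of width of order N^(-1/2) *)

Section GaussianMean.
Variables (R : realType) (N' : nat).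
Local Notation N := N'.+1.
Local Notation C := R[i].
Local Notation leb := (@lebesgue_measure R).

Let Ngt0 : 0 < (N%:R : R). Proof. by rewrite ltr0n. Qed.
Let pigt0 : 0 < (pi : R). Proof. exact: pi_gt0. Qed.

Lemma normal_pdf_gauss (s a q p : R) : 0 < p -> s = Num.sqrt p ->
  normal_pdf a s q = (Num.sqrt (p * pi *+ 2))^-1 * expR (- (q - a) ^+ 2 / (p *+ 2)).
Proof.
move=> p0 ->; rewrite normal_pdfE ?gt_eqF ?sqrtr_gt0//.
by rewrite /normal_peak /normal_fun sqr_sqrtr// ltW.
Qed.

(** The variance of [sigma1] is hbar / 2, that of the squared modulus of a coherent state. The wider
    Gaussian with [sigma2], of variance hbar, absorbs the factor |q - a| in first moments. *)
Definition sigma1 : R := Num.sqrt (4 * pi * N%:R)^-1.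
Definition sigma2 : R := Num.sqrt (2 * pi * N%:R)^-1.

Lemma normal_pdf_sigma1 a q :
  normal_pdf a sigma1 q = Num.sqrt (2 * N%:R) * expR (- (2 * pi * N%:R * (q - a) ^+ 2)).
Proof.
rewrite (@normal_pdf_gauss _ _ _ (4 * pi * N%:R)^-1)//; last by rewrite invr_gt0 !mulr_gt0.
congr (_ * expR _).
- rewrite -sqrtrV; last by rewrite mulrn_wge0// mulr_ge0 ?ltW// invr_gt0 !mulr_gt0.
  by congr Num.sqrt; rewrite -mulr_natr; move: (pi : R) pigt0 (N%:R) Ngt0 => p p0 n n0; field; rewrite !gt_eqF.
- by rewrite -mulr_natr; move: (pi : R) pigt0 (N%:R) Ngt0 => p p0 n n0; field; rewrite !gt_eqF.
Qed.

Lemma normal_pdf_sigma2 a q :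
  normal_pdf a sigma2 q = Num.sqrt N%:R * expR (- (pi * N%:R * (q - a) ^+ 2)).
Proof.
rewrite (@normal_pdf_gauss _ _ _ (2 * pi * N%:R)^-1)//; last by rewrite invr_gt0 !mulr_gt0.
congr (_ * expR _).
- rewrite -sqrtrV; last by rewrite mulrn_wge0// mulr_ge0 ?ltW// invr_gt0 !mulr_gt0.
  by congr Num.sqrt; rewrite -mulr_natr; move: (pi : R) pigt0 (N%:R) Ngt0 => p p0 n n0; field; rewrite !gt_eqF.
- by rewrite -mulr_natr; move: (pi : R) pigt0 (N%:R) Ngt0 => p p0 n n0; field; rewrite !gt_eqF.
Qed.

Lemma Rintegral_normal_pdf (a s : R) : \int[leb]_q normal_pdf a s q = 1.
Proof. by rewrite /Rintegral integral_normal_pdf. Qed.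

(** With s^2 = pi N, one has s |z| <= 1 + s^2 z^2 <= exp (s^2 z^2). So half of the Gaussian exponent
    pays for the factor |z| and leaves a gain 1/s. *)
Lemma normr_mul_gauss a q : `|q - a| * normal_pdf a sigma1 q <=
  Num.sqrt (2 / (pi * N%:R)) * normal_pdf a sigma2 q.
Proof.
rewrite normal_pdf_sigma1 normal_pdf_sigma2.
set z := q - a; have pN : 0 < pi * N%:R :> R by rewrite mulr_gt0.
pose s := Num.sqrt (pi * N%:R : R); have s0 : 0 < s by rewrite sqrtr_gt0.
have s2 : s ^+ 2 = pi * N%:R by rewrite sqr_sqrtr// ltW.
have -> : expR (- (2 * pi * N%:R * z ^+ 2)) =
    expR (- (pi * N%:R * z ^+ 2)) * expR (- (pi * N%:R * z ^+ 2)).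
  by rewrite -expRD; congr expR; ring.
have key : (s * `|z|) * expR (- (pi * N%:R * z ^+ 2)) <= 1.
  rewrite expRN ler_pdivrMr ?expR_gt0// mul1r.
  apply: le_trans (expR_ge1Dx _); rewrite -s2.
  have : z ^+ 2 = `|z| ^+ 2 by rewrite real_normK// num_real.
  by move=> ->; have := sqr_ge0 (s * `|z| - 1); have := sqr_ge0 (s * `|z|); rewrite sqrrB exprMn; lra.
have -> : Num.sqrt (2 / (pi * N%:R)) * (Num.sqrt N%:R * expR (- (pi * N%:R * z ^+ 2))) =
    Num.sqrt (2 * N%:R) / s * expR (- (pi * N%:R * z ^+ 2)).
  have -> : Num.sqrt (2 / (pi * N%:R)) = Num.sqrt 2 * s^-1 :> R.
    by rewrite sqrtrM// sqrtrV// ltW.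
  have -> : Num.sqrt (2 * N%:R) = Num.sqrt 2 * Num.sqrt N%:R :> R by rewrite sqrtrM.
  by field; rewrite gt_eqF.
have -> : `|z| * (Num.sqrt (2 * N%:R) * (expR (- (pi * N%:R * z ^+ 2)) * expR (- (pi * N%:R * z ^+ 2)))) =
    Num.sqrt (2 * N%:R) / s * expR (- (pi * N%:R * z ^+ 2)) * ((s * `|z|) * expR (- (pi * N%:R * z ^+ 2))).
  by field; rewrite gt_eqF.
by rewrite ler_piMr// mulr_ge0 ?expR_ge0// divr_ge0 ?sqrtr_ge0.
Qed.

(** Since |f q - f a| <= c |q - a|, the error is c times a first absolute moment, which
    [normr_mul_gauss] compares with the total mass 1 of the wider Gaussian. *)
Lemma gauss_mean (f : R -> R) (a c : R) : measurable_fun setT f -> (forall q, `|f q| <= 1) ->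
  0 <= c -> (forall q, `|f q - f a| <= c * `|q - a|) ->
  leb.-integrable setT (EFin \o (fun q => normal_pdf a sigma1 q * f q)) /\
  `|\int[leb]_q (normal_pdf a sigma1 q * f q) - f a| <= c * Num.sqrt (2 / (pi * N%:R)).
Proof.
move=> mf f1 c0 lip.
have ipdf s : leb.-integrable setT (EFin \o normal_pdf a s) by exact: integrable_normal_pdf.
have iF : leb.-integrable setT (EFin \o (fun q => normal_pdf a sigma1 q * f q)).
  apply: (le_integrable measurableT _ _ (ipdf sigma1)).
  - by apply/measurable_EFinP; apply: measurable_funM => //; exact: measurable_normal_pdf.
  - move=> q _ /=; rewrite lee_fin normrM ler_piMr//.
split => //.
have icst : leb.-integrable setT (EFin \o (fun q => f a * normal_pdf a sigma1 q)).
  by have := integrableZl measurableT (f a) (ipdf sigma1).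
have -> : f a = \int[leb]_q (f a * normal_pdf a sigma1 q).
  by rewrite RintegralZl// Rintegral_normal_pdf mulr1.
rewrite -RintegralB//.
apply: (le_trans (le_normr_Rintegral _ _)) => //.
  by have := integrableB measurableT iF icst.
have i2 : leb.-integrable setT (EFin \o (fun q => c * Num.sqrt (2 / (pi * N%:R)) * normal_pdf a sigma2 q)).
  by have := integrableZl measurableT (c * Num.sqrt (2 / (pi * N%:R))) (ipdf sigma2).
have -> : c * Num.sqrt (2 / (pi * N%:R)) =
    \int[leb]_q (c * Num.sqrt (2 / (pi * N%:R)) * normal_pdf a sigma2 q).
  by rewrite RintegralZl// Rintegral_normal_pdf mulr1.
apply: le_Rintegral => //.
  have := integrable_norm (integrableB measurableT iF icst).
  by [].
move=> q _ /=.
have -> : normal_pdf a sigma1 q * f q - f a * normal_pdf a sigma1 q =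
  normal_pdf a sigma1 q * (f q - f a) by ring.
rewrite normrM ger0_norm ?normal_pdf_ge0//.
apply: (@le_trans _ _ (c * (`|q - a| * normal_pdf a sigma1 q))).
  by rewrite mulrC mulrA ler_wpM2r ?normal_pdf_ge0.
by rewrite -mulrA ler_wpM2l// normr_mul_gauss.
Qed.

End GaussianMean.

Section Preliminaries.
Variable R : realType.
Local Notation C := R[i].

Lemma cos_lip (u v : R) : `|cos u - cos v| <= `|u - v|.
Proof.
wlog uv : u v / u <= v.
  by move=> h; have [/h//|/ltW/h] := leP u v; rewrite distrC [X in _ <= X]distrC.
have [|c _ h] := @MVT_segment R cos (fun x => - sin x) u v uv.
  by apply: continuous_subspaceT; exact: continuous_cos.
by rewrite distrC h normrM normrN [leRHS]distrC ler_piMl// sin_max.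
Qed.

Lemma sin_lip (u v : R) : `|sin u - sin v| <= `|u - v|.
Proof.
wlog uv : u v / u <= v.
  by move=> h; have [/h//|/ltW/h] := leP u v; rewrite distrC [X in _ <= X]distrC.
have [|c _ h] := @MVT_segment R sin cos u v uv.
  by apply: continuous_subspaceT; exact: continuous_sin.
by rewrite distrC h normrM [leRHS]distrC ler_piMl// cos_max.
Qed.

Lemma cbounded_measurable_fst (G : measurableTypeR R -> C) : cbounded_measurable G ->
  cbounded_measurable (fun y : measurableTypeR R * measurableTypeR R => G y.1).
Proof.
move=> [h1 h2]; split.
- exact: (bounded_measurable_fst (f := fun q => complex.Re (G q))).
- exact: (bounded_measurable_fst (f := fun q => complex.Im (G q))).
Qed.

Lemma cbounded_measurable_snd (G : measurableTypeR R -> C) : cbounded_measurable G ->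
  cbounded_measurable (fun y : measurableTypeR R * measurableTypeR R => G y.2).
Proof.
move=> [h1 h2]; split.
- exact: (bounded_measurable_snd (f := fun q => complex.Re (G q))).
- exact: (bounded_measurable_snd (f := fun q => complex.Im (G q))).
Qed.

Lemma continuous_gauss (b c : R) : continuous (fun q : R => expR (- (b * (c - q) ^+ 2))).
Proof.
move=> q; apply: (@continuous_comp _ _ _ (fun q : R => - (b * (c - q) ^+ 2)) expR); last exact: continuous_expR.
apply: cvgN; apply: cvgM; first exact: cvg_cst.
apply: (@continuous_comp _ _ _ (fun q : R => c - q) (fun z => z ^+ 2)); last exact: sqr_continuous.
by apply: cvgB; [exact: cvg_cst|exact: cvg_id].
Qed.

End Preliminaries.

(** * Fourier coefficients of Husimi measures and matrix elements of translations *)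

Section HusimiTransform.
Variables (R : realType) (N' : nat) (psi : 'cV[R[i]]_N'.+1) (k : 'cV[int]_2).
Local Notation N := N'.+1.
Local Notation C := R[i].
Local Notation leb := (@lebesgue_measure R).
Local Notation k1 := (k 0 0).
Local Notation k2 := (k 1 0).

Let Ngt0 : 0 < (N%:R : R). Proof. by rewrite ltr0n. Qed.
Let pigt0 : 0 < (pi : R). Proof. exact: pi_gt0. Qed.
Let N0 : (N%:R : R) != 0. Proof. by rewrite gt_eqF. Qed.

Definition partial_braket (M : nat) (x : R * R) : C :=
  \sum_(j < N) (psi j 0)^*%C * ((Num.sqrt N%:R)^-1%:C%C * zpartial (coherent_term N' x j) M).

Lemma partial_braket_ccvg x : ccvg (partial_braket ^~ x) (braket psi (coherent_state N x)).
Proof.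
rewrite braket_coherent; apply: ccvg_sum => j _; apply: ccvgM; first exact: ccvg_cst.
apply: ccvgM; first exact: ccvg_cst.
by have [] := coherent_zsum j (lexx `|x.1|).
Qed.

(** With K = [gaussian_cst] e^3 (e^3 is exp (2 + L) at L = 1) and tail bound T = 2 K / (1 - e^(-1)),
    this is 2 (2 K + 2 T): each component of a partial sum is at most K + 2 T, and the outer 2
    passes from components to modulus. *)
Definition coherent_bound : R :=
  4 * (gaussian_cst R N' * expR 3) + 8 * (gaussian_cst R N' * expR 3) / (1 - expR (-1)).

Lemma zpartial_bound x (j : 'I_N) M : `|x.1| <= 1 ->
  Num.sqrt (sqnorm (zpartial (coherent_term N' x j) M)) <= coherent_bound /\
  Num.sqrt (sqnorm (zsum (coherent_term N' x j))) <= coherent_bound.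
Proof.
move=> x1; have [_ h] := coherent_zsum j x1.
have [e0 e1] := andP (@expRN1_lt1 R).
set K := gaussian_cst R N' * expR 3; have K0 : 0 <= K by rewrite mulr_ge0 ?powR_ge0 ?expR_ge0.
set L := 2 * K / (1 - expR (-1)).
have L0 : 0 <= L by apply: divr_ge0; [exact: mulr_ge0|rewrite subr_ge0 ltW].
have hK : 2 + 1 = 3 :> R by ring.
have Lr n : L * expR (-1) ^+ n <= L by rewrite ler_piMr// exprn_ile1// ltW.
have z0 : Num.sqrt (sqnorm (zpartial (coherent_term N' x j) 0)) <= K.
  rewrite /zpartial big_ord1 subrr.
  by have := gaussian_decay 0 x1 (ltn_ord j); rewrite hK absz0 expr0 mulr1.
have sq_le (z : C) (a : R) : `|complex.Re z| <= a -> `|complex.Im z| <= a -> Num.sqrt (sqnorm z) <= 2 * a.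
  move=> r i; have a0 : 0 <= a by apply: le_trans r.
  rewrite -[leRHS]ger0_norm ?mulr_ge0// -sqrtr_sqr ler_wsqrtr// /sqnorm exprMn.
  have : complex.Re z ^+ 2 <= a ^+ 2 by rewrite -real_normK ?num_real// lerXn2r ?nnegrE.
  have : complex.Im z ^+ 2 <= a ^+ 2 by rewrite -real_normK ?num_real// lerXn2r ?nnegrE.
  have := sqr_ge0 a; lra.
have BE : coherent_bound = 2 * (2 * K + 2 * L) by rewrite /coherent_bound /L -/K; ring.
move: h; rewrite hK -/K -/L => h.
have [hr0 hi0] := h 0%N; have [hrM hiM] := h M.
have := Lr 0%N; have := Lr M => LM L1.
have rz0 : `|complex.Re (zpartial (coherent_term N' x j) 0)| <= K by apply: le_trans z0; exact: normr_Re.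
have iz0 : `|complex.Im (zpartial (coherent_term N' x j) 0)| <= K by apply: le_trans z0; exact: normr_Im.
rewrite BE; split; apply: sq_le.
- move: hr0 hrM rz0; rewrite !ler_norml => /andP[? ?] /andP[? ?] /andP[? ?]; apply/andP; split; lra.
- move: hi0 hiM iz0; rewrite !ler_norml => /andP[? ?] /andP[? ?] /andP[? ?]; apply/andP; split; lra.
- move: hr0 hrM rz0; rewrite !ler_norml => /andP[? ?] /andP[? ?] /andP[? ?]; apply/andP; split; lra.
- move: hi0 hiM iz0; rewrite !ler_norml => /andP[? ?] /andP[? ?] /andP[? ?]; apply/andP; split; lra.
Qed.

Definition braket_bound : R :=
  \sum_(j < N) Num.sqrt (sqnorm (psi j 0)) * ((Num.sqrt N%:R)^-1 * coherent_bound).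

Lemma weighted_sum_bound (u : 'I_N -> C) :
  (forall j, Num.sqrt (sqnorm (u j)) <= coherent_bound) ->
  Num.sqrt (sqnorm (\sum_(j < N) (psi j 0)^*%C * ((Num.sqrt N%:R)^-1%:C%C * u j))) <= braket_bound.
Proof.
move=> hu; rewrite (le_trans (sqrt_sqnorm_sum _ _))//; apply: ler_sum => j _.
rewrite !sqnormM sqnormJ sqnorm_real sqrtrM ?sqnorm_ge0// sqrtrM ?sqr_ge0// sqrtr_sqr
  ger0_norm ?invr_ge0 ?sqrtr_ge0//.
by rewrite !ler_wpM2l ?invr_ge0 ?sqrtr_ge0.
Qed.

Lemma partial_braket_bound M x : `|x.1| <= 1 ->
  Num.sqrt (sqnorm (partial_braket M x)) <= braket_bound.
Proof. by move=> x1; apply: weighted_sum_bound => j; have [] := zpartial_bound j M x1. Qed.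

Lemma husimi_density_bound x : husimi_density psi x <= N%:R * braket_bound ^+ 2.
Proof.
have [y -> y1] : exists2 y, husimi_density psi x = husimi_density psi y & `|y.1| <= 1.
  exists (x.1 - (Num.floor x.1)%:~R, x.2) => /=.
    apply: husimi_density_periodic; rewrite /lattice_eqv /= subrr rpred0 andbT.
    by rewrite opprB addrC subrK intr_int.
  have := floor_le x.1; have := floorD1_gt x.1; rewrite rmorphD /= => h1 h2.
  by rewrite ler_norml; apply/andP; split; lra.
rewrite /husimi_density ler_wpM2l// braket_coherent.
have := @weighted_sum_bound (fun j => zsum (coherent_term N' y j)) (fun j => (zpartial_bound j 0 y1).2).
set z := \sum_(j < N) _ => h.
rewrite -[sqnorm z]sqr_sqrtr ?sqnorm_ge0// lerXn2r ?nnegrE ?sqrtr_ge0//.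
by apply: le_trans h; exact: sqrtr_ge0.
Qed.

Lemma bounded_measurable_husimi :
  bounded_measurable (fun x : torus R => husimi_density psi (repr x)).
Proof.
split; first by apply: measurable_periodic; [exact: continuous_husimi_density|exact: husimi_density_periodic].
exists (N%:R * braket_bound ^+ 2) => x; rewrite ger0_norm ?husimi_density_bound//.
by rewrite mulr_ge0 ?sqnorm_ge0.
Qed.

(** The integer J such that J / N is the sample point j / N + m. Indexing by J turns the residue j
    and the translate m into a single lattice sum. *)
Definition site (M : nat) (s : 'I_N * 'I_M.*2.+1) : int := s.1%:Z + N%:Z * (s.2%:Z - M%:Z).

Lemma coherent_term_site (x : R * R) M (s : 'I_N * 'I_M.*2.+1) :
  coherent_term N' x s.1 (s.2%:Z - M%:Z) = gaussian N x ((site s)%:~R / N%:R).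
Proof.
rewrite /coherent_term; congr (gaussian N x _); rewrite /site !intrD !intrM !intrD -!pmulrn.
by move: (N%:R) N0 => n n0; field.
Qed.

Lemma partial_braket_site M x : partial_braket M x =
  \sum_(s : 'I_N * 'I_M.*2.+1) (psi s.1 0)^*%C * ((Num.sqrt N%:R)^-1%:C%C *
    gaussian N x ((site s)%:~R / N%:R)).
Proof.
rewrite -(pair_bigA _ (fun (j : 'I_N) (m : 'I_M.*2.+1) => (psi j 0)^*%C * ((Num.sqrt N%:R)^-1%:C%C *
    gaussian N x ((site (j, m))%:~R / N%:R)))) /=.
apply: eq_bigr => j _; rewrite /zpartial !mulr_sumr; apply: eq_bigr => m _.
by rewrite -(coherent_term_site x (j, m)).
Qed.

(** The product of g_x(J / N), the conjugate of g_x(J' / N) and F_k(x) splits into a function of q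
    times exp (2 i pi (J - J' - k1) p). The integral over p therefore keeps only the pairs with J' =
    J - k1. *)
Definition position_factor (J J' : int) (q : R) : C :=
  (Num.sqrt (2 * N%:R) * (expR (- (pi * N%:R * (J%:~R / N%:R - q) ^+ 2)) *
    expR (- (pi * N%:R * (J'%:~R / N%:R - q) ^+ 2))))%:C%C * expi (2 * pi * k2%:~R * q).

Definition momentum_factor (J J' : int) (p : R) : C := expi (2 * pi * (J - J' - k1)%:~R * p).

Lemma gaussian_product x J J' :
  gaussian N x (J%:~R / N%:R) * (gaussian N x (J'%:~R / N%:R))^*%C * chi k x =
  position_factor J J' x.1 * momentum_factor J J' x.2.
Proof.
rewrite /position_factor -gaussian_cst_sqr !gaussianE !conjcM -!expiN !conjc_real.
rewrite /momentum_factor chi_prod !rmorphM /=.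
set E := (expR _)%:C%C; set E' := (expR _)%:C%C.
have phase : expi (- (pi * N%:R * (x.1 * x.2))) * expi (2 * pi * N%:R * (x.2 * (J%:~R / N%:R))) *
   (expi (- - (pi * N%:R * (x.1 * x.2))) * expi (- (2 * pi * N%:R * (x.2 * (J'%:~R / N%:R))))) *
   expi (2 * pi * (- k1)%:~R * x.2) = expi (2 * pi * (J - J' - k1)%:~R * x.2) :> C.
  rewrite -!expiD; congr expi; rewrite !rmorphB !rmorphN /=.
  by move: (N%:R) N0 => n n0; field.
rewrite -phase; ring.
Qed.

Lemma cbounded_position_factor J J' :
  cbounded_measurable (position_factor J J' : measurableTypeR R -> C).
Proof.
apply: cbounded_measurableM; last exact: cbounded_measurable_expi.
apply: cbounded_measurable_real; apply: bounded_measurableM; first exact: bounded_measurable_cst.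
have bg (J0 : int) : @bounded_measurable _ (measurableTypeR R) R
    (fun q => expR (- (pi * N%:R * (J0%:~R / N%:R - q) ^+ 2))).
  split; first by apply: continuous_measurable_fun; exact: continuous_gauss.
  exists 1 => q; rewrite ger0_norm ?expR_ge0// -[leRHS]expR0 ler_expR oppr_le0.
  by rewrite mulr_ge0 ?sqr_ge0// mulr_ge0// ltW.
exact: bounded_measurableM.
Qed.

Lemma cbounded_momentum_factor J J' :
  cbounded_measurable (momentum_factor J J' : measurableTypeR R -> C).
Proof. exact: cbounded_measurable_expi. Qed.

(* The conjugate factor is truncated further out, so that every site of the
   first factor finds the partner selected by the momentum integral. *)
Definition truncated_density (M : nat) (x : R * R) : C :=
  N%:R%:C%C * (partial_braket M x * (partial_braket (M + `|k1|.+1) x)^*%C) * chi k x.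

Lemma truncated_densityE M x : truncated_density M x =
  \sum_(s : 'I_N * 'I_M.*2.+1) \sum_(s' : 'I_N * 'I_(M + `|k1|.+1).*2.+1)
    (psi s.1 0)^*%C * psi s'.1 0 *
    (position_factor (site s) (site s') x.1 * momentum_factor (site s) (site s') x.2).
Proof.
rewrite /truncated_density !partial_braket_site conjc_sum mulr_suml mulr_sumr mulr_suml.
apply: eq_bigr => s _; rewrite mulr_sumr mulr_sumr mulr_suml; apply: eq_bigr => s' _.
rewrite -gaussian_product; move: (gaussian N x _) (gaussian N x _) => g' g.
rewrite !conjcM conjcK conjc_real.
have -> : N%:R%:C%C = (Num.sqrt N%:R)%:C%C * (Num.sqrt N%:R)%:C%C :> C.
  by rewrite -rmorphM /= -expr2 sqr_sqrtr.
have i : (Num.sqrt N%:R)%:C%C * (Num.sqrt N%:R)^-1%:C%C = 1 :> C.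
  by rewrite -rmorphM /= mulfV// gt_eqF// sqrtr_gt0.
rewrite [LHS](_ : _ = ((Num.sqrt N%:R)%:C%C * (Num.sqrt N%:R)^-1%:C%C) *
  ((Num.sqrt N%:R)%:C%C * (Num.sqrt N%:R)^-1%:C%C) * ((psi s.1 0)^*%C * psi s'.1 0 *
  (g * g'^*%C * chi k x))); last by ring.
by rewrite i !mul1r.
Qed.

Lemma cbounded_truncated_density M : @cbounded_measurable _
  (measurableTypeR R * measurableTypeR R)%type R (truncated_density M).
Proof.
rewrite -[truncated_density M]/(fun x => truncated_density M x).
under eq_fun do rewrite truncated_densityE.
apply: cbounded_measurable_sum => s _; apply: cbounded_measurable_sum => s' _.
apply: cbounded_measurableM; first exact: cbounded_measurable_cst.
apply: cbounded_measurableM.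
- by apply: cbounded_measurable_fst; exact: cbounded_position_factor.
- by apply: cbounded_measurable_snd; exact: cbounded_momentum_factor.
Qed.

(** Euclidean division of J - k1 by N gives the residue and the translate of the partner; its
    quotient leaves [- M, M] by at most |k1| + 1. *)
Lemma site_partner M (s : 'I_N * 'I_M.*2.+1) :
  {s' : 'I_N * 'I_(M + `|k1|.+1).*2.+1 | s'.1 = ord_mod N' (s.1%:Z - k1) &
    forall s'' : 'I_N * 'I_(M + `|k1|.+1).*2.+1, (site s - site s'' - k1 == 0) = (s'' == s')}.
Proof.
pose J : int := site s - k1; pose M' : nat := (M + `|k1|.+1)%N; pose q : int := divz J N%:Z.
have JE : J = q * N%:Z + (ord_mod N' J : nat)%:Z by rewrite ord_modE -divz_eq.
have r1 : (ord_mod N' J < N)%N by exact: ltn_ord.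
have JsE : J = s.1%:Z + N%:Z * (s.2%:Z - M%:Z) - k1 by [].
have s1 : (s.1 < N)%N by exact: ltn_ord.
have s2 : (s.2 < M.*2.+1)%N by exact: ltn_ord.
have kN : (`|k1| <= N * `|k1|)%N by rewrite leq_pmull.
have q1 : - M'%:Z <= q.
  rewrite leNgt; apply/negP => h; have : (q + 1) * N%:Z <= - M'%:Z * N%:Z by rewrite ler_wpM2r//; lia.
  have : - (N%:Z * M%:Z) <= N%:Z * (s.2%:Z - M%:Z) by rewrite -mulrN ler_wpM2l//; lia.
  rewrite /M' => h1 h2; move: JE; rewrite JsE; nia.
have q2 : q <= M'%:Z.
  rewrite leNgt; apply/negP => h; have : M'%:Z * N%:Z <= q * N%:Z by rewrite ler_wpM2r//; lia.
  have : N%:Z * (s.2%:Z - M%:Z) <= N%:Z * M%:Z by rewrite ler_wpM2l//; lia.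
  rewrite /M' => h1 h2; move: JE; rewrite JsE; nia.
have lt : (absz (q + M'%:Z)%R < M'.*2.+1)%N by lia.
exists (ord_mod N' J, Ordinal lt) => /=.
  by rewrite (_ : J = (s.1%:Z - k1) + (s.2%:Z - M%:Z) * N%:Z) ?ord_mod_period// JsE; ring.
move=> s''; apply/idP/eqP => [|->]; last first.
  rewrite addrAC subr_eq0 -/J {1}JE /site /= gez0_abs; last by lia.
  by apply/eqP; rewrite -/M'; ring.
rewrite addrAC subr_eq0 -/J => /eqP Js.
have e1 : s''.1 = ord_mod N' J.
  by rewrite Js /site mulrC ord_mod_period ord_mod_nat.
case: s'' Js e1 => a b; rewrite /site /= => Js e1; congr pair => //.
apply/val_inj => /=; apply/eqP; rewrite -eqz_nat gez0_abs; last by lia.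
have : N%:Z * (q - (b%:Z - M'%:Z)) = 0.
  have : q * N%:Z + (ord_mod N' J : nat)%:Z = (ord_mod N' J : nat)%:Z + N%:Z * (b%:Z - M'%:Z).
    by rewrite -JE {1}Js e1.
  by move=> h; rewrite mulrBr -[X in X - _]mulrC; move: h; lia.
by move/eqP; rewrite mulf_eq0 /= => /eqP h; apply/eqP; lia.
Qed.

Lemma cint_truncated_density M : cint (@square_prob R) (truncated_density M) =
  \sum_(s : 'I_N * 'I_M.*2.+1) (psi s.1 0)^*%C * pext psi (s.1%:Z - k1) *
    cint (unit_prob R) (position_factor (site s) (site s - k1)).
Proof.
rewrite -[truncated_density M]/(fun x => truncated_density M x).
under eq_fun do rewrite truncated_densityE.
have b1 s s' : @cbounded_measurable _ (measurableTypeR R * measurableTypeR R)%type R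
    (fun x => position_factor s s' x.1 * momentum_factor s s' x.2).
  apply: cbounded_measurableM.
  - by apply: cbounded_measurable_fst; exact: cbounded_position_factor.
  - by apply: cbounded_measurable_snd; exact: cbounded_momentum_factor.
have b2 (c : C) s s' : @cbounded_measurable _ (measurableTypeR R * measurableTypeR R)%type R
    (fun x => c * (position_factor s s' x.1 * momentum_factor s s' x.2)).
  by apply: cbounded_measurableM => //; exact: cbounded_measurable_cst.
rewrite (cint_sum (@square_prob_fin R)); last by move=> s _; apply: cbounded_measurable_sum.
apply: eq_bigr => s _; rewrite (cint_sum (@square_prob_fin R))//.
have [s0 s01 s0P] := site_partner s.
under eq_bigr => s' _.
  rewrite (cintZ (@square_prob_fin R))// cint_square_prob; last 2 first.
  - exact: cbounded_position_factor.
  - exact: cbounded_momentum_factor.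
  rewrite /momentum_factor cint_unit_expi s0P; over.
rewrite (bigD1 s0)//= big1 ?addr0 => [|s' /negbTE ->]; last by rewrite mulr0n !mulr0.
rewrite eqxx mulr1 /pext -s01; have /eqP : site s - site s0 - k1 == 0 by rewrite s0P.
by rewrite addrAC => /eqP; rewrite subr_eq0 => /eqP ->.
Qed.

(** The midpoint of j / N and (j - k1) / N. The product of the Gaussians centered at these two
    points is, by completing the square, [overlap_cst] times a Gaussian of variance hbar / 2 at the
    midpoint. *)
Definition pair_mean (j : nat) : R := (j%:R - k1%:~R / 2) / N%:R.

Definition overlap_cst : R := expR (- (pi * k1%:~R ^+ 2 / (2 * N%:R))).

Definition gauss_wave (j : nat) (q : R) : C :=
  (normal_pdf (pair_mean j) (sigma1 R N') q)%:C%C * expi (2 * pi * k2%:~R * q).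

Lemma position_factor_gauss M (s : 'I_N * 'I_M.*2.+1) q :
  position_factor (site s) (site s - k1) q =
  overlap_cst%:C%C * gauss_wave s.1 (q - (s.2%:Z - M%:Z)%:~R).
Proof.
rewrite /position_factor /gauss_wave normal_pdf_sigma1 [RHS]mulrA.
set n : int := s.2%:Z - M%:Z.
have -> : expi (2 * pi * k2%:~R * q) = expi (2 * pi * k2%:~R * (q - n%:~R)) :> C.
  have -> : 2 * pi * k2%:~R * q = 2 * pi * (k2%:~R * (q - n%:~R) + k2%:~R * n%:~R) :> R by ring.
  by rewrite expi_2piD_int ?rpredM ?intr_int//; congr expi; ring.
suff E : expR (- (pi * N%:R * ((site s)%:~R / N%:R - q) ^+ 2)) *
    expR (- (pi * N%:R * ((site s - k1)%:~R / N%:R - q) ^+ 2)) =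
    overlap_cst * expR (- (2 * pi * N%:R * (q - n%:~R - pair_mean s.1) ^+ 2)).
  by rewrite E !rmorphM /=; ring.
rewrite /overlap_cst /pair_mean -!expRD; congr expR.
have -> : (site s - k1)%:~R = s.1%:R + N%:R * n%:~R - k1%:~R :> R.
  by rewrite /site -/n intrB intrD intrM -!pmulrn.
have -> : (site s)%:~R = s.1%:R + N%:R * n%:~R :> R.
  by rewrite /site -/n intrD intrM -!pmulrn.
by move: (N%:R) N0 (pi : R) => m m0 p; field.
Qed.

Let measurable_wave (f : R -> R) : continuous f -> measurable_fun setT f.
Proof. exact: continuous_measurable_fun. Qed.
Let sigma1_neq0 : sigma1 R N' != 0.
Proof. by rewrite gt_eqF// sqrtr_gt0 invr_gt0 !mulr_gt0. Qed.

Let bounded_pdf (a : R) : @bounded_measurable _ (measurableTypeR R) R (normal_pdf a (sigma1 R N')).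
Proof.
split; first exact: measurable_normal_pdf.
exists (normal_peak (sigma1 R N')) => q; rewrite ger0_norm ?normal_pdf_ge0//.
exact: normal_pdf_ub.
Qed.

Lemma cbounded_gauss_wave j (c : R) :
  @cbounded_measurable _ (measurableTypeR R) R (fun q => gauss_wave j (q - c)).
Proof.
have cs : continuous (fun q : R => q - c).
  by move=> q; apply: cvgB; [exact: cvg_id|exact: cvg_cst].
have cc (f : R -> R) : continuous f -> measurable_fun setT (fun q : R => f (q - c)).
  move=> cf; apply: continuous_measurable_fun => q.
  by apply: (@continuous_comp _ _ _ (fun q : R => q - c) f); [exact: cs|exact: cf].
apply: cbounded_measurableM.
  apply: cbounded_measurable_real; split; first by apply: cc; exact: continuous_normal_pdf.
  by exists (normal_peak (sigma1 R N')) => q; rewrite ger0_norm ?normal_pdf_ge0// normal_pdf_ub.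
split; split => /=.
- by apply: (cc (fun q => cos (2 * pi * k2%:~R * q))); exact: continuous_cos_mul.
- by exists 1 => q; exact: cos_max.
- by apply: (cc (fun q => sin (2 * pi * k2%:~R * q))); exact: continuous_sin_mul.
- by exists 1 => q; exact: sin_max.
Qed.

Definition wave_lip : R := 2 * pi * `|k2%:~R|.

Let mean_of (f : R -> R) j : continuous f -> (forall q, `|f q| <= 1) ->
  (forall q q', `|f q - f q'| <= `|q - q'|) ->
  let g := fun q => normal_pdf (pair_mean j) (sigma1 R N') q * f (2 * pi * k2%:~R * q) in
  (\sum_(m < M.*2.+1) \int[unit_prob R]_q g (q - (m%:Z - M%:Z)%:~R) @[M --> \oo] -->
    \int[leb]_q g q) /\
  `|\int[leb]_q g q - f (2 * pi * k2%:~R * pair_mean j)| <= wave_lip * Num.sqrt (2 / (pi * N%:R)).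
Proof.
move=> cf f1 lip g.
have cfc : continuous (fun q : R => f (2 * pi * k2%:~R * q)).
  move=> q; apply: (@continuous_comp _ _ _ (fun q : R => 2 * pi * k2%:~R * q) f); last exact: cf.
  by apply: cvgM; [exact: cvg_cst|exact: cvg_id].
have [||||ig hg] := @gauss_mean R N' (fun q => f (2 * pi * k2%:~R * q)) (pair_mean j) wave_lip.
- exact: measurable_wave.
- by move=> q; exact: f1.
- by rewrite /wave_lip mulr_ge0// mulr_ge0// ltW.
- move=> q; rewrite (le_trans (lip _ _))// -mulrBr /wave_lip !normrM (ger0_norm (ler0n R 2)) (ger0_norm (ltW pigt0)).
  exact: lexx.
split => //; apply: sum_unit_prob_cvg => //.
- apply: bounded_measurableM; first exact: bounded_pdf.
  by split; [exact: measurable_wave|exists 1].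
- by move=> q; apply: cvgM; [exact: continuous_normal_pdf|exact: cfc].
Qed.

(** The Fourier transform of the midpoint Gaussian at frequency k2, left as an integral over the
    line: [gauss_mean] estimates it with error of order N^(-1/2). *)
Definition wave_mean (j : nat) : C := Complex
  (\int[leb]_q (normal_pdf (pair_mean j) (sigma1 R N') q * cos (2 * pi * k2%:~R * q)))
  (\int[leb]_q (normal_pdf (pair_mean j) (sigma1 R N') q * sin (2 * pi * k2%:~R * q))).

Lemma gauss_wave_cvg j :
  ccvg (fun M => \sum_(m < M.*2.+1)
    cint (unit_prob R) (fun q => gauss_wave j (q - (m%:Z - M%:Z)%:~R))) (wave_mean j).
Proof.
have [hc _] := @mean_of cos j (@continuous_cos R) (@cos_max R) (@cos_lip R).
have [hs _] := @mean_of sin j (@continuous_sin R) (@sin_max R) (@sin_lip R).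
split.
- apply: cvg_trans hc; apply: near_eq_cvg; apply: nearW => M; rewrite raddf_sum /=.
  by apply: eq_bigr => m _; congr (Rintegral _ _ _); apply/funext => q; rewrite mul0r subr0.
- apply: cvg_trans hs; apply: near_eq_cvg; apply: nearW => M; rewrite raddf_sum /=.
  by apply: eq_bigr => m _; congr (Rintegral _ _ _); apply/funext => q; rewrite mul0r addr0.
Qed.

Lemma wave_mean_near j :
  Num.sqrt (sqnorm (wave_mean j - expi (2 * pi * k2%:~R * pair_mean j))) <=
  2 * (wave_lip * Num.sqrt (2 / (pi * N%:R))).
Proof.
have [_ hc] := @mean_of cos j (@continuous_cos R) (@cos_max R) (@cos_lip R).
have [_ hs] := @mean_of sin j (@continuous_sin R) (@sin_max R) (@sin_lip R).
have -> : wave_mean j - expi (2 * pi * k2%:~R * pair_mean j) =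
  (complex.Re (wave_mean j) - cos (2 * pi * k2%:~R * pair_mean j))%:C%C +
  'i%C * (complex.Im (wave_mean j) - sin (2 * pi * k2%:~R * pair_mean j))%:C%C.
  by apply: complex_ext; rewrite /=; ring.
rewrite (le_trans (sqrt_sqnormD _ _))// sqnormM !sqnorm_real.
have -> : sqnorm ('i%C : C) = 1 by rewrite /sqnorm /= expr0n expr1n add0r.
move: hc hs; rewrite /wave_mean /= mul1r !sqrtr_sqr => hc hs.
by apply: le_trans (lerD hc hs) _; rewrite [leRHS]mulr_natl mulr2n lexx.
Qed.

Definition husimi_transform : C :=
  cint (@torus_lebesgue R) (fun x => (husimi_density psi (repr x))%:C%C * chi k (repr x)).

(** Bounded convergence on the strip where x.1 is in [0, 1], of full measure. The two truncation
    ranges differ, but both partial brackets tend to the same bracket. *)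
Lemma truncated_density_cvg :
  ccvg (fun M => cint (@square_prob R) (truncated_density M)) husimi_transform.
Proof.
pose D : set (measurableTypeR R * measurableTypeR R) := `[0, 1]%classic `*` setT.
have mI : measurable (`[0, 1]%classic : set (measurableTypeR R)) by exact: measurable_itv.
have mD : measurable D by apply: measurableX.
have D0 : square_prob (~` D) = 0%E.
  have -> : ~` D = (~` `[0, 1]%classic) `*` setT.
    apply/seteqP; split => y; first by move=> h; split => // h1; apply: h; split.
    by move=> [h _] [h1 _].
  rewrite /square_prob product_measure1E//; last exact: measurableC.
  have I0 : unit_prob R (~` `[0, 1]%classic) = 0%E.
    rewrite unit_probE; last exact: measurableC.
    rewrite (_ : _ `&` _ = set0) ?measure0//.
    apply/seteqP; split => q //= [h]; rewrite !in_itv /= in h * => /andP[q0 q1].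
    by apply: h; rewrite q0 ltW.
  transitivity (unit_prob R (~` `[0%R, 1%R]%classic) * unit_prob R setT)%E; first by [].
  by rewrite I0 mul0e.
have Dx1 x : D x -> `|x.1| <= 1.
  by move=> [/=]; rewrite in_itv /= => /andP[x0 x1] _; rewrite ger0_norm.
have pt x : ccvg (truncated_density ^~ x) ((husimi_density psi x)%:C%C * chi k x).
  have -> : (husimi_density psi x)%:C%C = N%:R%:C%C * (braket psi (coherent_state N x) *
      (braket psi (coherent_state N x))^*%C).
    by rewrite [_ * _^*%C]mulrC Re_conj_ge0 -rmorphM.
  apply: ccvgM; last exact: ccvg_cst.
  apply: ccvgM; first exact: ccvg_cst.
  apply: ccvgM; first exact: partial_braket_ccvg.
  apply: ccvgJ; apply: (@ccvg_comp R (partial_braket ^~ x) _ (fun M => (M + `|k1|.+1)%N)).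
    exact: cvg_addnr.
  exact: partial_braket_ccvg.
pose B := N%:R * (braket_bound * braket_bound).
have bd M x : D x -> Num.sqrt (sqnorm (truncated_density M x)) <= B.
  move=> /Dx1 x1; rewrite /truncated_density !sqnormM sqnorm_expi mulr1 sqnormJ sqnorm_real.
  rewrite sqrtrM ?sqr_ge0// sqrtr_sqr ger0_norm// /B ler_wpM2l// sqrtrM ?sqnorm_ge0//.
  by apply: ler_pM; rewrite ?sqrtr_ge0// partial_braket_bound.
have -> : husimi_transform = cint (@square_prob R) (fun x => (husimi_density psi x)%:C%C * chi k x).
  apply: (@cint_torus R (fun x => (husimi_density psi x)%:C%C * chi k x)).
    by move=> y z yz; rewrite (husimi_density_periodic _ yz) (chi_periodic k yz).
  apply: cbounded_measurableM; last exact: cbounded_measurable_chi.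
  by apply: cbounded_measurable_real; exact: bounded_measurable_husimi.
split => /=.
- apply: (bounded_convergence_ae (@square_prob_fin R) mD D0 (M := B)).
  + by move=> M; have [[]] := cbounded_truncated_density M.
  + by move=> M x Dx; rewrite (le_trans (normr_Re _))// bd.
  + by move=> x; have [] := pt x.
- apply: (bounded_convergence_ae (@square_prob_fin R) mD D0 (M := B)).
  + by move=> M; have [_ []] := cbounded_truncated_density M.
  + by move=> M x Dx; rewrite (le_trans (normr_Im _))// bd.
  + by move=> x; have [] := pt x.
Qed.

(** Both sides are limits of the integrals of [truncated_density]: on the one hand by bounded
    convergence, on the other by integrating out the momentum and unfolding the position
    integral. *)
Lemma husimi_transformE : husimi_transform =
  \sum_(j < N) (psi j 0)^*%C * pext psi (j%:Z - k1) * (overlap_cst%:C%C * wave_mean j).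
Proof.
have h : ccvg (fun M => cint (@square_prob R) (truncated_density M))
    (\sum_(j < N) (psi j 0)^*%C * pext psi (j%:Z - k1) * (overlap_cst%:C%C * wave_mean j)).
  have -> : (fun M => cint (@square_prob R) (truncated_density M)) = (fun M =>
      \sum_(j < N) (psi j 0)^*%C * pext psi (j%:Z - k1) * (overlap_cst%:C%C *
      \sum_(m < M.*2.+1) cint (unit_prob R) (fun q => gauss_wave j (q - (m%:Z - M%:Z)%:~R)))).
    apply/funext => M; rewrite cint_truncated_density.
    rewrite -(pair_bigA _ (fun (j : 'I_N) (m : 'I_M.*2.+1) => (psi j 0)^*%C * pext psi (j%:Z - k1) *
      cint (unit_prob R) (position_factor (site (j, m)) (site (j, m) - k1)))) /=.
    apply: eq_bigr => j _; rewrite !mulr_sumr; apply: eq_bigr => m _; congr (_ * _).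
    rewrite -(cintZ (@unit_prob_fin R)); last exact: cbounded_gauss_wave.
    by congr (cint _ _); apply/funext => q; rewrite (@position_factor_gauss M (j, m)).
  apply: ccvg_sum => j _; apply: ccvgM; first exact: ccvg_cst.
  by apply: ccvgM; [exact: ccvg_cst|exact: gauss_wave_cvg].
have [r1 i1] := h; have [r2 i2] := truncated_density_cvg.
apply: complex_ext.
- exact: (cvg_unique (@Rhausdorff R) r2 r1).
- exact: (cvg_unique (@Rhausdorff R) i2 i1).
Qed.

(** The first term bounds 1 - [overlap_cst]; the second is the Gaussian averaging error, counted
    once for the real and once for the imaginary part. *)
Definition husimi_error : R := pi * k1%:~R ^+ 2 / (2 * N%:R) +
  2 * (wave_lip * Num.sqrt (2 / (pi * N%:R))).

Lemma overlap_wave_near j :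
  Num.sqrt (sqnorm (overlap_cst%:C%C * wave_mean j - expi (2 * pi * k2%:~R * pair_mean j))) <=
  husimi_error.
Proof.
pose a : R := pi * k1%:~R ^+ 2 / (2 * N%:R).
have a0 : 0 <= a.
  by apply: divr_ge0; [apply: mulr_ge0; [exact: pi_ge0|exact: sqr_ge0]|exact: mulr_ge0].
have o0 : 0 <= overlap_cst by exact: expR_ge0.
have o1 : overlap_cst <= 1 by rewrite -expR0 ler_expR oppr_le0.
have oa : 1 - overlap_cst <= a by have := expR_ge1Dx (- a); rewrite /overlap_cst -/a; lra.
have -> : overlap_cst%:C%C * wave_mean j - expi (2 * pi * k2%:~R * pair_mean j) =
  (overlap_cst - 1)%:C%C * expi (2 * pi * k2%:~R * pair_mean j) +
  overlap_cst%:C%C * (wave_mean j - expi (2 * pi * k2%:~R * pair_mean j)).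
  by rewrite rmorphB /=; ring.
rewrite (le_trans (sqrt_sqnormD _ _))// !sqnormM !sqnorm_real sqnorm_expi mulr1.
rewrite sqrtr_sqr sqrtrM ?sqr_ge0// sqrtr_sqr (ger0_norm o0) distrC.
rewrite (@ger0_norm _ (1 - overlap_cst)) ?subr_ge0// /husimi_error -/a lerD//.
apply: le_trans (wave_mean_near j); rewrite ler_piMl// sqrtr_ge0.
Qed.

(** At the midpoint the wave has exactly the phase exp (- i pi k1 k2 / N) exp (2 i pi k2 j / N) of
    the translation, so only [husimi_error] remains in each term. The weights |psi_j| |psi_(j - k1)|
    sum to at most 1 by the arithmetic-geometric inequality. *)
Lemma husimi_transform_near : braket psi psi = 1 ->
  Num.sqrt (sqnorm (husimi_transform - braket psi (translation R N k *m psi))) <= husimi_error.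
Proof.
move=> psi1.
have -> : husimi_transform - braket psi (translation R N k *m psi) =
  \sum_(j < N) (psi j 0)^*%C * pext psi (j%:Z - k1) *
    (overlap_cst%:C%C * wave_mean j - expi (2 * pi * k2%:~R * pair_mean j)).
  rewrite husimi_transformE braket_pext -sumrB; apply: eq_bigr => j _.
  rewrite pext_translation -expiD /pext ord_mod_nat.
  have -> : - (pi * (k1 * k2)%:~R / N%:R) + 2 * pi * k2%:~R * j%:Z%:~R / N%:R =
      2 * pi * k2%:~R * pair_mean j :> R.
    by rewrite /pair_mean intrM -pmulrn; move: (N%:R) N0 (pi : R) => m m0 p; field.
  by ring.
rewrite (le_trans (sqrt_sqnorm_sum _ _))//.
have e0 : 0 <= husimi_error by apply: le_trans (overlap_wave_near 0); exact: sqrtr_ge0.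
have sum1 : \sum_(j < N) sqnorm (psi j 0) = 1.
  have : (sqnorm_vec psi)%:C%C = 1 by rewrite -braket_self.
  by case.
have sum2 : \sum_(j < N) sqnorm (pext psi (j%:Z - k1)) = 1.
  have := congr1 (@complex.Re R) (sum_ord_mod (fun j : 'I_N => (sqnorm (psi j 0))%:C%C) (- k1)).
  by rewrite !raddf_sum /= sum1.
apply: (@le_trans _ _ (\sum_(j < N) (2^-1 * (sqnorm (psi j 0) + sqnorm (pext psi (j%:Z - k1)))) * husimi_error)).
  apply: ler_sum => j _; rewrite sqnormM sqrtrM ?sqnorm_ge0//.
  apply: ler_pM; rewrite ?sqrtr_ge0 ?overlap_wave_near//.
  rewrite sqnormM sqnormJ sqrtrM ?sqnorm_ge0//.
  have := sqr_ge0 (Num.sqrt (sqnorm (psi j 0)) - Num.sqrt (sqnorm (pext psi (j%:Z - k1)))).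
  rewrite sqrrB !sqr_sqrtr ?sqnorm_ge0//; lra.
by rewrite -mulr_suml -mulr_sumr big_split /= sum1 sum2; lra.
Qed.

Lemma husimi_Re_Im : husimi_transform =
  Complex (husimi psi (fun x => complex.Re (chi k (repr x))))
          (husimi psi (fun x => complex.Im (chi k (repr x)))).
Proof.
apply: complex_ext => /=; rewrite /husimi; congr (Rintegral _ _ _); apply/funext => x.
- by rewrite mul0r subr0.
- by rewrite mul0r addr0.
Qed.

End HusimiTransform.

Lemma husimi_error_cvg (R : realType) (k : 'cV[int]_2) (f : nat -> nat) :
  f n @[n --> \oo] --> \oo ->
  husimi_error R (f n) k @[n --> \oo] --> (0 : R).
Proof.
move=> foo.
have inv0 : (f n).+1%:R^-1 @[n --> \oo] --> (0 : R) by exact: (cvg_comp _ _ foo (@cvg_harmonic R)).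
have -> : (fun n => husimi_error R (f n) k) = (fun n =>
    (pi * (k 0 0)%:~R ^+ 2 / 2) * (f n).+1%:R^-1 +
    (2 * wave_lip R k) * Num.sqrt ((2 / pi) * (f n).+1%:R^-1)).
  by apply/funext => n; rewrite /husimi_error !invfM; congr (_ + _); [ring|rewrite -!mulrA].
rewrite -[X in _ --> X](addr0 0); apply: cvgD.
  by rewrite -[X in _ --> X](mulr0 (pi * (k 0 0)%:~R ^+ 2 / 2)); apply: cvgM => //; exact: cvg_cst.
rewrite -[X in _ --> X](mulr0 (2 * wave_lip R k)); apply: cvgM; first exact: cvg_cst.
rewrite -[X in _ --> X]sqrtr0.
apply: (@cvg_comp _ _ _ (fun n => (2 / pi) * (f n).+1%:R^-1) Num.sqrt _ (nbhs (0 : R))); last exact: sqrt_continuous.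
have : (2 / pi) * (f n).+1%:R^-1 @[n --> \oo] --> (2 / pi) * (0 : R).
  by apply: cvgM => //; exact: cvg_cst.
by rewrite mulr0.
Qed.

(** * Characters as smooth test functions *)

Section SmoothCharacters.
Variable R : realType.
Local Notation C := R[i].
Implicit Types (k : 'cV[int]_2) (x y v : R * R).

Lemma derive_line (F : R * R -> R) x v (G : R -> R) (d : R) :
  (forall h : R, F (h *: v + x) = G h) -> is_derive (0 : R) 1 G d ->
  derivable F x v /\ 'D_v F x = d.
Proof.
move=> FG [dG dGE].
have E : (fun h : R => h^-1 *: ((F \o shift x) (h *: v) - F x)) =
    (fun h : R => h^-1 *: ((G \o shift (0 : R)) (h *: (1 : R)) - G 0)).
  apply/funext => h; rewrite /= FG addr0 scaler1.
  by have := FG 0; rewrite scale0r add0r => ->.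
by split; [rewrite /derivable E; exact: dG|rewrite /derive E; exact: dGE].
Qed.

(** A family closed under partial derivatives, each of which rescales c and advances t by pi / 2; so
    all orders of smoothness follow by one induction. *)
Definition plane_wave (a b c t : R) (y : R * R) : R := c * cos (a * y.1 + b * y.2 + t).

Lemma continuous_plane_wave a b c t : continuous (plane_wave a b c t).
Proof.
move=> y; apply: cvgM; first exact: cvg_cst.
apply: (@continuous_comp _ _ _ (fun y : R * R => a * y.1 + b * y.2 + t) cos); last exact: continuous_cos.
apply: cvgD; last exact: cvg_cst.
by apply: cvgD; apply: cvgM; do ?[exact: cvg_cst|exact: cvg_fst|exact: cvg_snd].
Qed.

Lemma is_derive_wave (s c t : R) : is_derive (0 : R) 1 (fun h : R => c * cos (s * h + t)) (c * s * cos (t + pi / 2)).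
Proof.
apply: is_derive_eq; rewrite ?scaler1 ?scaler0 ?add0r ?addr0 cosDpihalf mulr0 add0r.
transitivity (c * (- sin t * s)); first by [].
by ring.
Qed.

Lemma derive_plane_wave a b c t y :
  (derivable (plane_wave a b c t) y (1, 0) /\
   'D_((1 : R), (0 : R)) (plane_wave a b c t) y = plane_wave a b (c * a) (t + pi / 2) y) /\
  (derivable (plane_wave a b c t) y (0, 1) /\
   'D_((0 : R), (1 : R)) (plane_wave a b c t) y = plane_wave a b (c * b) (t + pi / 2) y).
Proof.
split.
- rewrite [plane_wave _ _ (c * a) _ _](_ : _ = c * a * cos ((a * y.1 + b * y.2 + t) + pi / 2)); last first.
    by rewrite /plane_wave addrA.
  apply: derive_line (is_derive_wave a c _) => h.
  rewrite /plane_wave /=; congr (_ * cos _).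
  transitivity (a * (h * 1 + y.1) + b * (h * 0 + y.2) + t); first by [].
  by ring.
- rewrite [plane_wave _ _ (c * b) _ _](_ : _ = c * b * cos ((a * y.1 + b * y.2 + t) + pi / 2)); last first.
    by rewrite /plane_wave addrA.
  apply: derive_line (is_derive_wave b c _) => h.
  rewrite /plane_wave /=; congr (_ * cos _).
  transitivity (a * (h * 0 + y.1) + b * (h * 1 + y.2) + t); first by [].
  by ring.
Qed.

Lemma C_k_plane_wave n a b c t : C_k n (plane_wave a b c t).
Proof.
elim: n c t => [|n IH] c t /=; first exact: continuous_plane_wave.
split.
- exact: continuous_plane_wave.
- move=> y; have [[d1 _] [d2 _]] := derive_plane_wave a b c t y.
  by split; [exact: d1|exact: d2].
- have -> : (fun x => 'D_((1 : R), (0 : R)) (plane_wave a b c t) x) = plane_wave a b (c * a) (t + pi / 2).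
    by apply/funext => y; have [[_ ->] _] := derive_plane_wave a b c t y.
  exact: IH.
- have -> : (fun x => 'D_((0 : R), (1 : R)) (plane_wave a b c t) x) = plane_wave a b (c * b) (t + pi / 2).
    by apply/funext => y; have [_ [_ ->]] := derive_plane_wave a b c t y.
  exact: IH.
Qed.

Lemma torus_smooth_chi k :
  torus_smooth (fun x : torus R => complex.Re (chi k (repr x))) /\
  torus_smooth (fun x : torus R => complex.Im (chi k (repr x))).
Proof.
split=> n.
- rewrite (_ : _ \o _ = plane_wave (2 * pi * (k 1 0)%:~R) (- (2 * pi * (k 0 0)%:~R)) 1 0).
    exact: C_k_plane_wave.
  apply/funext => y; rewrite -[LHS]/(complex.Re (chi k (repr (torus_proj y)))).
  rewrite (doubly_periodic_repr y (@chi_periodic R k)).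
  by rewrite /plane_wave /chi /= mul1r; congr cos; ring.
- rewrite (_ : _ \o _ = plane_wave (2 * pi * (k 1 0)%:~R) (- (2 * pi * (k 0 0)%:~R)) 1 (- (pi / 2))).
    exact: C_k_plane_wave.
  apply/funext => y; rewrite -[LHS]/(complex.Im (chi k (repr (torus_proj y)))).
  rewrite (doubly_periodic_repr y (@chi_periodic R k)).
  by rewrite /plane_wave /chi /= mul1r cosBpihalf; congr sin; ring.
Qed.

End SmoothCharacters.

(** * From Husimi convergence to convergence of matrix elements *)

Section SemiclassicalSequences.
Variable R : realType.
Local Notation C := R[i].

Lemma semiclassical_ccvg (A : 'M[int]_2) (mu : probability (torus R) R) :
  semiclassical_measure A mu ->
  exists (N : nat -> nat) (psi : forall n, 'cV[C]_(N n).+1),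
    [/\ N n @[n --> \oo] --> \oo, forall n, normalized_eigenstate A (psi n) &
      forall k, ccvg (fun n => braket (psi n) (translation R (N n).+1 k *m psi n))
        (cint mu (fun x => chi k (repr x)))].
Proof.
move=> [N [psi [Ngt0 Noo Apsi lim]]].
(* The dimension [N n] is positive but not syntactically a successor, and the type of [psi n]
   depends on it. Packing dimension and state together makes the equality of pairs rewritable. *)
pose Z := {N : nat & 'cV[C]_N}.
pose z n : Z := existT _ (N n) (psi n).
have ex n : exists s : {N : nat & 'cV[C]_N.+1}, existT (fun N => 'cV[C]_N) (projT1 s).+1 (projT2 s) = z n.
  rewrite /z; move: (Ngt0 n) (psi n); case: (N n) => // N' _ phi.
  by exists (existT (fun N => 'cV[C]_N.+1) N' phi).
have [s sE] := choice ex.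
exists (fun n => projT1 (s n)), (fun n => projT2 (s n)).
have Ns n : N n = (projT1 (s n)).+1 by rewrite -[LHS]/(projT1 (z n)) -sE.
have Noo' : projT1 (s n) @[n --> \oo] --> \oo.
  move=> X [m _ mX]; have [m' _ h] := Noo [set i | (m < i)%N] (ex_intro2 _ _ m.+1 I (fun i hi => hi)).
  by exists m' => // n /h /=; rewrite Ns ltnS => /mX.
have Apsi' n : normalized_eigenstate A (projT2 (s n)).
  have := Apsi n; rewrite -[normalized_eigenstate A (psi n)]/(normalized_eigenstate A (projT2 (z n))).
  by rewrite -sE.
split => // k; have [s1 s2] := torus_smooth_chi R k.
have husE f n : husimi (psi n) f = husimi (projT2 (s n)) f.
  by rewrite -[LHS]/(husimi (projT2 (z n)) f) -sE.
have h1 : ccvg (fun n => husimi_transform (projT2 (s n)) k) (cint mu (fun x => chi k (repr x))).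
  split.
  - have := lim _ s1; apply: cvg_trans; apply: near_eq_cvg; apply: nearW => n.
    by rewrite husimi_Re_Im husE.
  - have := lim _ s2; apply: cvg_trans; apply: near_eq_cvg; apply: nearW => n.
    by rewrite husimi_Re_Im husE.
apply: ccvg_sub0 h1 _.
have e0 := @husimi_error_cvg R k _ Noo'.
apply: (@squeeze_cvgr _ _ _ _ (fun=> 0) (fun n => husimi_error R (projT1 (s n)) k ^+ 2)).
- apply: nearW => n; rewrite sqnorm_ge0 /=.
  have [psi1 _] := Apsi' n; have := husimi_transform_near k psi1 => h.
  rewrite -[leLHS]sqr_sqrtr ?sqnorm_ge0// lerXn2r ?nnegrE ?sqrtr_ge0//.
  by apply: le_trans h; exact: sqrtr_ge0.
- exact: cvg_cst.
- by rewrite -[X in _ --> X](expr0n _ 2); under eq_fun do rewrite expr2; rewrite expr2; exact: cvgM.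
Qed.

End SemiclassicalSequences.

(** * The variational inequality *)

Lemma cvgr_sum (R : realType) (I : Type) (r : seq I) (P : pred I) (u : I -> nat -> R) (l : I -> R) :
  (forall i, P i -> u i n @[n --> \oo] --> l i) ->
  \sum_(i <- r | P i) u i n @[n --> \oo] --> \sum_(i <- r | P i) l i.
Proof.
move=> ul; elim: r => [|i s IH].
  by under eq_fun do rewrite big_nil; rewrite big_nil; exact: cvg_cst.
under eq_fun do rewrite big_cons; rewrite big_cons; case: ifPn => // Pi.
by apply: cvgD => //; exact: ul.
Qed.

Lemma Rintegral_sqnorm_trig (R : realType) (m : {measure set (torus R) -> \bar R})
    (I : finType) (c : I -> R[i]) (l : I -> 'cV[int]_2) : (m setT < +oo)%E ->
  (\int[m]_x sqnorm (\sum_i c i * chi (l i) (repr x)))%:C%C =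
  \sum_i \sum_j (c i)^*%C * c j * cint m (fun x => chi (l j - l i) (repr x)).
Proof.
move=> mfin; rewrite -cint_real.
rewrite (pair_bigA _ (fun i j => (c i)^*%C * c j * cint m (fun x => chi (l j - l i) (repr x)))) /=.
rewrite -(@cint_trig _ _ _ (fun s : I * I => (c s.1)^*%C * c s.2) (fun s => l s.2 - l s.1))//.
congr cint; apply/funext => x; rewrite -Re_conj_ge0.
rewrite -(pair_bigA _ (fun i j => ((c i)^*%C * c j) * chi (l j - l i) (repr x))) /=.
rewrite conjc_sum mulr_suml; apply: eq_bigr => i _; rewrite mulr_sumr; apply: eq_bigr => j _.
by rewrite chiD chiN conjcM; ring.
Qed.

(** * Symbol calculus on a sequence of states and the positivity argument *)

Section Asymptotics.
Variables (R : realType) (mu : probability (torus R) R).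
Local Notation C := R[i].
Variables (N : nat -> nat) (psi : forall n, 'cV[C]_(N n).+1).
Hypothesis Noo : N n @[n --> \oo] --> \oo.
Hypothesis psi1 : forall n, braket (psi n) (psi n) = 1.
Hypothesis mom : forall k, ccvg (fun n => braket (psi n) (translation R (N n).+1 k *m psi n))
        (cint mu (fun x => chi k (repr x))).
Local Notation T n k := (translation R (N n).+1 k).
Implicit Types (k l : 'cV[int]_2) (I J : finType) (v : R * R).

Let mufin : (mu setT < +oo)%E. Proof. by rewrite probability_setT ltry. Qed.

Lemma invN_cvg0 : (N n).+1%:R^-1 @[n --> \oo] --> (0 : R).
Proof. exact: (cvg_comp _ _ Noo (@cvg_harmonic R)). Qed.

Lemma phase_cvg1 (m : int) : ccvg (fun n => expi (pi * m%:~R / (N n).+1%:R)) (1 : C).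
Proof.
rewrite -(expi0 R); apply: ccvg_expi; rewrite -[X in _ --> X](mulr0 (pi * m%:~R)).
by apply: cvgM; [exact: cvg_cst|exact: invN_cvg0].
Qed.

Lemma braket_TT n k l (phi xi : 'cV[C]_(N n).+1) :
  braket (T n k *m phi) (T n l *m xi) =
  expi (pi * (k 0 0 * l 1 0 - l 0 0 * k 1 0)%:~R / (N n).+1%:R) *
  braket phi (T n (l - k) *m xi).
Proof.
rewrite -{1}(opprK k) -braket_translationr translationD braketZr [- k + l]addrC.
have -> : l 0 0 * (- k) 1 0 - (- k) 0 0 * l 1 0 = k 0 0 * l 1 0 - l 0 0 * k 1 0.
  by rewrite !mxE; ring.
by [].
Qed.

(** The vector Op(a) psi for the trigonometric polynomial a with coefficients c and frequencies
    l. *)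
Definition opvec n I (c : I -> C) (l : I -> 'cV[int]_2) : 'cV[C]_(N n).+1 :=
  \sum_i c i *: (T n (l i) *m psi n).

(** The scalar product of two translates of psi is a matrix element of a single translation, up to a
    phase tending to 1. Coefficients may vary with n, to carry the phases that [translated_overlap]
    produces. *)
Lemma opvec_sqnorm_cvg I (b : nat -> I -> C) (c : I -> C) (l : I -> 'cV[int]_2) :
  (forall i, ccvg (b ^~ i) (c i)) ->
  sqnorm_vec (opvec n (b n) l) @[n --> \oo] -->
    \int[mu]_x sqnorm (\sum_i c i * chi (l i) (repr x)).
Proof.
move=> bc.
have h1 : ccvg (fun n => (sqnorm_vec (opvec n (b n) l))%:C%C)
    (\sum_i \sum_j (c i)^*%C * (c j * (1 * cint mu (fun x => chi (l j - l i) (repr x))))).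
  have -> : (fun n => (sqnorm_vec (opvec n (b n) l))%:C%C) = (fun n => \sum_i \sum_j
      (b n i)^*%C * (b n j * (expi (pi * (l i 0 0 * l j 1 0 - l j 0 0 * l i 1 0)%:~R / (N n).+1%:R) *
      braket (psi n) (T n (l j - l i) *m psi n)))).
    apply/funext => n; rewrite -braket_self /opvec braket_suml; apply: eq_bigr => i _.
    rewrite braketZl braket_sumr mulr_sumr; apply: eq_bigr => j _.
    by rewrite braketZr braket_TT.
  apply: ccvg_sum => i _; apply: ccvg_sum => j _; apply: ccvgM; first exact: ccvgJ.
  by apply: ccvgM => //; apply: ccvgM => //; exact: phase_cvg1.
have [h2 _] := h1; suff e : \sum_i \sum_j (c i)^*%C * (c j * (1 * cint mu (fun x => chi (l j - l i) (repr x)))) =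
    (\int[mu]_x sqnorm (\sum_i c i * chi (l i) (repr x)))%:C%C by rewrite e in h2.
rewrite Rintegral_sqnorm_trig//; apply: eq_bigr => i _; apply: eq_bigr => j _.
by rewrite mul1r mulrA.
Qed.

Lemma translation_commute n k l (phi : 'cV[C]_(N n).+1) :
  T n k *m (T n l *m phi) =
  expi (2 * pi * (l 0 0 * k 1 0 - k 0 0 * l 1 0)%:~R / (N n).+1%:R) *: (T n l *m (T n k *m phi)).
Proof.
rewrite !translationD scalerA -expiD [l + k]addrC; congr (expi _ *: _).
by rewrite !rmorphB /=; ring.
Qed.

(* Moving [T_V] to the left past [Op(f)] translates the symbol by [v = lim V/N]. *)
Lemma translated_overlap (V : nat -> 'cV[int]_2) v I J (c : I -> C) (l : I -> 'cV[int]_2)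
    (d : J -> C) (m : J -> 'cV[int]_2) :
  ((V n 0 0)%:~R / (N n).+1%:R : R) @[n --> \oo] --> v.1 ->
  ((V n 1 0)%:~R / (N n).+1%:R : R) @[n --> \oo] --> v.2 ->
  exists2 e : nat -> R,
    (forall n, sqnorm (braket (opvec n c l) (T n (V n) *m opvec n d m)) <= e n) &
    e n @[n --> \oo] --> \int[mu]_x
      (sqnorm (\sum_i c i * chi (l i) ((repr x).1 + v.1, (repr x).2 + v.2)) *
       sqnorm (\sum_j d j * chi (m j) (repr x))).
Proof.
move=> V1 V2.
pose b n (s : I * J) : C := (c s.1)^*%C * d s.2 *
  (expi (2 * pi * ((V n) 0 0 * - l s.1 1 0 - - l s.1 0 0 * (V n) 1 0)%:~R / (N n).+1%:R) *
   expi (pi * (m s.2 0 0 * - l s.1 1 0 - - l s.1 0 0 * m s.2 1 0)%:~R / (N n).+1%:R)).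
pose q (s : I * J) := - l s.1 + m s.2.
exists (fun n => sqnorm_vec (opvec n (b n) q)).
  move=> n.
  have -> : braket (opvec n c l) (T n (V n) *m opvec n d m) =
      braket (T n (- V n) *m psi n) (opvec n (b n) q).
    rewrite -braket_translationr /opvec braket_suml [T n (V n) *m (\sum_(s : I * J) _)]mulmx_sumr.
    rewrite [RHS]braket_sumr.
    rewrite -(pair_bigA _ (fun i j => braket (psi n) (T n (V n) *m (b n (i, j) *: (T n (q (i, j)) *m psi n))))) /=.
    apply: eq_bigr => i _; rewrite braketZl mulmx_sumr braket_sumr mulr_sumr.
    apply: eq_bigr => j _; rewrite -!scalemxAr !braketZr.
    rewrite -{1}(opprK (l i)) -braket_translationr translation_commute braketZr.
    rewrite [T n (- l i) *m (T n (m j) *m _)]translationD -!scalemxAr braketZr.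
    by rewrite /b /q /= !mxE; ring.
  apply: bessel; by rewrite braket_translation.
have bc s : ccvg (b ^~ s) ((c s.1)^*%C * d s.2 * (expi (- (2 * pi * ((l s.1 1 0)%:~R * v.1 - (l s.1 0 0)%:~R * v.2))) * 1)).
  apply: ccvgM; first exact: ccvg_cst.
  apply: ccvgM; last exact: phase_cvg1.
  apply: ccvg_expi.
  have -> : (fun n => 2 * pi * ((V n) 0 0 * - l s.1 1 0 - - l s.1 0 0 * (V n) 1 0)%:~R / (N n).+1%:R) =
      (fun n => - (2 * pi * ((l s.1 1 0)%:~R * ((V n 0 0)%:~R / (N n).+1%:R) -
        (l s.1 0 0)%:~R * ((V n 1 0)%:~R / (N n).+1%:R)))) :> (nat -> R).
    by apply/funext => n; rewrite !(rmorphB, rmorphM, rmorphN) /=; ring.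
  apply: cvgN; apply: cvgM; first exact: cvg_cst.
  by apply: cvgB; apply: cvgM => //; exact: cvg_cst.
have := @opvec_sqnorm_cvg _ b _ q bc.
set r1 := Rintegral _ _ _; set r2 := Rintegral _ _ _; suff -> : r1 = r2 by [].
congr (Rintegral _ _ _); apply/funext => x.
rewrite -[X in _ = X * _]sqnormJ -sqnormM conjc_sum; congr sqnorm.
rewrite -(pair_bigA _ (fun i j => ((c i)^*%C * d j * (expi (- (2 * pi * ((l i 1 0)%:~R * v.1 - (l i 0 0)%:~R * v.2))) * 1)) * chi (- l i + m j) (repr x))) /=.
rewrite mulr_suml; apply: eq_bigr => i _; rewrite mulr_sumr; apply: eq_bigr => j _.
by rewrite chiD chiN chi_translate !conjcM expiN -/(chi (l i) v); ring.
Qed.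

Lemma opvec_cst n : psi n = opvec n (fun _ : unit => 1) (fun=> 0).
Proof. by rewrite /opvec (big_pred1 tt) ?scale1r ?translation0//; case. Qed.

Section Inequality.
Variables (V : nat -> 'cV[int]_2 -> 'cV[int]_2) (v : 'cV[int]_2 -> R * R).
Hypothesis VB : forall n k l, V n (k - l) = V n k - V n l.
Hypothesis Vcross : forall n k l, cross (V n k) (V n l) = cross k l.
Hypothesis V1 : forall k, ((V n k 0 0)%:~R / (N n).+1%:R : R) @[n --> \oo] --> (v k).1.
Hypothesis V2 : forall k, ((V n k 1 0)%:~R / (N n).+1%:R : R) @[n --> \oo] --> (v k).2.
Hypothesis Vpsi : forall n k,
  braket (psi n) (T n (V n k) *m psi n) = braket (psi n) (T n k *m psi n).
Variables (f : R * R -> R).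
Hypothesis tf : real_trig_poly f.

(** Limits of bounds for the three brackets containing Op(f), in this order: T_(V k) between Op(f)
    psi and psi, between psi and Op(f) psi, and between Op(f) psi and itself. *)
Definition translation_defect k : R :=
  Num.sqrt (\int[mu]_x (f ((repr x).1 + (v k).1, (repr x).2 + (v k).2)) ^+ 2) +
  Num.sqrt (\int[mu]_x (f ((repr x).1 - (v k).1, (repr x).2 - (v k).2)) ^+ 2) +
  Num.sqrt (\int[mu]_x ((f ((repr x).1 + (v k).1, (repr x).2 + (v k).2)) ^+ 2 *
                        f (repr x) ^+ 2)).

(** Positivity of the squared norm of sum_i a_i T_(V k_i) rho, with f and a fixed. Expanding the
    matrix element of T_(V p) in rho = psi - Op(f) psi gives one term free of f, equal to that of
    T_p in psi by [Vpsi], and three that [translation_defect] bounds. *)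
Lemma main_inequality I (a : I -> C) (k : I -> 'cV[int]_2) :
  (1 - \int[mu]_x (1 - f (repr x)) ^+ 2) *
    \int[@torus_lebesgue R]_x sqnorm (\sum_i a i * chi (k i) (repr x)) <=
  \int[mu]_x sqnorm (\sum_i a i * chi (k i) (repr x)) +
  \sum_i \sum_(j | k i != k j)
    Num.sqrt (sqnorm ((a i)^*%C * a j)) * translation_defect (k j - k i).
Proof.
have [J [c [l fE]]] := tf.
pose F n := opvec n c l; pose rho n := psi n - F n.
have sqf y : sqnorm (\sum_j c j * chi (l j) y) = f y ^+ 2 by rewrite -fE sqnorm_real.
have sq1 (y : R * R) : sqnorm (\sum_(s : unit) 1 * chi 0 y) = 1 :> R.
  by rewrite (big_pred1 tt) ?mul1r ?chi0 ?sqnorm1//; case.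
have rho_cvg : sqnorm_vec (rho n) @[n --> \oo] --> \int[mu]_x (1 - f (repr x)) ^+ 2.
  pose c' (s : unit + J) : C := match s with inl _ => 1 | inr j => - c j end.
  pose l' (s : unit + J) : 'cV[int]_2 := match s with inl _ => 0 | inr j => l j end.
  have := @opvec_sqnorm_cvg _ (fun=> c') c' l' (fun s => ccvg_cst (c' s)).
  have -> : (fun n => sqnorm_vec (opvec n c' l')) = (fun n => sqnorm_vec (rho n)).
    apply/funext => n; congr sqnorm_vec; rewrite /opvec big_sumType /= -/(opvec n (fun _ : unit => 1) (fun=> 0)) -opvec_cst.
    rewrite /rho /F /opvec -sumrN; congr (_ + _); apply: eq_bigr => j _.
    by rewrite scaleNr.
  set r1 := Rintegral _ _ _; set r2 := Rintegral _ _ _; suff -> : r1 = r2 by [].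
  congr (Rintegral _ _ _); apply/funext => x; rewrite big_sumType /= (big_pred1 tt) ?mul1r ?chi0; last by case.
  rewrite -sqnorm_real rmorphB /= fE -sumrN; congr (sqnorm (_ + _)).
  by apply: eq_bigr => j _; rewrite mulNr.
have off p : exists e : nat -> R,
    (forall n, Num.sqrt (sqnorm (braket (rho n) (T n (V n p) *m rho n) - braket (psi n) (T n p *m psi n))) <= e n) /\
    e n @[n --> \oo] --> translation_defect p.
  have [e1 e1P e1cvg] := @translated_overlap (V ^~ p) (v p) _ _ c l (fun _ : unit => 1) (fun=> 0) (@V1 p) (@V2 p).
  have V1' : ((- V n p) 0 0)%:~R / (N n).+1%:R @[n --> \oo] --> (- (v p).1).
    by under eq_fun do rewrite !mxE rmorphN /= mulNr; apply: cvgN; exact: V1.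
  have V2' : ((- V n p) 1 0)%:~R / (N n).+1%:R @[n --> \oo] --> (- (v p).2).
    by under eq_fun do rewrite !mxE rmorphN /= mulNr; apply: cvgN; exact: V2.
  have [e2 e2P e2cvg] := @translated_overlap (fun n => - V n p) (- (v p).1, - (v p).2) _ _ c l (fun _ : unit => 1) (fun=> 0) V1' V2'.
  have [e3 e3P e3cvg] := @translated_overlap (V ^~ p) (v p) _ _ c l c l (@V1 p) (@V2 p).
  exists (fun n => Num.sqrt (e1 n) + Num.sqrt (e2 n) + Num.sqrt (e3 n)); split.
    move=> n; rewrite mulmxBr !(braketBr, braketBl) Vpsi.
    set m := braket (psi n) (T n p *m _); set x1 := braket (F n) (_ *m psi n).
    set x2 := braket (psi n) (_ *m F n); set x3 := braket (F n) _.
    have -> : m - x1 - (x2 - x3) - m = - x1 + - x2 + x3 by ring.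
    rewrite (le_trans (sqrt_sqnormD _ _))// lerD//; last exact/ler_wsqrtr/e3P.
    rewrite (le_trans (sqrt_sqnormD _ _))// !sqnormN lerD//.
      by apply: ler_wsqrtr; have := e1P n; rewrite -opvec_cst.
    apply: ler_wsqrtr; have := e2P n; rewrite -opvec_cst; apply: le_trans.
    by rewrite -[leRHS]sqnormJ -braketJ /x2 braket_translationr.
  have sqrt_cvg (u : nat -> R) z z' : u n @[n --> \oo] --> z -> z = z' ->
      Num.sqrt (u n) @[n --> \oo] --> Num.sqrt z'.
    by move=> uz <-; apply: (cvg_comp _ _ uz); exact: sqrt_continuous.
  apply: cvgD; first apply: cvgD.
  - apply: sqrt_cvg e1cvg _; congr (Rintegral _ _ _); apply/funext => x; by rewrite sqf sq1 mulr1.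
  - apply: sqrt_cvg e2cvg _; congr (Rintegral _ _ _); apply/funext => x; by rewrite sqf sq1 mulr1.
  - apply: sqrt_cvg e3cvg _; congr (Rintegral _ _ _); apply/funext => x; by rewrite !sqf.
have {off}[e eP] := choice off.
(* By [Vcross] the exponent involves [k i] and [k j] in place of their images under [V n], so it is
   fixed up to the factor h and the phase tends to 1. *)
pose w i j n : C := expi (pi * (cross (k i) (k j))%:~R / (N n).+1%:R).
pose ca i j : C := (a i)^*%C * a j.
pose br n p : C := braket (rho n) (T n (V n p) *m rho n).
pose m n p : C := braket (psi n) (T n p *m psi n).
(* The squared norm is split in three: [u] uses the matrix elements of psi for all pairs, [d]
   corrects the pairs of equal frequency by the squared norm of rho minus 1, and [s] bounds the
   error on the other pairs. *)
pose u n : C := \sum_i \sum_j ca i j * (w i j n * m n (k j - k i)).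
pose d n : C := \sum_i \sum_(j | k i == k j) ca i j * (w i j n * (sqnorm_vec (rho n) - 1)%:C%C).
pose s n : R := \sum_i \sum_(j | k i != k j) Num.sqrt (sqnorm (ca i j)) * e (k j - k i) n.
have V0 n : V n 0 = 0 by have := VB n 0 0; rewrite !subrr.
have brE n i : br n (k i - k i) = (sqnorm_vec (rho n))%:C%C.
  by rewrite /br subrr V0 translation0 braket_self.
have mE n i : m n (k i - k i) = 1 by rewrite /m subrr translation0 psi1.
have pos n : 0 <= complex.Re (u n) + complex.Re (d n) + s n.
  pose x : C := \sum_i \sum_(j | k i != k j) ca i j * (w i j n * (br n (k j - k i) - m n (k j - k i))).
  have QE : (sqnorm_vec (\sum_i a i *: (T n (V n (k i)) *m rho n)))%:C%C = u n + d n + x.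
    rewrite -braket_self braket_suml /u /d /x -!big_split; apply: eq_bigr => i _ /=.
    rewrite braketZl braket_sumr mulr_sumr.
    have ph j : braket (T n (V n (k i)) *m rho n) (T n (V n (k j)) *m rho n) = w i j n * br n (k j - k i).
      rewrite braket_TT -VB /w -(Vcross n) /cross; congr (expi (_ * _%:~R / _) * _); ring.
    rewrite [X in _ = _ + X + _]big_mkcond [X in _ = _ + _ + X]big_mkcond -!big_split /=.
    apply: eq_bigr => j _; rewrite braketZr ph /ca.
    have [<-|_] /= := eqVneq (k i) (k j); last by ring.
    by rewrite brE mE rmorphB /=; ring.
  have Q0 : 0 <= complex.Re (u n + d n + x).
    by rewrite -QE; exact: sqnorm_vec_ge0.
  apply: le_trans Q0 _; rewrite !raddfD /= lerD2l.
  rewrite (le_trans (ler_norm _))// (le_trans (normr_Re _))//.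
  rewrite (le_trans (sqrt_sqnorm_sum _ _))// ler_sum// => i _.
  rewrite (le_trans (sqrt_sqnorm_sum _ _))// ler_sum// => j _.
  rewrite (sqnormM (ca i j)) (sqnormM (w i j n)) sqnorm_expi mul1r (sqrtrM _ (sqnorm_ge0 (ca i j))) ler_wpM2l ?sqrtr_ge0//.
  exact: (eP (k j - k i)).1.
have wcvg i j : ccvg (w i j) 1 by exact: phase_cvg1.
have ucvg : ccvg u (\int[mu]_x sqnorm (\sum_i a i * chi (k i) (repr x)))%:C%C.
  rewrite Rintegral_sqnorm_trig//; apply: ccvg_sum => i _; apply: ccvg_sum => j _.
  apply: ccvgM; first exact: ccvg_cst.
  by rewrite -[X in ccvg _ X]mul1r; apply: (ccvgM (wcvg i j)); exact: mom.
pose r := \int[mu]_x (1 - f (repr x)) ^+ 2.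
pose L := \int[@torus_lebesgue R]_x sqnorm (\sum_i a i * chi (k i) (repr x)).
(* Lebesgue measure enters here: by orthogonality of characters, the coefficients over pairs of
   equal frequency add up to the Lebesgue integral of |a|^2. *)
have LE : \sum_i \sum_(j | k i == k j) ca i j = L%:C%C.
  rewrite Rintegral_sqnorm_trig ?torus_lebesgue_fin//; apply: eq_bigr => i _.
  rewrite big_mkcond; apply: eq_bigr => j _; rewrite cint_chi subr_eq0 eq_sym.
  by case: (k j == k i); rewrite ?mulr1 ?mulr0.
have dcvg : ccvg d (L * (r - 1))%:C%C.
  rewrite rmorphM /= -LE mulr_suml; apply: ccvg_sum => i _; rewrite mulr_suml.
  apply: ccvg_sum => j _; apply: ccvgM; first exact: ccvg_cst.
  rewrite -[X in ccvg _ X]mul1r; apply: (ccvgM (wcvg i j)); split => /=; last exact: cvg_cst.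
  by apply: cvgB; [exact: rho_cvg|exact: cvg_cst].
pose S := \sum_i \sum_(j | k i != k j) Num.sqrt (sqnorm (ca i j)) * translation_defect (k j - k i).
have scvg : s n @[n --> \oo] --> S.
  apply: cvgr_sum => i _; apply: cvgr_sum => j _; apply: cvgM; first exact: cvg_cst.
  exact: (eP (k j - k i)).2.
have : 0 <= \int[mu]_x sqnorm (\sum_i a i * chi (k i) (repr x)) + L * (r - 1) + S.
  have h : complex.Re (u n) + complex.Re (d n) + s n @[n --> \oo] -->
      \int[mu]_x sqnorm (\sum_i a i * chi (k i) (repr x)) + L * (r - 1) + S.
    apply: cvgD => //; apply: cvgD; [exact: (proj1 ucvg)|exact: (proj1 dcvg)].
  rewrite -(cvg_lim _ h)//; apply: limr_ge; first by apply/cvg_ex; eexists; exact: h.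
  by apply: nearW => n; exact: pos.
rewrite -/r -/L -/S; lra.
Qed.

End Inequality.
End Asymptotics.

(** * Finite sets of points and trigonometric bumps around them *)

Section Bumps.
Variable R : realType.
Local Notation T2 := (torus R).
Implicit Types (x s : T2) (y z : R * R) (D : seq T2).

Lemma torus_gap_diff_eq0 y x :
  (torus_gap (y.1 - (repr x).1, y.2 - (repr x).2) == 0) = (torus_proj y == x).
Proof.
apply/eqP/eqP => [/torus_gap_eq0|<-].
  rewrite /lattice_eqv /= !subr0 => h; rewrite -[RHS]torus_projK.
  by apply/torus_projP; exact: h.
rewrite -torus_gap0; apply: (real_trig_poly_periodic (@real_trig_poly_gap R)).
by have := repr_torus_proj y; rewrite lattice_eqv_sym /lattice_eqv /= !subr0.
Qed.

Lemma measurable_torus_set1 x : measurable [set x].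
Proof.
have tp := real_trig_poly_translate (- (repr x).1, - (repr x).2) (@real_trig_poly_gap R).
have [mg _] := bounded_measurable_trig tp.
have -> : [set x] = (fun x' : T2 => torus_gap ((repr x').1 - (repr x).1, (repr x').2 - (repr x).2)) @^-1` [set 0].
  apply/seteqP; split => [x' -> /=|x' /= /eqP].
    by apply/eqP; rewrite torus_gap_diff_eq0 torus_projK.
  by rewrite torus_gap_diff_eq0 torus_projK => /eqP.
by rewrite -[X in measurable X]setTI; apply: mg.
Qed.

Lemma torus_seq_cons x D : [set` x :: D] = [set x] `|` [set` D].
Proof.
apply/seteqP; split => [x' /=|x' /= [->|h]]; rewrite in_cons ?eqxx//.
  by case/predU1P; [left|right].
by rewrite h orbT.
Qed.

Lemma measurable_torus_seq D : measurable [set` D].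
Proof.
elim: D => [|x D IH]; first by rewrite set_nil.
rewrite torus_seq_cons.
by apply: measurableU => //; exact: measurable_torus_set1.
Qed.

Lemma measure_seq_null (m : {measure set T2 -> \bar R}) D :
  (forall s, s \in D -> m [set s] = 0%E) -> m [set` D] = 0%E.
Proof.
elim: D => [|s D IH] null; first by rewrite set_nil measure0.
rewrite torus_seq_cons; apply/eqP; rewrite eq_le measure_ge0 andbT.
apply: le_trans (measureU2 _ _ _) _; [exact: measurable_torus_set1|exact: measurable_torus_seq|].
have h : m [set` D] = 0%E by apply: IH => s' s'D; apply: null; rewrite in_cons s'D orbT.
have h1 : (m [set s] <= 0)%E by rewrite null ?mem_head.
have h2 : (m [set` D] <= 0)%E by rewrite h.
exact: (adde_le0 h1 h2).
Qed.

(** Each summand is 1 at one point of D and less than 1 elsewhere, so high powers concentrate on D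
    while remaining trigonometric polynomials bounded by the number of points. *)
Definition bump D (p : nat) y : R :=
  \sum_(s <- D) (1 - torus_gap (y.1 - (repr s).1, y.2 - (repr s).2)) ^+ p.

Lemma real_trig_poly_bump D p : real_trig_poly (bump D p).
Proof.
apply: real_trig_poly_sum => s; apply: real_trig_polyX.
apply: real_trig_polyB; first exact: real_trig_poly_cst.
exact: (real_trig_poly_translate (- (repr s).1, - (repr s).2) (@real_trig_poly_gap R)).
Qed.

Lemma bump_bounded D p y : `|bump D p y| <= (size D)%:R.
Proof.
rewrite /bump; elim: D => [|s D IH]; first by rewrite big_nil normr0.
rewrite big_cons (le_trans (ler_normD _ _))//= -add1n natrD lerD//.
set y' := (_, _); rewrite normrX.
have := torus_gap_ge0 y'; have := torus_gap_le1 y' => h1 h0.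
by rewrite exprn_ile1// ger0_norm; lra.
Qed.

Lemma bump_cvg D y : uniq D ->
  bump D p y @[p --> \oo] --> ((torus_proj y \in D)%:R : R).
Proof.
move=> uD; have -> : (torus_proj y \in D)%:R = \sum_(s <- D) (torus_proj y == s)%:R :> R.
  elim: D uD => [|s D IH]; first by rewrite big_nil.
  rewrite big_cons /= in_cons => /andP[sD uD]; rewrite -IH//.
  by have [->|] := eqVneq (torus_proj y) s; rewrite ?(negbTE sD) ?addr0 ?add0r.
apply: cvgr_sum => s _; rewrite -torus_gap_diff_eq0; set u := torus_gap _.
have u0 : 0 <= u by exact: torus_gap_ge0.
have u1 : u <= 1 by exact: torus_gap_le1.
have [->|un0] := eqVneq u 0.
  by under eq_fun do rewrite subr0 expr1n; exact: cvg_cst.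
apply: cvg_expr; rewrite ger0_norm ?subr_ge0//; lra.
Qed.

Lemma Rintegral_indic_comp (m : {measure set T2 -> \bar R}) (P : T2 -> bool) :
  \int[m]_x (P x)%:R = \int[m]_x \1_[set x | P x] x.
Proof. by congr (Rintegral _ _ _); apply/funext => x; rewrite indicE; congr ((nat_of_bool _)%:R); apply/idP/idP; rewrite in_setE. Qed.

End Bumps.

(** * Sharpening the observable to the indicator of a finite set *)

Section LimitInequality.
Variables (R : realType) (mu : probability (torus R) R).
Local Notation T2 := (torus R).
Local Notation C := R[i].
Variables (N : nat -> nat) (psi : forall n, 'cV[C]_(N n).+1).
Hypothesis Noo : N n @[n --> \oo] --> \oo.
Hypothesis psi1 : forall n, braket (psi n) (psi n) = 1.
Local Notation T n k := (translation R (N n).+1 k).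
Hypothesis mom : forall k, ccvg (fun n => braket (psi n) (T n k *m psi n))
        (cint mu (fun x => chi k (repr x))).
Variables (V : nat -> 'cV[int]_2 -> 'cV[int]_2) (v : 'cV[int]_2 -> R * R).
Hypothesis VB : forall n k l, V n (k - l) = V n k - V n l.
Hypothesis Vcross : forall n k l, cross (V n k) (V n l) = cross k l.
Hypothesis V1 : forall k, ((V n k 0 0)%:~R / (N n).+1%:R : R) @[n --> \oo] --> (v k).1.
Hypothesis V2 : forall k, ((V n k 1 0)%:~R / (N n).+1%:R : R) @[n --> \oo] --> (v k).2.
Hypothesis Vpsi : forall n k,
  braket (psi n) (T n (V n k) *m psi n) = braket (psi n) (T n k *m psi n).
Variable D : seq T2.
Hypothesis uD : uniq D.
Hypothesis Dnull : forall k s, k != 0 -> s \in D ->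
  mu [set torus_proj ((repr s).1 + (v k).1, (repr s).2 + (v k).2)] = 0%E /\
  mu [set torus_proj ((repr s).1 - (v k).1, (repr s).2 - (v k).2)] = 0%E.

Let mufin : (mu setT < +oo)%E. Proof. by rewrite probability_setT ltry. Qed.

(** If x + z is in D then x is in D - z, a finite set of null points. *)
Lemma translate_null (z : R * R) :
  (forall s, s \in D -> mu [set torus_proj ((repr s).1 - z.1, (repr s).2 - z.2)] = 0%E) ->
  forall B : set T2, measurable B ->
    (forall x : T2, B x -> torus_proj ((repr x).1 + z.1, (repr x).2 + z.2) \in D) -> mu B = 0%E.
Proof.
move=> null B mB BD.
pose D' := [seq torus_proj ((repr s).1 - z.1, (repr s).2 - z.2) | s <- D].
have BD' : B `<=` [set` D'].
  move=> x /BD h; apply/mapP; eexists; first exact: h.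
  rewrite -[LHS]torus_projK; apply/torus_projP.
  have := repr_torus_proj ((repr x).1 + z.1, (repr x).2 + z.2).
  rewrite lattice_eqv_sym /lattice_eqv /= => /andP[h1 h2].
  by apply/andP; split; [move: h1|move: h2]; congr (_ \is a _); ring.
apply/eqP; rewrite eq_le measure_ge0 andbT.
apply: (@le_trans _ _ (mu [set` D'])).
  by apply: le_measure => //; rewrite inE//; exact: measurable_torus_seq.
by rewrite measure_seq_null// => _ /mapP[s sD ->]; exact: null.
Qed.

Lemma bump_sqr_cvg (h : nat -> T2 -> R) (P : T2 -> bool) (M : R) :
  (forall p, measurable_fun setT (h p)) -> (forall p x, `|h p x| <= M) ->
  (forall x, h p x @[p --> \oo] --> ((P x)%:R : R)) ->
  measurable [set x | P x] /\
  \int[mu]_x (h p x) ^+ 2 @[p --> \oo] --> fine (mu [set x | P x]).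
Proof.
move=> mh hM hP.
have mP : measurable [set x | P x].
  have mlim : measurable_fun setT (fun x => (P x)%:R : R).
    by apply: (measurable_fun_cvg mh) => x _; exact: hP.
  have -> : [set x | P x] = (fun x => (P x)%:R : R) @^-1` [set 1].
    apply/seteqP; split => x /=; first by move->.
    by case: (P x) => // /eqP; rewrite eq_sym oner_eq0.
  by rewrite -[X in measurable X]setTI; apply: mlim.
split=> //; rewrite -Rintegral_indic// -Rintegral_indic_comp.
apply: (@bounded_convergence _ _ _ _ _ _ _ (M ^+ 2)).
- exact: mufin.
- by move=> p; apply: measurable_funX.
- by move=> p x; rewrite normrX lerXn2r ?nnegrE// (le_trans (normr_ge0 _) (hM p x)).
- move=> x; have -> : (P x)%:R = (P x)%:R ^+ 2 :> R by case: (P x); rewrite ?expr1n ?expr0n.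
  by rewrite expr2; under eq_fun do rewrite expr2; apply: cvgM.
Qed.

(** By bounded convergence the three integrals tend to the masses of D - v, of D + v and of a subset
    of D - v, all zero by [Dnull]. *)
Lemma translation_defect_cvg k : k != 0 ->
  translation_defect mu v (bump D p) k @[p --> \oo] --> (0 : R).
Proof.
move=> k0.
have sqrt0 (u : nat -> R) : u n @[n --> \oo] --> (0 : R) -> Num.sqrt (u n) @[n --> \oo] --> (0 : R).
  by move=> uz; rewrite -[X in _ --> X](@sqrtr0 R); apply: (cvg_comp _ _ uz); exact: sqrt_continuous.
have mbump z p : measurable_fun setT (fun x : T2 => bump D p ((repr x).1 + z.1, (repr x).2 + z.2)).
  by have [] := bounded_measurable_trig (real_trig_poly_translate z (real_trig_poly_bump D p)).
have tr z : (forall s, s \in D -> mu [set torus_proj ((repr s).1 - z.1, (repr s).2 - z.2)] = 0%E) ->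
    \int[mu]_x (bump D p ((repr x).1 + z.1, (repr x).2 + z.2)) ^+ 2 @[p --> \oo] --> (0 : R).
  move=> null.
  have [mP] := @bump_sqr_cvg _ _ _ (mbump z) (fun p x => bump_bounded D p _) (fun x => @bump_cvg _ D _ uD).
  by rewrite (translate_null null mP).
have n1 s : s \in D -> mu [set torus_proj ((repr s).1 - (v k).1, (repr s).2 - (v k).2)] = 0%E.
  by move=> /(Dnull k0) [].
have n2 s : s \in D -> mu [set torus_proj ((repr s).1 - - (v k).1, (repr s).2 - - (v k).2)] = 0%E.
  by move=> /(Dnull k0) []; rewrite !opprK.
rewrite -[X in _ --> X]addr0 -[X in _ --> X + _]addr0.
apply: cvgD; first apply: cvgD; apply: sqrt0.
- exact: (tr (v k)).
- exact: (tr (- (v k).1, - (v k).2)).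
pose h p (x : T2) := bump D p ((repr x).1 + (v k).1, (repr x).2 + (v k).2) * bump D p (repr x).
pose P (x : T2) := (torus_proj ((repr x).1 + (v k).1, (repr x).2 + (v k).2) \in D) && (torus_proj (repr x) \in D).
have [mP] : measurable [set x | P x] /\
    \int[mu]_x (h p x) ^+ 2 @[p --> \oo] --> fine (mu [set x | P x]).
  apply: (@bump_sqr_cvg h P ((size D)%:R * (size D)%:R)).
  - move=> p; apply: measurable_funM; first exact: mbump.
    by have [] := bounded_measurable_trig (real_trig_poly_bump D p).
  - by move=> p x; rewrite normrM ler_pM// bump_bounded.
  - by move=> x; rewrite /P -mulnb natrM; apply: cvgM; exact: bump_cvg.
rewrite (translate_null n1 mP) => [|x /= /andP[]//].
by under eq_fun do under eq_fun do rewrite exprMn.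
Qed.

(** Let p grow in [main_inequality] with a fixed: 1 - int (1 - f)^2 dmu tends to 1 - mu(~D) = mu(D),
    and the finitely many defects vanish. *)
Lemma limit_inequality (I : finType) (a : I -> C) (k : I -> 'cV[int]_2) :
  fine (mu [set` D]) *
    \int[@torus_lebesgue R]_x sqnorm (\sum_i a i * chi (k i) (repr x)) <=
  \int[mu]_x sqnorm (\sum_i a i * chi (k i) (repr x)).
Proof.
set L := \int[_]_x _; set M := \int[_]_x _.
have [mP rcvg] : measurable [set x : T2 | torus_proj (repr x) \notin D] /\
    \int[mu]_x (1 - bump D p (repr x)) ^+ 2 @[p --> \oo] -->
    fine (mu [set x : T2 | torus_proj (repr x) \notin D]).
  apply: (@bump_sqr_cvg (fun p x => 1 - bump D p (repr x)) (fun x => torus_proj (repr x) \notin D) (1 + (size D)%:R)).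
  - move=> p; apply: measurable_funB => //.
    by have [] := bounded_measurable_trig (real_trig_poly_bump D p).
  - by move=> p x; rewrite (le_trans (ler_normB _ _))// normr1 lerD2l bump_bounded.
  - move=> x; have -> : (torus_proj (repr x) \notin D)%:R = 1 - (torus_proj (repr x) \in D)%:R :> R.
      by case: (_ \in D); rewrite ?subrr ?subr0.
    by apply: cvgB; [exact: cvg_cst|exact: bump_cvg].
have e1 : fine (mu [set x : T2 | torus_proj (repr x) \notin D]) = 1 - fine (mu [set` D]).
  have -> : [set x : T2 | torus_proj (repr x) \notin D] = ~` [set` D].
    by apply/seteqP; split => x /=; rewrite torus_projK => /negP.
  rewrite probability_setC; last exact: measurable_torus_seq.
  by rewrite fineB ?fin_num_measure//; exact: measurable_torus_seq.
rewrite e1 in rcvg.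
pose S p : R := \sum_i \sum_(j | k i != k j) Num.sqrt (sqnorm ((a i)^*%C * a j)) *
  translation_defect mu v (bump D p) (k j - k i).
have scvg : S p @[p --> \oo] --> (\sum_i \sum_(j | k i != k j) Num.sqrt (sqnorm ((a i)^*%C * a j)) * 0 : R).
  apply: cvgr_sum => i _; apply: cvgr_sum => j kij; apply: cvgM; first exact: cvg_cst.
  by apply: translation_defect_cvg; rewrite subr_eq0 eq_sym.
have S0 : \sum_i \sum_(j | k i != k j) Num.sqrt (sqnorm ((a i)^*%C * a j)) * 0 = 0 :> R.
  by rewrite big1// => i _; rewrite big1// => j _; rewrite mulr0.
have main p : (1 - \int[mu]_x (1 - bump D p (repr x)) ^+ 2) * L <= M + S p.
  exact: (main_inequality Noo psi1 mom VB Vcross V1 V2 Vpsi (real_trig_poly_bump D p)).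
have lcvg : (1 - \int[mu]_x (1 - bump D p (repr x)) ^+ 2) * L @[p --> \oo] --> (1 - (1 - fine (mu [set` D]))) * L.
  by apply: cvgM; [apply: cvgB => //; exact: cvg_cst|exact: cvg_cst].
have mcvg : M + S p @[p --> \oo] --> M + 0.
  by rewrite -S0; apply: cvgD => //; exact: cvg_cst.
rewrite subKr in lcvg; rewrite addr0 in mcvg.
rewrite -(cvg_lim _ lcvg)// -(cvg_lim _ mcvg)//; apply: ler_lim; [apply/cvg_ex; eexists; exact: lcvg|apply/cvg_ex; eexists; exact: mcvg|].
by apply: nearW => p; exact: main.
Qed.

End LimitInequality.

(** * Hyperbolic dynamics on the torus *)

Section LucasSubsequence.
Variables (t : int) (R : realType).
Hypothesis ht : 2 < `|t|.

(** With 1/h = N + 1, take for m + 1 the least index at which |b| reaches 1/h. Minimality bounds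
    b_m, and since one step multiplies by at most |t| + 1, b_(m+1) stays comparable to 1/h. *)
Lemma lucas_index (N : nat) : exists m,
  [/\ `|lucas t m| <= N%:Z, N.+1%:Z <= `|lucas t m.+1| &
      `|lucas t m.+1| <= (`|t| + 1) * N.+1%:Z].
Proof.
have ex : exists n, N.+1%:Z <= `|lucas t n| by exists N.+1; exact: lucas_ge.
case: (ex_minnP ex) => -[|m] hm min; first by rewrite normr0 in hm.
have lm : `|lucas t m| <= N%:Z.
  by rewrite leNgt; apply/negP => h; have := min m; rewrite ltnn => /(_ _)/negP; apply; move: h; lia.
(* The step from b_0 = 0 to b_1 = 1 has no ratio bound and is treated apart. *)
exists m; split => //; case: m lm {hm min} => [|m] lm.
  by rewrite /= normr1; have := normr_ge0 t; nia.
apply: le_trans (lucas_leS ht m) _; rewrite ler_wpM2l//; lia.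
Qed.

Lemma increasing_seq_cvg (f : nat -> nat) : increasing_seq f -> f n @[n --> \oo] --> \oo.
Proof.
move=> finc; have fn n : (n <= f n)%N.
  elim: n => // n IH; apply: (leq_ltn_trans IH).
  have h a b : (f a <= f b)%N = (a <= b)%N by exact: finc.
  by rewrite ltnNge h -ltnNge.
move=> X [m _ mX]; exists m => // n /= mn; apply: mX => /=.
exact: leq_trans mn (fn n).
Qed.

Lemma intr_div_bounded (u : nat -> int) (N : nat -> nat) (M : int) :
  (forall n, `|u n| <= M * (N n).+1%:Z) ->
  bounded_fun (fun n => (u n)%:~R / (N n).+1%:R : R).
Proof.
move=> uM; exists M%:~R; split => [|z Mz n _ /=]; first exact: num_real.
apply: le_trans (ltW Mz); rewrite normrM normfV [ `|_.+1%:R|]ger0_norm// ler_pdivrMr//.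
by rewrite -intr_norm -[_.+1%:R]/((Posz (N n).+1)%:~R) -intrM ler_int.
Qed.

(** Two successive extractions by Bolzano-Weierstrass. The sign of x is that of A^(m+1) = b_(m+1) A
    - b_m; the relation is [lucas_norm] divided by 1/h^2, and |b_(m+1)| >= 1/h gives |y| >= 1. *)
Lemma lucas_subsequence (N : nat -> nat) : N n @[n --> \oo] --> \oo ->
  exists (m f : nat -> nat) (x y : R),
    [/\ f n @[n --> \oo] --> \oo,
        - (lucas t (m n))%:~R / (N (f n)).+1%:R @[n --> \oo] --> x,
        (lucas t (m n).+1)%:~R / (N (f n)).+1%:R @[n --> \oo] --> y,
        x ^+ 2 + t%:~R * x * y + y ^+ 2 = 0 & y != 0].
Proof.
move=> Noo; have [m hm] := choice (fun n => lucas_index (N n)).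
have b1 : bounded_fun (fun n => (- lucas t (m n))%:~R / (N n).+1%:R : R).
  apply: (@intr_div_bounded _ _ 1) => n; rewrite normrN mul1r.
  by have [h _ _] := hm n; apply: (le_trans h); rewrite lez_nat.
have [f1 inc1 cvg1] := bolzano_weierstrass b1.
have b2 : bounded_fun (fun n => (lucas t (m (f1 n)).+1)%:~R / (N (f1 n)).+1%:R : R).
  by apply: (@intr_div_bounded _ _ (`|t| + 1)) => n; have [_ _] := hm (f1 n).
have [f2 inc2 cvg2] := bolzano_weierstrass b2.
have f1oo := increasing_seq_cvg inc1; have f2oo := increasing_seq_cvg inc2.
have foo : f1 (f2 n) @[n --> \oo] --> \oo by exact: (cvg_comp _ _ f2oo f1oo).
set x := lim _ in cvg1; set y := lim _ in cvg2.
have xc : - (lucas t (m (f1 (f2 n))))%:~R / (N (f1 (f2 n))).+1%:R @[n --> \oo] --> x.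
  have := cvg_comp _ _ f2oo cvg1; apply: cvg_trans; apply: near_eq_cvg; apply: nearW => n /=.
  by rewrite rmorphN.
have yc : (lucas t (m (f1 (f2 n))).+1)%:~R / (N (f1 (f2 n))).+1%:R @[n --> \oo] --> y by exact: cvg2.
have Nc : (N (f1 (f2 n))).+1%:R^-1 @[n --> \oo] --> (0 : R).
  exact: (cvg_comp _ _ (cvg_comp _ _ foo Noo) (@cvg_harmonic R)).
exists (fun n => m (f1 (f2 n))), (fun n => f1 (f2 n)), x, y; split => //.
- pose u n : R := - (lucas t (m (f1 (f2 n))))%:~R / (N (f1 (f2 n))).+1%:R.
  pose w n : R := (lucas t (m (f1 (f2 n))).+1)%:~R / (N (f1 (f2 n))).+1%:R.
  have h1 : u n ^+ 2 + t%:~R * u n * w n + w n ^+ 2 @[n --> \oo] -->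
      x ^+ 2 + t%:~R * x * y + y ^+ 2.
    apply: cvgD; first apply: cvgD.
    + by rewrite expr2; under eq_fun do rewrite expr2; apply: cvgM.
    + by apply: cvgM => //; apply: cvgM => //; exact: cvg_cst.
    + by rewrite expr2; under eq_fun do rewrite expr2; apply: cvgM.
  have h2 : (N (f1 (f2 n))).+1%:R^-1 * (N (f1 (f2 n))).+1%:R^-1 @[n --> \oo] --> (0 * 0 : R).
    by apply: cvgM.
  have e : (fun n => u n ^+ 2 + t%:~R * u n * w n + w n ^+ 2) =
      (fun n => (N (f1 (f2 n))).+1%:R^-1 * (N (f1 (f2 n))).+1%:R^-1).
    apply/funext => n; rewrite /u /w.
    have := lucas_norm t (m (f1 (f2 n))); move: (m _) => m'; move: (lucas t m'.+1) => p; move: (lucas t m') => q.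
    move=> /(congr1 (fun z => z%:~R : R)); rewrite !(rmorphD, rmorphN, rmorphM, rmorphXn) /= => h.
    have n0 : (N (f1 (f2 n))).+1%:R != 0 :> R by rewrite pnatr_eq0.
    move: (_.+1%:R) n0 => M M0; rewrite -[RHS]mul1r -[X in _ = X * _]h; field; exact: M0.
  by rewrite e in h1; rewrite -(cvg_lim _ h1)// (cvg_lim _ h2)// mulr0.
- have : 1 <= `|y|.
    have ny : `|(lucas t (m (f1 (f2 n))).+1)%:~R / (N (f1 (f2 n))).+1%:R| @[n --> \oo] --> `|y|.
      exact: cvg_norm.
    rewrite -(cvg_lim _ ny)//; apply: limr_ge; first by apply/cvg_ex; eexists; exact: ny.
    apply: nearW => n; rewrite normrM normfV [ `|_.+1%:R|]ger0_norm// ler_pdivlMr// mul1r.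
    rewrite -intr_norm -[_.+1%:R]/((Posz (N (f1 (f2 n))).+1)%:~R) ler_int.
    by have [] := hm (f1 (f2 n)).
  by apply: contraTneq => ->; rewrite normr0 ler10.
Qed.

End LucasSubsequence.

Local Open Scope quotient_scope.

(** * The toral automorphism and the atoms of invariant measures *)

Section Dynamics.
Variables (R : realType) (A : 'M[int]_2).
Hypothesis hdet : \det A = 1.
Local Notation T2 := (torus R).
Local Notation f := (@torus_map R A).
Local Notation g := (@plane_map A R).
Implicit Types (x s : T2) (y z : R * R) (D : seq T2).

Lemma torus_map_proj y : f (torus_proj y) = torus_proj (plane_map A y).
Proof.
apply/torus_projP; have := repr_torus_proj y; rewrite /lattice_eqv /=.
move: (repr _) => z /andP[h1 h2]; apply/andP; split.
- have -> : (A 0 0)%:~R * z.1 + (A 0 1)%:~R * z.2 - ((A 0 0)%:~R * y.1 + (A 0 1)%:~R * y.2) =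
    (A 0 0)%:~R * (z.1 - y.1) + (A 0 1)%:~R * (z.2 - y.2) by ring.
  by rewrite rpredD// rpredM// intr_int.
- have -> : (A 1 0)%:~R * z.1 + (A 1 1)%:~R * z.2 - ((A 1 0)%:~R * y.1 + (A 1 1)%:~R * y.2) =
    (A 1 0)%:~R * (z.1 - y.1) + (A 1 1)%:~R * (z.2 - y.2) by ring.
  by rewrite rpredD// rpredM// intr_int.
Qed.

Lemma iter_torus_map_proj n y : iter n f (torus_proj y) = torus_proj (iter n g y).
Proof. by elim: n => //= n ->; exact: torus_map_proj. Qed.

Lemma torus_map_inj : injective f.
Proof.
move=> x x'; rewrite -(torus_projK x) -(torus_projK x') !torus_map_proj.
move: (repr x) (repr x') => y z /torus_projP /andP[/= h1 h2]; apply/torus_projP.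
have d : (A 0 0)%:~R * (A 1 1)%:~R - (A 0 1)%:~R * (A 1 0)%:~R = 1 :> R.
  by rewrite -!intrM -intrB (det2 hdet).
move: h1 h2 d; set a := (A 0 0)%:~R; set b := (A 0 1)%:~R; set c := (A 1 0)%:~R; set e := (A 1 1)%:~R.
have [ai bi ci ei] : [/\ a \is a Num.int, b \is a Num.int, c \is a Num.int & e \is a Num.int].
  by split; exact: intr_int.
move=> h1 h2 d; apply/andP; split.
- have -> : y.1 - z.1 = e * (a * y.1 + b * y.2 - (a * z.1 + b * z.2)) -
      b * (c * y.1 + e * y.2 - (c * z.1 + e * z.2)).
    by rewrite -[LHS]mul1r -d; ring.
  by rewrite rpredB// rpredM.
- have -> : y.2 - z.2 = a * (c * y.1 + e * y.2 - (c * z.1 + e * z.2)) -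
      c * (a * y.1 + b * y.2 - (a * z.1 + b * z.2)).
    by rewrite -[LHS]mul1r -d; ring.
  by rewrite rpredB// rpredM.
Qed.

Lemma iter_torus_map_inj n : injective (iter n f).
Proof. by elim: n => [|n IH] x x' //= /torus_map_inj /IH. Qed.

Lemma continuous_plane_map : continuous (@plane_map A R).
Proof.
move=> y.
have h (a b : R) : (a * z.1 + b * z.2) @[z --> y] --> a * y.1 + b * y.2.
  by apply: cvgD; apply: cvgM; do ?[exact: cvg_cst|exact: cvg_fst|exact: cvg_snd].
exact: (cvg_pair (h _ _) (h _ _)).
Qed.

Lemma measurable_torus_map : measurable_fun setT f.
Proof.
apply: (@measurability _ _ _ _ _ _ (@open T2)) => //.
move=> _ [U oU <-]; rewrite setTI; apply: measurable_torus_open.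
have -> : open (f @^-1` U) = open (@torus_proj R @^-1` (f @^-1` U)) by [].
have -> : @torus_proj R @^-1` (f @^-1` U) = g @^-1` (@torus_proj R @^-1` U).
  by apply/seteqP; split => y /=; rewrite torus_map_proj.
move/continuousP: continuous_plane_map; apply.
by move/continuousP: (@pi_continuous _ {eq_quot (@lattice_equiv R)}); apply.
Qed.

Lemma measure_torus_seq (m : {measure set T2 -> \bar R}) D : uniq D ->
  m [set` D] = (\sum_(s <- D) m [set s])%E.
Proof.
elim: D => [|s D IH]; first by rewrite set_nil measure0 big_nil.
move=> /= /andP[sD uD]; rewrite big_cons -IH// torus_seq_cons measureU//.
- exact: measurable_torus_set1.
- exact: measurable_torus_seq.
- by apply/seteqP; split => // x [/= -> h]; rewrite h in sD.
Qed.

Section Invariant.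
Variable mu : probability T2 R.
Hypothesis hmu : invariant_measure A mu.

Lemma invariant_set1 x : mu [set f x] = mu [set x].
Proof.
rewrite -hmu; last exact: measurable_torus_set1.
congr (mu _); by apply/seteqP; split => x' /= => [/torus_map_inj|->].
Qed.

Lemma invariant_iter_set1 n x : mu [set iter n f x] = mu [set x].
Proof. by elim: n => //= n IH; rewrite invariant_set1. Qed.

(** By invariance all iterates of x have the same mass, and infinitely many distinct points share a
    total mass of at most 1. *)
Lemma aperiodic_null x : (forall i j, (i < j)%N -> iter j f x != iter i f x) ->
  mu [set x] = 0%E.
Proof.
move=> ap; pose c := fine (mu [set x]).
have ce : mu [set x] = c%:E by rewrite fineK// fin_num_measure//; exact: measurable_torus_set1.
have c0 : 0 <= c by exact: fine_ge0.
have cn n : n%:R * c <= 1.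
  pose D := [seq iter i f x | i <- iota 0 n].
  have uD : uniq D.
    rewrite map_inj_in_uniq ?iota_uniq// => i j _ _ /eqP ij.
    by case: (ltngtP i j) => // /ap; rewrite ?ij// eq_sym ij.
  have := probability_le1 mu (measurable_torus_seq D); rewrite measure_torus_seq//.
  rewrite big_map (eq_bigr (fun=> c%:E)) => [|i _]; last exact: etrans (invariant_iter_set1 _ _) ce.
  rewrite sumEFin lee_fin big_const_seq count_predT size_iota iter_addr_0.
  by rewrite mulr_natl.
rewrite ce; congr EFin; apply/eqP; rewrite eq_le c0 andbT leNgt; apply/negP => cpos.
have := cn (Num.truncn (c^-1)).+1; apply/negP; rewrite -ltNge -ltr_pdivrMr// mul1r.
by apply: truncnS_gt; rewrite num_real.
Qed.

(** If s + v had a finite orbit, a common multiple J of its period and that of s would put A^J v - v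
    in Z^2, against [eigen_vector_not_int]. So s + v is aperiodic and carries no mass. *)
Lemma periodic_translate_null s n (x y : R) (k : 'cV[int]_2) : 2 < `|\tr A| -> (0 < n)%N -> iter n f s = s ->
  x ^+ 2 + (\tr A)%:~R * x * y + y ^+ 2 = 0 -> y != 0 -> k != 0 ->
  mu [set torus_proj ((repr s).1 + (eigen_vector A x y k).1, (repr s).2 + (eigen_vector A x y k).2)] = 0%E.
Proof.
move=> htr n0 sn xy y0 k0; set v := eigen_vector A x y k; apply: aperiodic_null => i j ij.
apply/negP => /eqP; set z := torus_proj _.
rewrite -(subnKC (ltnW ij)) iterD => /iter_torus_map_inj zz.
pose J := ((j - i) * n)%N.
have J0 : (0 < J)%N by rewrite muln_gt0 subn_gt0 ij.
have zJ : iter J f z = z.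
  by rewrite /J mulnC; elim: (n) => // n' IH; rewrite mulSn iterD IH.
have sJ : iter J f s = s by rewrite /J; elim: (j - i)%N => // n' IH; rewrite mulSn iterD IH.
have pD m (u w : R * R) : iter m g (u.1 + w.1, u.2 + w.2) =
    ((iter m g u).1 + (iter m g w).1,
     (iter m g u).2 + (iter m g w).2).
  by elim: m => //= m ->; rewrite /plane_map /=; congr pair; ring.
move: zJ sJ; rewrite /z iter_torus_map_proj pD => /torus_projP /andP[/= z1 z2].
rewrite -{1}(torus_projK s) iter_torus_map_proj -[RHS]torus_projK => /torus_projP /andP[/= s1 s2].
have e a b c d : (a + b - (c + d)) - (a - c) = b - d :> R by ring.
apply: (@eigen_vector_not_int A hdet htr R x y k 0 J) => //=; split.
- by have := rpredB z1 s1; rewrite e.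
- by have := rpredB z2 s2; rewrite e.
Qed.

End Invariant.
End Dynamics.

HB.instance Definition _ (R : realType) := Measure_isProbability.Build _ _ _
  (@torus_lebesgue R) (torus_lebesgue_setT R).

(** * The lower bound on semiclassical measures, and invariance of Lebesgue measure *)

Section LowerBound.
Variables (R : realType) (A : 'M[int]_2).
Hypothesis hdet : \det A = 1.
Hypothesis htr : 2 < `|\tr A|.
Local Notation T2 := (torus R).
Local Notation f := (@torus_map R A).
Local Notation leb := (@torus_lebesgue R).

(** [V n] is the power of A at which the Lucas number reaches 1/h: additive, symplectic and without
    effect on the matrix elements of eigenstates, while [V n k] times h converges to [v k]. *)
Lemma semiclassical_lower_bound (mu : probability T2 R) (D : seq T2) :
  invariant_measure A mu -> semiclassical_measure A mu ->
  uniq D -> (forall s, s \in D -> exists2 n, (0 < n)%N & iter n f s = s) ->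
  forall B, measurable B -> fine (mu [set` D]) * fine (leb B) <= fine (mu B).
Proof.
move=> hmu /semiclassical_ccvg[N [psi [Noo Apsi mom]]] uD pD.
have [m [g [x [y [goo xc yc xy y0]]]]] := lucas_subsequence R htr Noo.
have Ngoo : N (g n) @[n --> \oo] --> \oo by exact: (cvg_comp _ _ goo Noo).
pose V n k := itermx A (m n).+1 k.
pose v k := eigen_vector A x y k.
have VE n k i : V n k i 0 = lucas (\tr A) (m n).+1 * (A *m k) i 0 - lucas (\tr A) (m n) * k i 0.
  by rewrite /V (itermxS hdet) entryZB; congr (_ - _); rewrite mxE.
have Vc k i : (V n k i 0)%:~R / (N (g n)).+1%:R @[n --> \oo] -->
    x * (k i 0)%:~R + y * ((A *m k) i 0)%:~R.
  have -> : (fun n => (V n k i 0)%:~R / (N (g n)).+1%:R) =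
      (fun n => - (lucas (\tr A) (m n))%:~R / (N (g n)).+1%:R * (k i 0)%:~R +
        (lucas (\tr A) (m n).+1)%:~R / (N (g n)).+1%:R * ((A *m k) i 0)%:~R) :> (nat -> R).
    by apply/funext => n; rewrite VE rmorphB !rmorphM /=; ring.
  by apply: cvgD; apply: cvgM => //; exact: cvg_cst.
have null k s : k != 0 -> s \in D ->
    mu [set torus_proj ((repr s).1 + (v k).1, (repr s).2 + (v k).2)] = 0%E.
  by move=> k0 /pD[n n0 sn]; exact: (periodic_translate_null hdet hmu htr n0 sn xy y0 k0).
have mufin : (mu setT < +oo)%E by rewrite probability_setT ltry.
apply: le_measure_trig.
- exact: mufin.
- exact: torus_lebesgue_fin.
- exact: fine_ge0.
move=> a [I [c [k aE]]].
have sqa z : a z ^+ 2 = sqnorm (\sum_i c i * chi (k i) z) by rewrite -aE sqnorm_real.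
have := @limit_inequality R mu (fun n => N (g n)) (fun n => psi (g n)) Ngoo
  (fun n => proj1 (Apsi (g n))) (fun k => ccvg_comp goo (mom k)) V v
  (fun n k l => itermxB _ _ _ _) (fun n k l => cross_itermx hdet _ _ _)
  (fun k => Vc k 0) (fun k => Vc k 1) (fun n k => eigenstate_itermx _ _ (Apsi (g n))) D uD.
move=> /(_ _ I c k); under eq_Rintegral do rewrite -sqa; under [X in _ -> _ <= X]eq_Rintegral do rewrite sqa.
apply => l s l0 sD; split; first exact: null.
(* Since [v] is odd, translation by - v(l) is translation by v(- l), covered by the same nullity
   statement. *)
have -> : ((repr s).1 - (v l).1, (repr s).2 - (v l).2) =
    ((repr s).1 + (v (- l)).1, (repr s).2 + (v (- l)).2).
  by rewrite /v /eigen_vector mulmxN !mxE !rmorphN /=; congr pair; ring.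
by apply: null; rewrite ?oppr_eq0.
Qed.

(** Let a be a sum of n + 1 distinct characters, each rotated to equal 1 at x. Then |a|^2 is (n +
    1)^2 at x and has integral n + 1, so that (n + 1) Leb{x} <= 1 for every n. *)
Lemma torus_lebesgue_set1 (x : T2) : leb [set x] = 0%E.
Proof.
have fin : leb [set x] \is a fin_num.
  by rewrite fin_num_measure//; exact: measurable_torus_set1.
rewrite -(fineK fin); congr EFin; apply/eqP; rewrite eq_le fine_ge0// andbT.
set L := fine _.
pose e (i : nat) : 'cV[int]_2 := \col_j (i%:Z * (j == 0)%:R).
suff nL n : n.+1%:R * L <= 1.
  rewrite leNgt; apply/negP => L0; have := nL (Num.truncn (L^-1)).
  by apply/negP; rewrite -ltNge -ltr_pdivrMr// mul1r truncnS_gt// num_real.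
pose c (i : 'I_n.+1) : R[i] := (chi (e i) (repr x))^*%C.
have cc i : (c i)^*%C * c i = 1 by rewrite /c /chi Re_conj_ge0 sqnormJ sqnorm_expi.
have intE : \int[leb]_y sqnorm (\sum_i c i * chi (e i) (repr y)) = n.+1%:R.
  apply: complexI; rewrite Rintegral_sqnorm_trig ?torus_lebesgue_fin//.
  rewrite (eq_bigr (fun=> 1)) ?sumr_const ?card_ord ?rmorph_nat// => i _.
  rewrite (bigD1 i)// big1 => [|j ji]; rewrite cint_chi subr_eq0.
    by rewrite cc eqxx mulr1; exact: addr0.
  case: eqP => [/matrixP/(_ 0 0)|]; rewrite ?mulr0// !mxE eqxx !mulr1 => /eqP.
  by rewrite eqz_nat => ij; rewrite (val_inj (eqP ij)) eqxx in ji.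
have tb : bounded_measurable (fun y : T2 => sqnorm (\sum_i c i * chi (e i) (repr y))).
  apply: bounded_measurable_sqnorm; apply: (@cbounded_measurable_trig R (fun y => \sum_i c i * chi (e i) y)).
  by exists 'I_n.+1, c, (fun i : 'I_n.+1 => e i).
have mx := measurable_torus_set1 x.
have := @bounded_le_Rintegral _ _ _ leb (torus_lebesgue_fin R)
  (fun y => n.+1%:R ^+ 2 * \1_[set x] y) _ (bounded_measurableM (bounded_measurable_cst _ _) (bounded_measurable_indic R mx)) tb.
rewrite intE bounded_RintegralZ ?torus_lebesgue_fin//; last exact: bounded_measurable_indic.
rewrite Rintegral_indic// -/L expr2 -mulrA -[X in _ <= X]mulr1 ler_pM2l ?ltr0n//; apply => y.
rewrite indicE; case: (boolP (y \in [set x])) => [|_]; last by rewrite mulr0 sqnorm_ge0.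
rewrite inE /= => ->; rewrite mulr1.
rewrite (eq_bigr (fun=> 1)) ?sumr_const ?card_ord => [|i _].
  by rewrite -[_ *+ _]/(n.+1%:R) -(rmorph_nat (real_complex R)) sqnorm_real.
by rewrite /c /chi Re_conj_ge0 sqnorm_expi.
Qed.

Lemma torus_lebesgue_seq (D : seq T2) : leb [set` D] = 0%E.
Proof. by apply: measure_seq_null => s _; exact: torus_lebesgue_set1. Qed.

Definition lebesgue_image : set T2 -> \bar R := pushforward leb f.

Let lebesgue_image0 : lebesgue_image set0 = 0%E.
Proof. by rewrite /lebesgue_image /pushforward preimage_set0 measure0. Qed.

Let lebesgue_image_ge0 B : (0 <= lebesgue_image B)%E.
Proof. by rewrite /lebesgue_image /pushforward; exact: measure_ge0. Qed.

Let lebesgue_image_sigma_additive : semi_sigma_additive lebesgue_image.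
Proof. apply: measure_semi_sigma_additive; exact: measurable_torus_map. Qed.

HB.instance Definition _ := isMeasure.Build _ _ _ lebesgue_image
  lebesgue_image0 lebesgue_image_ge0 lebesgue_image_sigma_additive.

Let lebesgue_image_setT : lebesgue_image setT = 1%E.
Proof. by rewrite /lebesgue_image /pushforward preimage_setT torus_lebesgue_setT. Qed.

HB.instance Definition _ := Measure_isProbability.Build _ _ _
  lebesgue_image lebesgue_image_setT.

Lemma Rintegral_lebesgue_image (h : T2 -> R) : bounded_measurable h -> (forall x, 0 <= h x) ->
  \int[lebesgue_image]_x h x = \int[leb]_x h (f x).
Proof.
move=> [mh _] h0.
have e : (\int[lebesgue_image]_x (h x)%:E)%E = (\int[leb]_x (h (f x))%:E)%E.
  rewrite (@ge0_integral_pushforward _ _ _ _ _ f (@measurable_torus_map R A) leb setT (EFin \o h))//.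
  - exact/measurable_EFinP.
  - by move=> x _; rewrite lee_fin.
by rewrite /Rintegral e.
Qed.

(** The vector A^(-1) k, written with the adjugate since det A = 1. As A preserves the symplectic
    pairing, F_k composed with A is F_(A^(-1) k). *)
Definition dual_mulmx (k : 'cV[int]_2) : 'cV[int]_2 :=
  \col_i (if i == 0 then A 1 1 * k 0 0 - A 0 1 * k 1 0 else A 0 0 * k 1 0 - A 1 0 * k 0 0).

Lemma dual_mulmx0 k : dual_mulmx k 0 0 = A 1 1 * k 0 0 - A 0 1 * k 1 0.
Proof. by rewrite mxE. Qed.

Lemma dual_mulmx1 k : dual_mulmx k 1 0 = A 0 0 * k 1 0 - A 1 0 * k 0 0.
Proof. by rewrite mxE. Qed.

Lemma dual_mulmxB k l : dual_mulmx (k - l) = dual_mulmx k - dual_mulmx l.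
Proof.
have eB i : (k - l) i 0 = k i 0 - l i 0 by rewrite !mxE.
by apply: cV2P; rewrite [RHS]mxE [X in _ = _ + X]mxE !(dual_mulmx0, dual_mulmx1) !eB; ring.
Qed.

Lemma dual_mulmx_eq0 k : (dual_mulmx k == 0) = (k == 0).
Proof.
apply/eqP/eqP => [h|->]; last by apply: cV2P; rewrite !(dual_mulmx0, dual_mulmx1) !mxE !mulr0 subrr.
have h0 : dual_mulmx k 0 0 = 0 by rewrite h mxE.
have h1 : dual_mulmx k 1 0 = 0 by rewrite h mxE.
move: h0 h1 (det2 hdet); rewrite dual_mulmx0 dual_mulmx1 => h0 h1 d; apply: cV2P; rewrite mxE.
- rewrite -[LHS]mul1r -d.
  transitivity (A 0 0 * (A 1 1 * k 0 0 - A 0 1 * k 1 0) + A 0 1 * (A 0 0 * k 1 0 - A 1 0 * k 0 0)); first by ring.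
  by rewrite h0 h1 !mulr0 addr0.
- rewrite -[LHS]mul1r -d.
  transitivity (A 1 0 * (A 1 1 * k 0 0 - A 0 1 * k 1 0) + A 1 1 * (A 0 0 * k 1 0 - A 1 0 * k 0 0)); first by ring.
  by rewrite h0 h1 !mulr0 addr0.
Qed.

Lemma chi_plane_map (k : 'cV[int]_2) (y : R * R) : chi k (plane_map A y) = chi (dual_mulmx k) y.
Proof.
by rewrite /chi /plane_map /= dual_mulmx0 dual_mulmx1 !rmorphB !rmorphM /=; congr expi; ring.
Qed.

(** Leb and its image give the same integrals to squares of trigonometric polynomials, because k ->
    A^(-1) k is injective. [le_measure_trig] with c = 1 yields one inequality for every B, and
    complements reverse it. *)
Lemma torus_lebesgue_invariant : invariant_measure A leb.
Proof.
have le B : measurable B -> fine (leb B) <= fine (lebesgue_image B).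
  move=> mB; rewrite -[X in X <= _]mul1r; apply: le_measure_trig mB => //.
  - by change (lebesgue_image setT < +oo)%E; rewrite lebesgue_image_setT ltry.
  - exact: torus_lebesgue_fin.
  move=> a ta; have [I [c [k aE]]] := ta; rewrite mul1r.
  have sqa z : a z ^+ 2 = sqnorm (\sum_i c i * chi (k i) z) by rewrite -aE sqnorm_real.
  rewrite Rintegral_lebesgue_image; last 2 first.
  - exact/bounded_measurableX/bounded_measurable_trig.
  - by move=> x; rewrite sqr_ge0.
  have e1 : (fun x : T2 => a (repr (f x)) ^+ 2) =
      (fun x => sqnorm (\sum_i c i * chi (dual_mulmx (k i)) (repr x))).
    apply/funext => x; rewrite -[in LHS](torus_projK x) torus_map_proj.
    rewrite (doubly_periodic_repr _ (real_trig_poly_periodic ta)) sqa; congr sqnorm.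
    by apply: eq_bigr => i _; rewrite chi_plane_map.
  have e2 : (fun x : T2 => a (repr x) ^+ 2) = (fun x => sqnorm (\sum_i c i * chi (k i) (repr x))).
    by apply/funext => x; rewrite sqa.
  rewrite e1 e2 le_eqVlt; apply/orP; left; apply/eqP/complexI.
  rewrite !Rintegral_sqnorm_trig ?torus_lebesgue_fin//; apply: eq_bigr => i _; apply: eq_bigr => j _.
  by rewrite !cint_chi -dual_mulmxB dual_mulmx_eq0.
have finB B : measurable B -> leb B \is a fin_num.
  by move=> mB; rewrite fin_num_measure.
have mf B : measurable B -> measurable (f @^-1` B).
  by move=> mB; rewrite -[X in measurable X]setTI; exact: measurable_torus_map.
have setC_leb C : measurable C -> fine (leb (~` C)) = 1 - fine (leb C).
  move=> mC; have -> : leb (~` C) = (1 - leb C)%E by exact: probability_setC.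
  by rewrite fineB ?finB.
move=> B mB; have e : fine (leb (f @^-1` B)) = fine (leb B).
  apply/eqP; rewrite eq_le le// andbT.
  have h : 1 - fine (leb B) <= 1 - fine (leb (f @^-1` B)).
    by rewrite -(setC_leb _ mB) -(setC_leb _ (mf _ mB)); exact: (le _ (measurableC mB)).
  by rewrite lerD2l lerN2 in h.
exact: (etrans (esym (fineK (finB _ (mf _ mB)))) (etrans (congr1 EFin e) (fineK (finB _ mB)))).
Qed.

End LowerBound.

(** * Measures carried by periodic orbits *)

Section MaximalNullSet.
Context (d : measure_display) (T : measurableType d) (R : realType).
Variables (mu : probability T R) (m : {measure set T -> \bar R}).

(** Exhaustion: a countable union of m-null sets whose mu-masses approach the supremum attains it,
    and a further m-null set charged by mu would exceed it. For m = Leb such a set carries the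
    singular part of mu. *)
Lemma maximal_null_set : exists S, [/\ measurable S, m S = 0%E &
  forall B, measurable B -> m B = 0%E -> mu (B `&` ~` S) = 0%E].
Proof.
pose E := [set fine (mu B) | B in [set B | measurable B /\ m B = 0%E]].
have hE : has_sup E.
  split; first by exists (fine (mu set0)), set0 => //; split => //; rewrite measure0.
  by exists 1 => _ [B [mB _] <-]; rewrite -lee_fin fineK ?fin_num_measure// probability_le1.
have ex n : exists B, [/\ measurable B, m B = 0%E & sup E - n.+1%:R^-1 < fine (mu B)].
  have n0 : 0 < n.+1%:R^-1 :> R by rewrite invr_gt0.
  by have [_ [B [mB B0] <-] h] := sup_adherent n0 hE; exists B.
have [S_ SP] := choice ex.
have mS : measurable (\bigcup_n S_ n) by apply: bigcup_measurable => n _; have [] := SP n.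
have S0 : m (\bigcup_n S_ n) = 0%E.
  apply/negligibleP => //; apply: negligible_bigcup => n.
  by have [h1 h2 _] := SP n; apply/negligibleP.
exists (\bigcup_n S_ n); split => // B mB B0; set S := \bigcup_n S_ n.
have mBS : measurable (B `&` ~` S) by apply: measurableI => //; exact: measurableC.
have fin C : measurable C -> mu C \is a fin_num by move=> mC; rewrite fin_num_measure.
have U0 : m (S `|` B) = 0%E.
  apply/negligibleP; first exact: measurableU.
  by apply: negligibleU; apply/negligibleP.
have h1 : fine (mu S) + fine (mu (B `&` ~` S)) <= sup E.
  rewrite -fineD ?fin// -measureU//; last by rewrite setIC -setIA setICl setI0.
  have -> : S `|` (B `&` ~` S) = S `|` B by rewrite setUIr setUv setIT.
  by apply: sup_upper_bound => //; exists (S `|` B) => //; split => //; exact: measurableU.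
rewrite -[LHS]fineK ?fin//; congr EFin; apply/eqP; rewrite eq_le fine_ge0// andbT.
rewrite leNgt; apply/negP; set r := fine _ => r0.
have [n nr] : exists n : nat, n.+1%:R^-1 < r.
  exists (Num.truncn r^-1); rewrite -[ltRHS]invrK ltf_pV2 ?posrE ?invr_gt0//.
  by rewrite truncnS_gt// num_real.
have [mSn _ hn] := SP n.
have h2 : fine (mu (S_ n)) <= fine (mu S).
  rewrite fine_le ?fin// le_measure ?inE//; exact: bigcup_sup.
move: h1 h2 hn nr; rewrite -/r; move: (fine (mu S)) (fine (mu (S_ n))) (sup E) (_^-1) => p q e z.
lra.
Qed.

End MaximalNullSet.

(** * Weighted sets of periodic orbits *)

Section Orbits.
Variables (R : realType) (A : 'M[int]_2).
Hypothesis hdet : \det A = 1.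
Local Notation T2 := (torus R).
Local Notation f := (@torus_map R A).
Implicit Types (t : {fset T2}) (x y : T2).

Lemma periodic_orbitP t x : periodic_orbit A t -> x \in t ->
  (exists2 n, (0 < n)%N & iter n f x = x) /\
  (forall y, y \in t <-> exists k, y = iter k f x).
Proof.
move=> [z [n [n0 zn tE]]] /tE[a xE].
have zper k : iter (k * n) f z = z by elim: k => // k IH; rewrite mulSn iterD IH.
split; first by exists n => //; rewrite xE -iterD addnC iterD zn.
move=> y; rewrite tE; split => -[k ->].
  (* As x = f^a z and f^(a n) z = z, another a n - a steps lead from x back to z; n >= 1 makes the
     subtraction exact. *)
  exists (k + (a * n - a))%N; rewrite iterD xE -(iterD _ a) subnK ?zper//.
  by rewrite -{1}(muln1 a) leq_mul2l n0 orbT.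
by exists (k + a)%N; rewrite xE iterD.
Qed.

Lemma periodic_orbit_eq t t' x : periodic_orbit A t -> periodic_orbit A t' ->
  x \in t -> x \in t' -> t = t'.
Proof.
move=> pt pt' /(periodic_orbitP pt)[_ tE] /(periodic_orbitP pt')[_ tE'].
by apply/fsetP => y; apply/idP/idP; [move/tE/tE'|move/tE'/tE].
Qed.

Lemma torus_map_orbit t x : periodic_orbit A t -> (f x \in t) = (x \in t).
Proof.
move=> pt; apply/idP/idP => [fx|xt].
  have [[n n0 fxn] tE] := periodic_orbitP pt fx.
  apply/tE; exists n.-1; apply: (@torus_map_inj R A hdet).
  by rewrite -iterS prednK// fxn.
by have [_ tE] := periodic_orbitP pt xt; apply/tE; exists 1%N.
Qed.

Definition orbit_points (F : seq {fset T2}) : seq T2 := flatten [seq (t : seq T2) | t <- F].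

Lemma orbit_pointsP (F : seq {fset T2}) x : reflect (exists2 t, t \in F & x \in t) (x \in orbit_points F).
Proof. exact: flatten_mapP. Qed.

Lemma orbit_points_uniq (F : seq {fset T2}) : uniq F -> (forall t, t \in F -> periodic_orbit A t) ->
  uniq (orbit_points F).
Proof.
rewrite /orbit_points; elim: F => //= t F IH /andP[tF uF] pF.
rewrite cat_uniq fset_uniq /=; apply/andP; split; last first.
  by apply: IH => // t' t'F; apply: pF; rewrite in_cons t'F orbT.
apply/hasPn => x /flatten_mapP[t' t'F xt']; apply/negP => xt.
have tt' : t = t'.
  by apply: (periodic_orbit_eq _ _ xt xt'); apply: pF; rewrite in_cons ?eqxx ?t'F ?orbT.
by rewrite tt' t'F in tF.
Qed.

Section Weighted.
Variables (mu : probability T2 R) (F : {fset {fset T2}}) (w : {fset T2} -> R).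
Hypothesis hmu : invariant_measure A mu.
Hypothesis hF : weighted_orbits A F w.
Let S := orbits_support F.
Let D := orbit_points F.

Let orbF t : t \in F -> periodic_orbit A t. Proof. by move: t; case: hF. Qed.

Lemma orbits_supportE : S = [set` D].
Proof. by apply/seteqP; split => x /= /orbit_pointsP. Qed.

Lemma measurable_orbits_support : measurable S.
Proof. by rewrite orbits_supportE; exact: measurable_torus_seq. Qed.

Lemma orbit_points_periodic s : s \in D -> exists2 n, (0 < n)%N & iter n f s = s.
Proof. by move=> /orbit_pointsP[t /orbF pt st]; have [] := periodic_orbitP pt st. Qed.

Lemma uniq_D : uniq D.
Proof. by apply: orbit_points_uniq => //; exact: fset_uniq. Qed.

Lemma torus_map_support : f @^-1` S = S.
Proof.
apply/seteqP; split => x [t tF xt]; exists t => //.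
  by rewrite -(torus_map_orbit x (orbF tF)).
by rewrite (torus_map_orbit x (orbF tF)).
Qed.

Lemma orbits_measureE B : orbits_measure F w B =
  (\sum_(t <- F) w t * (#|` t|%:R^-1 * \sum_(x <- t) (x \in B)%:R))%:E.
Proof.
rewrite /orbits_measure -sumEFin; apply: eq_bigr => t _.
by rewrite /orbit_measure EFinM EFinM -sumEFin.
Qed.

Lemma orbit_card_neq0 t : t \in F -> #|` t|%:R != 0 :> R.
Proof.
move=> /orbF [z [n [_ _ tE]]]; rewrite pnatr_eq0 cardfs_eq0.
by apply/fset0Pn; exists z; apply/tE; exists 0%N.
Qed.

Lemma orbits_measure_support : orbits_measure F w S = 1%E.
Proof.
rewrite orbits_measureE; congr EFin; transitivity (\sum_(t <- F) w t); last by case: hF.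
rewrite big_seq [RHS]big_seq; apply: eq_bigr => t tF.
rewrite big_seq (eq_bigr (fun=> 1)) => [|x xt]; last by rewrite mem_set//; exists t.
by rewrite -big_seq big_const_seq count_predT iter_addr_0 mulVf ?mulr1//; exact: orbit_card_neq0.
Qed.

Lemma measure_setI_support B : measurable B ->
  mu (B `&` S) = (\sum_(t <- F) \sum_(x <- t) fine (mu [set x]) * (x \in B)%:R)%:E.
Proof.
move=> mB; pose D' := [seq x <- D | x \in B].
have -> : B `&` S = [set` D'].
  apply/seteqP; split => x /=; rewrite mem_filter.
    by move=> [Bx /orbit_pointsP ->]; rewrite mem_set.
  by move=> /andP[/set_mem Bx /orbit_pointsP].
rewrite measure_torus_seq ?filter_uniq ?uniq_D// big_filter.
rewrite (eq_bigr (fun x => (fine (mu [set x]))%:E)) => [|x _]; last first.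
  by rewrite fineK// fin_num_measure//; exact: measurable_torus_set1.
rewrite sumEFin; congr EFin; rewrite big_mkcond /= /D /orbit_points big_flatten big_map.
apply: eq_bigr => t _; apply: eq_bigr => x _.
by case: (x \in B); rewrite ?mulr1 ?mulr0.
Qed.

Lemma orbit_point_mass t x : t \in F -> x \in t ->
  mu [set` t] = (#|` t|%:R * fine (mu [set x]))%:E.
Proof.
move=> tF xt; have [_ tE] := periodic_orbitP (orbF tF) xt.
have -> : [set` t] = [set` (t : seq T2)] by [].
rewrite measure_torus_seq ?fset_uniq// big_seq (eq_bigr (fun=> (fine (mu [set x]))%:E)).
  by rewrite -big_seq sumEFin big_const_seq count_predT iter_addr_0 mulr_natl.
move=> y /tE[k ->]; rewrite fineK ?fin_num_measure//; last exact: measurable_torus_set1.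
exact: (invariant_iter_set1 hdet hmu).
Qed.

(** Invariance makes the points of an orbit equally charged, so on S the measure mu is determined by
    the masses of the orbits; these being w_t mu(S), it is mu(S) delta_(F,w). *)
Lemma measure_support_decomposition B :
  (forall t, t \in F -> mu [set` t] = ((w t)%:E * mu S)%E) -> measurable B ->
  mu (B `&` S) = ((fine (mu S))%:E * orbits_measure F w B)%E.
Proof.
move=> hw mB; rewrite measure_setI_support// orbits_measureE -EFinM; congr EFin.
rewrite mulr_sumr big_seq [RHS]big_seq; apply: eq_bigr => t tF.
rewrite !mulr_sumr big_seq [RHS]big_seq; apply: eq_bigr => x xt.
have := hw _ tF; rewrite (orbit_point_mass tF xt).
rewrite -(fineK (fin_num_measure mu _ measurable_orbits_support)) -EFinM => -[h].
rewrite !mulrA; congr (_ * _); apply: (mulfI (orbit_card_neq0 tF)); rewrite h.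
by field; exact: orbit_card_neq0.
Qed.

End Weighted.
End Orbits.

(** Since nu(S) = 0 and the orbits are disjoint, any decomposition forces beta = mu(S) and mu(t) =
    w_t mu(S) for t in F. Existence is therefore stated under this proportionality, while the
    semiclassical bounds hold for every decomposition. *)
Theorem theorem4p1 (R : realType) (A : 'M[int]_2)
    (hdet : \det A = 1) (htr : 2 < `|\tr A|)
    (hmod2 : map_mx (intr : int -> 'F_2) A = 1%:M \/
             map_mx (intr : int -> 'F_2) A = \matrix_(i, j) (i != j)%:R)
    (mu : probability (torus R) R) (hmu : invariant_measure A mu)
    (F : {fset {fset (torus R)}}) (w : {fset (torus R)} -> R)
    (hF : weighted_orbits A F w) :
  ((forall t, t \in F ->
      mu [set` t] = ((w t)%:E * mu (orbits_support F))%E) ->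
    exists beta nu, orbit_decomposition A mu F w beta nu) /\
  (forall beta nu, orbit_decomposition A mu F w beta nu ->
    semiclassical_measure A mu ->
    (exists2 mac : {measure set (torus R) -> \bar R},
       lebesgue_component mu mac & (beta%:E <= mac setT)%E) /\
    beta <= 2^-1).
Proof.
set S := orbits_support F.
have mS : measurable S := measurable_orbits_support F.
have mSc : measurable (~` S) by exact: measurableC.
have fin (P : probability (torus R) R) B : measurable B -> P B \is a fin_num.
  by move=> mB; rewrite fin_num_measure.
have leb0 : torus_lebesgue S = 0%E by rewrite /S orbits_supportE torus_lebesgue_seq.
have split_mu B : measurable B -> mu B = (mu (B `&` S) + mu (B `&` ~` S))%E.
  move=> mB; rewrite -measureU; first by rewrite -setIUr setUv setIT.
  - exact: measurableI.
  - exact: measurableI.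
  - by rewrite setIACA setICr setI0.
split.
- move=> hw; pose beta := fine (mu S).
  (* The second argument is the value taken when mu(~S) = 0, that is beta = 1: nu must still be an
     invariant probability that does not charge S, and Lebesgue measure is one. *)
  pose nu := mnormalize (mrestr mu mSc) (@torus_lebesgue R).
  have b0 : 0 <= beta by exact: fine_ge0.
  have b1 : beta <= 1 by rewrite -lee_fin fineK ?fin// probability_le1.
  have Sc : mu (~` S) = (1 - beta)%:E by rewrite probability_setC// EFinB fineK ?fin.
  have nuE B : nu B = if (1 - beta)%:E == 0%E then torus_lebesgue B
      else (mu (B `&` ~` S) * ((1 - beta)^-1)%:E)%E.
    have eT : mrestr mu mSc setT = (1 - beta)%:E by rewrite /mrestr setTI Sc.
    have -> : (1 - beta)%:E == 0%E = (mrestr mu mSc setT == 0%E) || (mrestr mu mSc setT == +oo%E).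
      by rewrite eT orbF.
    have -> : 1 - beta = fine (mrestr mu mSc setT) by rewrite eT.
    by rewrite /nu /mnormalize; case: (_ || _).
  exists beta, nu; split.
  + by rewrite b0 b1.
  + move=> B mB; change (nu (torus_map A @^-1` B) = nu B); rewrite !nuE.
    case: ifP => _; first exact: (torus_lebesgue_invariant hdet mB).
    congr (_ * _)%E; rewrite -(hmu _ (measurableI _ _ mB mSc)) preimage_setI.
    by rewrite -(preimage_setC (torus_map A) S) (torus_map_support hdet hF).
  + change (nu S = 0%E); rewrite nuE; case: ifP => _; first exact: leb0.
    by rewrite setICr measure0 mul0e.
  + move=> B mB; change (mu B = (beta%:E * orbits_measure F w B + (1 - beta)%:E * nu B)%E).
    rewrite split_mu// (measure_support_decomposition hdet hmu hF hw mB).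
    congr (_ + _)%E; rewrite nuE eqe; case: eqVneq => [b1e|b1n].
      have Sc0 : mu (~` S) = 0%E by rewrite Sc b1e.
      rewrite b1e mul0e; apply/eqP; rewrite eq_le measure_ge0 andbT -Sc0.
      by rewrite le_measure ?inE//; exact: measurableI.
    by rewrite muleCA -EFinM mulfV// mule1.
- move=> beta nu [/andP[b0 b1] hnu nuS dec] semi.
  have muS : mu S = beta%:E.
    by rewrite dec// (orbits_measure_support hF) nuS mule0 adde0 mule1.
  have lower B : measurable B -> beta * fine (torus_lebesgue B) <= fine (mu B).
    move=> mB; have := semiclassical_lower_bound hdet htr hmu semi (uniq_D hF) (orbit_points_periodic hF) mB.
    by rewrite -orbits_supportE muS.
  have lebC C : measurable C -> torus_lebesgue C = 0%E -> torus_lebesgue (~` C) = 1%E.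
    move=> mC C0; have -> : torus_lebesgue (~` C) = (1 - torus_lebesgue C)%E by exact: probability_setC.
    by rewrite C0 sube0.
  split; last first.
    have := lower _ mSc; rewrite lebC// mulr1 probability_setC// muS -EFinB /=; lra.
  (* Restricting mu to Z and to its complement gives the Lebesgue decomposition: outside Z, no
     Lebesgue-null set is charged. *)
  have [Z [mZ Z0 hZ]] := maximal_null_set mu (@torus_lebesgue R).
  have mZc : measurable (~` Z) by exact: measurableC.
  exists (mrestr mu mZc).
    split.
      by apply/null_content_dominatesP => B mB B0; exact: hZ.
    exists (mrestr mu mZ); split.
      by exists Z; split => //; change (mu (~` Z `&` Z) = 0%E); rewrite setICl measure0.
    move=> B mB; change (mu B = (mu (B `&` ~` Z) + mu (B `&` Z))%E).
    rewrite -measureU; first by rewrite -setIUr setUC setUv setIT.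
    - exact: measurableI.
    - exact: measurableI.
    - by rewrite setIACA setICl setI0.
  (* The complement of Z has full Lebesgue measure, so mu >= beta Leb on it bounds the mass of the
     absolutely continuous part. *)
  change (beta%:E <= mu (setT `&` ~` Z))%E; rewrite setTI -(fineK (fin mu _ mZc)) lee_fin.
  by have := lower _ mZc; rewrite lebC// mulr1.
Qed.
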